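(* Let $\Omega$ and $F$ be as in the context. Suppose $u,v\in C(\bar\Omega)$ and $f\in C(\Omega)$ satisfy, in the viscosity sense, $$F(D^2u,Du,u,x)\le f\le F(D^2v,Dv,v,x)\quad\text{in }\Omega,$$ and $u(\tilde x)>v(\tilde x)$ for some $\tilde x\in\Omega$. Assume also that one of the following holds: (i) $f\le0$ and $u<0$ in $\Omega$, and $v\ge0$ on $\partial\Omega$; or (ii) $f\ge0$ and $v>0$ in $\Omega$, and $u\le0$ on $\partial\Omega$. Then $v\equiv tu$ for some $t>0$.
   Context: $\Omega\subseteq\mathbb{R}^n$ is a bounded, smooth, connected open set; $\mathbb{S}^n$ denotes the real symmetric $n\times n$ matrices. For $0<\gamma\le\Gamma$ and $M\in\mathbb{S}^n$ the Pucci operators are $\mathcal{P}^+_{\gamma,\Gamma}(M)=\sup_A[-\mathrm{tr}(AM)]$ and $\mathcal{P}^-_{\gamma,\Gamma}(M)=\inf_A[-\mathrm{tr}(AM)]$, with $A$ ranging over symmetric matrices whose eigenvalues lie in $[\gamma,\Gamma]$. The nonlinearity $F:\mathbb{S}^n\times\mathbb{R}^n\times\mathbb{R}\times\Omega\to\mathbb{R}$ satisfies: (F1) for each $K>0$ there are an increasing continuous $\omega_K:[0,\infty)\to[0,\infty)$ with $\omega_K(0)=0$ and $\nu\in(1/2,1]$ such that $|F(M,p,z,x)-F(M,p,z,y)|\le\omega_K(|x-y|^\nu(|M|+1))$ whenever $|p|,|z|\le K$; (F2) there are constants $\delta_1,\delta_0\ge0$, $0<\gamma\le\Gamma$ with $\mathcal{P}^-_{\gamma,\Gamma}(M-N)-\delta_1|p-q|-\delta_0|z-w|\le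 F(M,p,z,x)-F(N,q,w,x)\le\mathcal{P}^+_{\gamma,\Gamma}(M-N)+\delta_1|p-q|+\delta_0|z-w|$ for all arguments; (F3) $F(tM,tp,tz,x)=tF(M,p,z,x)$ for all $t\ge0$. Viscosity sense: for $f\in C(\Omega)$, $u\in C(\Omega)$ satisfies $F(D^2u,Du,u,x)\le f$ ($\ge f$) if whenever $\varphi\in C^2(\Omega)$ and $u-\varphi$ has a local maximum (minimum) at $x_0$, then $F(D^2\varphi(x_0),D\varphi(x_0),u(x_0),x_0)\le f(x_0)$ (resp. $\ge$). *)

(* Defs.v *)
From HB Require Import structures.
From mathcomp Require Import all_boot all_order all_algebra.
From mathcomp Require Import all_classical all_reals all_analysis.
Set Implicit Arguments. Unset Strict Implicit. Unset Printing Implicit Defensive.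
Import Order.TTheory GRing.Theory Num.Theory.
Import numFieldNormedType.Exports.
Local Open Scope classical_set_scope.
Local Open Scope ring_scope.

Section PDEDefs.
Variables (R : realType) (n : nat).
Local Notation V := 'rV[R]_n.

Definition basis_vec (i : 'I_n) : V := delta_mx 0 i.

Definition partial (i : 'I_n) (g : V -> R) : V -> R :=
  fun x => derive g x (basis_vec i).

Definition iter_partial (s : seq 'I_n) (g : V -> R) : V -> R :=
  foldr partial g s.

Definition grad (g : V -> R) (x : V) : V := \row_i partial i g x.
Definition hess (g : V -> R) (x : V) : 'M[R]_n :=
  \matrix_(i, j) partial j (partial i g) x.

Definition C2_on (O : set V) (g : V -> R) : Prop :=
  forall x, O x ->
    [/\ {for x, continuous g},
        forall i, derivable g x (basis_vec i) /\ {for x, continuous (partial i g)}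
      & forall i j, derivable (partial i g) x (basis_vec j) /\
                    {for x, continuous (partial j (partial i g))}].

Definition smooth (g : V -> R) : Prop :=
  forall s : seq 'I_n,
    continuous (iter_partial s g) /\
    forall i x, derivable (iter_partial s g) x (basis_vec i).

Definition bdry (O : set V) : set V := closure O `\` interior O.

(* O is a bounded open set with smooth (C^oo) boundary: it admits a global
   smooth defining function rho with O = {rho < 0}, bdry O = {rho = 0}
   and D rho <> 0 on bdry O. *)
Definition smooth_bounded_domain (O : set V) : Prop :=
  open O /\ bounded_set O /\
  exists rho : V -> R, [/\ smooth rho,
    O = [set x | rho x < 0], bdry O = [set x | rho x = 0]
  & forall x, bdry O x -> grad rho x != 0].

Definition symmetric (M : 'M[R]_n) : Prop := M^T = M.

Definition ellip_set (gam Gam : R) : set 'M[R]_n :=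
  [set A | symmetric A /\ forall a, eigenvalue A a -> gam <= a <= Gam].

Definition pucci_plus (gam Gam : R) (M : 'M[R]_n) : R :=
  sup [set - \tr (A *m M) | A in ellip_set gam Gam].
Definition pucci_minus (gam Gam : R) (M : 'M[R]_n) : R :=
  inf [set - \tr (A *m M) | A in ellip_set gam Gam].

Definition local_max (g : V -> R) (x0 : V) : Prop :=
  \forall y \near x0, g y <= g x0.
Definition local_min (g : V -> R) (x0 : V) : Prop :=
  \forall y \near x0, g x0 <= g y.

Definition NLop := 'M[R]_n -> V -> R -> V -> R.

Definition visc_sub (F : NLop) (O : set V) (u f : V -> R) : Prop :=
  forall (phi : V -> R) (x0 : V), C2_on O phi -> O x0 ->
    local_max (fun y => u y - phi y) x0 ->
    F (hess phi x0) (grad phi x0) (u x0) x0 <= f x0.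

Definition visc_super (F : NLop) (O : set V) (u f : V -> R) : Prop :=
  forall (phi : V -> R) (x0 : V), C2_on O phi -> O x0 ->
    local_min (fun y => u y - phi y) x0 ->
    f x0 <= F (hess phi x0) (grad phi x0) (u x0) x0.

Definition cond_F1 (F : NLop) (O : set V) : Prop :=
  forall K : R, 0 < K ->
    exists (omega : R -> R) (nu : R),
      [/\ [/\ {within [set s | 0 <= s], continuous omega},
              (forall a b, 0 <= a -> a < b -> omega a < omega b),
              (forall s, 0 <= s -> 0 <= omega s) &
              omega 0 = 0],
          1 / 2 < nu <= 1
        & forall M p z x y, symmetric M -> O x -> O y ->
            `|p| <= K -> `|z| <= K ->
            `|F M p z x - F M p z y| <= omega (`|x - y| `^ nu * (`|M| + 1))].

Definition cond_F2 (F : NLop) (O : set V) (d1 d0 gam Gam : R) : Prop :=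
  [/\ 0 <= d1, 0 <= d0, 0 < gam, gam <= Gam &
    forall M N p q z w x, symmetric M -> symmetric N -> O x ->
      pucci_minus gam Gam (M - N) - d1 * `|p - q| - d0 * `|z - w|
        <= F M p z x - F N q w x /\
      F M p z x - F N q w x
        <= pucci_plus gam Gam (M - N) + d1 * `|p - q| + d0 * `|z - w|].

Definition cond_F3 (F : NLop) (O : set V) : Prop :=
  forall (t : R) M p z x, 0 <= t -> symmetric M -> O x ->
    F (t *: M) (t *: p) (t * z) x = t * F M p z x.

End PDEDefs.

(* Main.v *)
Require Import Defs.
From HB Require Import structures.
From mathcomp Require Import all_boot all_order all_algebra.
From mathcomp Require Import all_classical all_reals all_analysis.
From mathcomp Require Import ring lra.
Set Implicit Arguments. Unset Strict Implicit. Unset Printing Implicit Defensive.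
Import Order.TTheory GRing.Theory Num.Theory.
Import numFieldNormedType.Exports.
Local Open Scope classical_set_scope.
Local Open Scope ring_scope.

(* Assume (ii) and let s* be the largest s with s u <= v. For 0 < s <= 1 the function w = s u - v
   satisfies P^-(D^2 w) - d1 |Dw| - d0 |w| <= (s - 1) f <= 0 in the viscosity sense. Hence, if s* u
   touches v inside the domain, the strong maximum principle gives v = s* u. Otherwise v - s* u is
   bounded below on compact subsets, and a maximum principle in the thin strip {-a <= rho < 0}
   shows that s can be increased beyond s*. Case (i) is case (ii) for
   -F(-M,-p,-z,x) and the pair (-v,-u).

   The inequality for w comes from doubling variables with the penalization
   L (sqrt(e^2 + |z|^2) - |z|^2), z = x - y: either the Hessian gap N = M - (X - Y) has trace
   larger than L and, by homogeneity, gam tr N absorbs the error made in (F1), or |z| is so small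
   that this error is negligible; nu > 1/2 is what makes |z|^nu |Y| small since |Y| is of order
   sqrt(tr N / |z|). *)

(** * Norms and the dot product *)

(** The obstacle in the doubling step is a circular choice of constants: the modulus in (F1) depends
    on a bound for the gradient, the gradient of the penalization has size about [L], and [L] must
    be large to bring the two points together. Homogeneity breaks the circle. All arguments of [F]
    are divided by [T = tr N + 1]. When the trace of the gap is at least [4 L], the rescaled
    gradient is bounded independently of [L], so the modulus in use can be fixed before [L].
    Otherwise a modulus depending on [L] is used, and [e], chosen after it, forces the points
    together. Since [F] need not be monotone in [z], the difference w has no maximum principle on
    the whole domain. What remains is the thin strip, where a barrier with large second derivative
    across the boundary beats the term with d0. The point where u > v gives s* < 1, which leaves
    room to increase s without losing s <= 1. *)

Lemma mxnorm_leP (R : realType) m n (x : 'M[R]_(m, n)) (c : R) : 0 <= c ->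
  reflect (forall i j, `|x i j| <= c) (`|x| <= c).
Proof.
move=> c0; rewrite /Num.norm /= mx_normrE; apply: (iffP (bigmax_leP _ _ _ _)).
  by move=> [_ H] i j; exact: (H (i, j)).
by move=> H; split=> // -[i j] _; exact: H.
Qed.

Lemma coord_le_mxnorm (R : realType) m n (x : 'M[R]_(m, n)) i j : `|x i j| <= `|x|.
Proof. by move/mxnorm_leP: (lexx `|x|); apply. Qed.

(** The norm on matrices is the maximum of the absolute values of the entries. Euclidean quantities
    go through [dot], and passing between the two costs factors [n%:R], see [dot_le_norm] and
    [norm_le_dot]. *)
Definition dot (R : pzRingType) n (x y : 'rV[R]_n) : R := (x *m y^T) 0 0.

Section Dot.
Variables (R : realType) (n : nat).
Implicit Types (x y z : 'rV[R]_n) (A B : 'M[R]_n) (a b : R).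

Lemma dotE x y : dot x y = \sum_k x 0 k * y 0 k.
Proof. by rewrite /dot mxE; apply: eq_bigr => k _; rewrite mxE. Qed.

Lemma dotC x y : dot x y = dot y x.
Proof. by rewrite !dotE; apply: eq_bigr => k _; rewrite mulrC. Qed.

Lemma dotDl x y z : dot (x + y) z = dot x z + dot y z.
Proof. by rewrite /dot mulmxDl mxE. Qed.

Lemma dotDr x y z : dot z (x + y) = dot z x + dot z y.
Proof. by rewrite !(dotC z) dotDl. Qed.

Lemma dotZl a x y : dot (a *: x) y = a * dot x y.
Proof. by rewrite /dot -scalemxAl mxE. Qed.

Lemma dotZr a x y : dot x (a *: y) = a * dot x y.
Proof. by rewrite dotC dotZl dotC. Qed.

Lemma dotNl x y : dot (- x) y = - dot x y.
Proof. by rewrite /dot mulNmx mxE. Qed.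

Lemma dotNr x y : dot x (- y) = - dot x y.
Proof. by rewrite dotC dotNl dotC. Qed.

Lemma dot0l y : dot 0 y = 0.
Proof. by rewrite /dot mul0mx mxE. Qed.

Lemma dot0r y : dot y 0 = 0.
Proof. by rewrite dotC dot0l. Qed.

Definition dot_lin := (dotDl, dotDr, dotNl, dotNr, dotZl, dotZr, dot0l, dot0r).

Lemma mulmx_scaler x a A : x *m (a *: A) = a *: (x *m A).
Proof. by rewrite -scalemxAr. Qed.

Lemma mulmx_scalel x a A : (a *: x) *m A = a *: (x *m A).
Proof. by rewrite -scalemxAl. Qed.

Definition quad_lin := (mulmxDl, mulmxDr, mulNmx, mulmxN, mulmx_scalel,
  mulmx_scaler, mul0mx, mulmx0, mulmx1, dot_lin).

Lemma dot_mul_tr A x y : dot (x *m A) y = dot x (y *m A^T).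
Proof. by rewrite /dot trmx_mul trmxK mulmxA. Qed.

Lemma dot_sym A x y : A^T = A -> dot (x *m A) y = dot (y *m A) x.
Proof. by move=> sA; rewrite dot_mul_tr sA dotC. Qed.

Lemma dot_ge0 x : 0 <= dot x x.
Proof. by rewrite dotE; apply: sumr_ge0 => k _; rewrite -expr2 sqr_ge0. Qed.

Lemma dot_eq0 x : dot x x = 0 -> x = 0.
Proof.
rewrite dotE => /eqP; rewrite psumr_eq0; last by move=> k _; rewrite -expr2 sqr_ge0.
move=> /allP H; apply/rowP => k; rewrite mxE.
by have := H k (mem_index_enum _); rewrite /= -expr2 sqrf_eq0 => /eqP.
Qed.

Lemma dot_gt0 x : x != 0 -> 0 < dot x x.
Proof.
move=> x0; rewrite lt_neqAle dot_ge0 andbT eq_sym; apply: contra x0.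
by move=> /eqP/dot_eq0 ->.
Qed.

Lemma dot_bound x y : `|dot x y| <= n%:R * `|x| * `|y|.
Proof.
rewrite dotE; apply: le_trans (ler_norm_sum _ _ _) _.
apply: (@le_trans _ _ (\sum_(k < n) `|x| * `|y|)).
  by apply: ler_sum => k _; rewrite normrM ler_pM // coord_le_mxnorm.
by rewrite sumr_const card_ord -mulrA mulr_natl.
Qed.

Lemma dot_le_norm x : dot x x <= n%:R * `|x| ^+ 2.
Proof. by rewrite expr2 mulrA; apply: le_trans (dot_bound _ _); rewrite ler_norm. Qed.

Lemma norm_le_dot x : `|x| ^+ 2 <= dot x x.
Proof.
have /mxnorm_leP : forall i j, `|x i j| <= Num.sqrt (dot x x).
  move=> i j; rewrite -sqrtr_sqr ler_sqrt ?dot_ge0 // dotE (bigD1 j) //= ord1 expr2.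
  by rewrite lerDl sumr_ge0 // => k _; rewrite -expr2 sqr_ge0.
move=> /(_ (sqrtr_ge0 _)) H.
by rewrite -(sqr_sqrtr (dot_ge0 x)) ler_sqr ?nnegrE ?sqrtr_ge0.
Qed.

Lemma mulmx_bound x A : `|x *m A| <= n%:R * `|x| * `|A|.
Proof.
apply/mxnorm_leP => [|i j]; first by rewrite !mulr_ge0.
rewrite mxE; apply: le_trans (ler_norm_sum _ _ _) _.
apply: (@le_trans _ _ (\sum_(k < n) `|x| * `|A|)).
  by apply: ler_sum => k _; rewrite normrM ler_pM // coord_le_mxnorm.
by rewrite sumr_const card_ord -mulrA mulr_natl.
Qed.

Lemma quad_bound x A y : `|dot (x *m A) y| <= n%:R ^+ 2 * `|A| * `|x| * `|y|.
Proof.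
apply: le_trans (dot_bound _ _) _.
rewrite -[_ * `|x *m A| * _]mulrAC [leRHS](_ : _ = n%:R * `|y| * (n%:R * `|x| * `|A|)); last by ring.
by rewrite ler_wpM2l ?mulr_ge0 ?mulmx_bound.
Qed.

Lemma CS_dot x y : dot x y ^+ 2 <= dot x x * dot y y.
Proof.
have [->|y0] := eqVneq y 0; first by rewrite !dot_lin expr0n mulr0.
have yy := dot_gt0 y0.
have := dot_ge0 (dot y y *: x - dot x y *: y).
rewrite !dot_lin (dotC y x) => H.
have : 0 <= dot y y * (dot x x * dot y y - dot x y ^+ 2) by apply: le_trans H _; nra.
by rewrite pmulr_rge0 // subr_ge0.
Qed.

Lemma dot_delta x i : dot x (delta_mx 0 i) = x 0 i.
Proof.
rewrite dotE (bigD1 i) //= !mxE !eqxx mulr1 big1 ?addr0 // => k ki.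
by rewrite !mxE (negbTE ki) andbF mulr0.
Qed.

Lemma quad_delta A i j : dot (delta_mx 0 i *m A) (delta_mx 0 j) = A i j.
Proof. by rewrite dot_delta -rowE mxE. Qed.

Lemma norm_delta_le i : `|delta_mx 0 i : 'rV[R]_n| <= 1.
Proof.
by apply/mxnorm_leP => // k j; rewrite mxE; case: (_ && _); rewrite ?normr1 ?normr0.
Qed.

End Dot.

Lemma eq_ler (R : numDomainType) (x y : R) : x = y -> x <= y.
Proof. by move=> ->. Qed.

(** * Regularity on grids of cubes *)

Section Average.
Variables (R : realType) (T : finType).
Implicit Types f g : T -> R.

Definition avg f : R := #|T|%:R^-1 * \sum_t f t.

Lemma eq_avg f g : f =1 g -> avg f = avg g.
Proof. by move=> fg; rewrite /avg; congr (_ * _); apply: eq_bigr => t _. Qed.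

Lemma avgD f g : avg (fun t => f t + g t) = avg f + avg g.
Proof. by rewrite /avg big_split mulrDr. Qed.

Lemma avgZ c f : avg (fun t => c * f t) = c * avg f.
Proof. by rewrite /avg -mulr_sumr mulrCA. Qed.

Lemma avgB f g : avg (fun t => f t - g t) = avg f - avg g.
Proof. by rewrite /avg sumrB mulrBr. Qed.

Lemma avg_sum (D : finType) (F : D -> T -> R) :
  avg (fun t => \sum_k F k t) = \sum_k avg (F k).
Proof. by rewrite /avg exchange_big mulr_sumr. Qed.

Hypothesis T0 : (0 < #|T|)%N.

Lemma avg_cst c : avg (fun=> c) = c.
Proof.
rewrite /avg sumr_const -[c *+ _]mulr_natl mulrA mulVf ?mul1r //.
by rewrite pnatr_eq0 -lt0n.
Qed.

Lemma ler_avg f g : (forall t, f t <= g t) -> avg f <= avg g.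
Proof. by move=> fg; rewrite /avg ler_wpM2l ?invr_ge0 // ler_sum. Qed.

Lemma avg_norm_le f c : (forall t, `|f t| <= c) -> `|avg f| <= c.
Proof.
move=> H; rewrite ler_norml -{1}(avg_cst c) -{2}(avg_cst c).
rewrite -mulN1r -avgZ; apply/andP; split; apply: ler_avg => t;
  by have := H t; rewrite ler_norml => /andP[]; rewrite ?mulN1r.
Qed.

(** The mean of the squares is the square of the mean plus the variance. Only the term at [t0] of
    the variance is kept: it is the energy gained in [regular_node] when one child deviates. *)
Lemma avg_sqr_ge f t0 :
  avg f ^+ 2 + #|T|%:R^-1 * (f t0 - avg f) ^+ 2 <= avg (fun t => f t ^+ 2).
Proof.
set m := avg f.
have -> : avg (fun t => f t ^+ 2) = m ^+ 2 + avg (fun t => (f t - m) ^+ 2).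
  rewrite (@eq_avg (fun t => (f t - m) ^+ 2) (fun t => f t ^+ 2 + ((- (2 * m)) * f t + m ^+ 2))); last first.
    by move=> t; ring.
  by rewrite !avgD avgZ avg_cst -/m; ring.
rewrite lerD2l /avg ler_wpM2l ?invr_ge0 // (bigD1 t0) //= lerDl.
by apply: sumr_ge0 => t _; rewrite sqr_ge0.
Qed.

Lemma avg_exists_ge f c : c <= avg f -> exists t, c <= f t.
Proof.
move=> cf; apply: contrapT => /forallNP H.
have {}H t : f t < c by rewrite ltNge; apply/negP/H.
have : avg f < c.
  rewrite -(avg_cst c) /avg ltr_pM2l ?invr_gt0 ?ltr0n //.
  have [t0 _] : exists t0 : T, t0 \in T by apply/card_gt0P.
  by apply: ltr_sum => //; apply/hasP; exists t0; rewrite ?mem_index_enum.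
by rewrite ltNge cf.
Qed.

End Average.

(* Energy increment.  On a tree of bounded averages, a node that is not within
   [theta] of all its children raises the mean energy of the next generation by
   [theta^2 / #|T|]; boundedness of the energy then forces a node that is close
   to all its children, even among the nodes where the component [k0] is not
   too small. *)
Lemma regular_node (R : realType) (T D : finType) (k0 : D) (B d theta : R) :
  (0 < #|T|)%N -> 0 < d -> 0 < theta ->
  exists J : nat, forall (A : Type) (ch : nat -> A -> T -> A)
      (X : nat -> A -> D -> R) (a : A),
    (forall j a k, X j.+1 a k = avg (fun t => X j (ch j a t) k)) ->
    (forall a k, `|X 0%N a k| <= B) ->
    (forall a, 0 <= X 0%N a k0 <= 1) ->
    d <= X J a k0 ->
    exists j b, [/\ (j < J)%N, d / 2 <= X j.+1 b k0 &
      forall t k, `|X j (ch j b t) k - X j.+1 b k| <= theta].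
Proof.
move=> T0 d0 th0.
have cT : 0 < #|T|%:R :> R by rewrite ltr0n.
pose beta := #|T|%:R^-1 * theta ^+ 2.
have b0 : 0 < beta by rewrite mulr_gt0 ?invr_gt0 ?exprn_gt0.
pose E := #|D|%:R * B ^+ 2.
have E0 : 0 <= E by rewrite mulr_ge0 ?sqr_ge0.
(* Enough levels for the accumulated gain [beta * (d / 2)] per level to exceed [E], the largest
   possible energy. *)
pose J := Num.bound (E / (beta * (d / 2))).
exists J => A ch X a Xavg XB X01 da.
apply: contrapT => /forallNP ng.
have X1 j b : X j b k0 <= 1.
  elim: j b => [|j IH] b; first by case/andP: (X01 b).
  by rewrite Xavg -(avg_cst T0 1) ler_avg.
(* The second term is affine in [X j b k0], hence compatible with averaging. Per level it asks for a
   gain of at most [beta] where [X j b k0 >= d / 2], and for none elsewhere, so no node has to be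
   discarded. *)
have claim j b : (j <= J)%N -> \sum_k X j b k ^+ 2 + j%:R * (beta * (X j b k0 - d / 2)) <= E.
  elim: j b => [|j IH] b jJ.
    rewrite mul0r addr0 /E -[leRHS](_ : \sum_(k : D) B ^+ 2 = _); last first.
      by rewrite sumr_const mulr_natl.
    apply: ler_sum => k _; rewrite -real_normK ?num_real //.
    by rewrite lerXn2r ?nnegrE ?XB // (le_trans _ (XB b k)).
  have : avg (fun t => \sum_k X j (ch j b t) k ^+ 2 +
             j%:R * (beta * (X j (ch j b t) k0 - d / 2))) <= E.
    by rewrite -(avg_cst T0 E); apply: ler_avg => t; exact: IH (ltnW jJ).
  rewrite avgD avgZ avgZ avgB (avg_cst T0) -Xavg avg_sum; apply: le_trans.
  rewrite -natr1 mulrDl mul1r [X in _ + X <= _]addrC addrA lerD2r.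
  have le_energy (k : D) (t : T) : X j.+1 b k ^+ 2 +
      #|T|%:R^-1 * (X j (ch j b t) k - X j.+1 b k) ^+ 2 <=
      avg (fun t => X j (ch j b t) k ^+ 2).
    by rewrite Xavg; exact: avg_sqr_ge.
  have le_energy0 (k : D) : X j.+1 b k ^+ 2 <= avg (fun t => X j (ch j b t) k ^+ 2).
    have [t _] : exists t0 : T, t0 \in T by apply/card_gt0P.
    by apply: le_trans (le_energy k t); rewrite lerDl mulr_ge0 ?invr_ge0 ?sqr_ge0.
  have [dX|Xd] := leP (d / 2) (X j.+1 b k0); last first.
    apply: (@le_trans _ _ (\sum_k X j.+1 b k ^+ 2)); last by apply: ler_sum.
    by rewrite gerDl pmulr_rle0 // subr_le0 ltW.
  have [t [k tk]] : exists t k, theta < `|X j (ch j b t) k - X j.+1 b k|.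
    apply: contrapT => /forallNP H; apply: (ng j); exists b; split=> // t k.
    rewrite leNgt; apply/negP => tk; apply: (H t); by exists k.
  apply: (@le_trans _ _ (\sum_k X j.+1 b k ^+ 2 + beta)).
    rewrite lerD2l ler_piMr ?ltW //.
    by have := X1 j.+1 b; lra.
  rewrite [X in X + _ <= _](bigD1 k) //= [X in _ <= X](bigD1 k) //= addrAC lerD //.
    apply: le_trans (le_energy k t); rewrite lerD2l ler_wpM2l ?invr_ge0 //.
    by rewrite -[X in _ <= X]real_normK ?num_real // lerXn2r ?nnegrE ?(ltW th0) ?(ltW tk).
  by apply: ler_sum.
have := claim J a (leqnn J).
have EJ : E < J%:R * (beta * (d / 2)).
  have bd0 : 0 < beta * (d / 2) by rewrite mulr_gt0 ?divr_gt0.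
  by rewrite -ltr_pdivrMr //; apply: archi_boundP; rewrite divr_ge0 // ltW.
have : 0 <= \sum_k X J a k ^+ 2 by apply: sumr_ge0 => k _; rewrite sqr_ge0.
have : J%:R * (beta * (d / 2)) <= J%:R * (beta * (X J a k0 - d / 2)).
  by rewrite ler_wpM2l // ler_wpM2l ?(ltW b0) //; lra.
by move: EJ; lra.
Qed.

(** Extension by an infimum of cones, attained because [P] is finite. It turns the slopes, known
    only at contact points, into functions on the whole space whose difference quotients can be
    averaged over grids. *)
Lemma mcshane (R : realType) (P : finType) (N : nat) (Z : P -> 'rV[R]_N)
    (f : P -> R) (K : R) (i0 : P) :
  0 <= K -> (forall i j, f i - f j <= K * `|Z i - Z j|) ->
  exists g : 'rV[R]_N -> R, (forall i, g (Z i) = f i) /\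
    forall x y, `|g x - g y| <= K * `|x - y|.
Proof.
move=> K0 fK.
have ex x : exists i, forall j, f i + K * `|x - Z i| <= f j + K * `|x - Z j|.
  have [i _ iP] := @arg_minP _ _ _ i0 xpredT (fun i => f i + K * `|x - Z i|) isT.
  by exists i => j; exact: iP.
pose m x := projT1 (cid (ex x)).
have mP x j : f (m x) + K * `|x - Z (m x)| <= f j + K * `|x - Z j|.
  by rewrite /m; case: cid.
exists (fun x => f (m x) + K * `|x - Z (m x)|); split=> [i|].
  apply/eqP; rewrite eq_le; apply/andP; split.
    by have := mP (Z i) i; rewrite subrr normr0 mulr0 addr0.
  by have := fK i (m (Z i)); lra.
have half x y : f (m x) + K * `|x - Z (m x)| - (f (m y) + K * `|y - Z (m y)|)
    <= K * `|x - y|.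
  have := mP x (m y).
  have : K * `|x - Z (m y)| <= K * `|x - y| + K * `|y - Z (m y)|.
    by rewrite -mulrDr ler_wpM2l // (le_trans _ (ler_normD _ _)) // addrA subrK.
  by lra.
move=> x y; rewrite ler_norml half andbT.
by have := half y x; rewrite (distrC y x); lra.
Qed.

Section Grid.
Variables (R : realType) (N M' : nat).
Local Notation M := (M'.+1).
Local Notation T := {ffun 'I_N -> 'I_M}.
Implicit Types (t : T) (i : 'I_N) (c : 'I_M) (a x : 'rV[R]_N).

Definition grid_vec t : 'rV[R]_N := \row_i (t i : nat)%:R.
Definition upd t i c : T := [ffun k => if k == i then c else t k].
Local Notation e_ i := (delta_mx 0 i : 'rV[R]_N).

Lemma cardT_gt0 : (0 < #|{: T}|)%N.
Proof. by apply/card_gt0P; exists [ffun=> ord0]. Qed.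

Lemma avg_upd i (f : T -> R) :
  avg f = avg (fun t => M%:R^-1 * \sum_c f (upd t i c)).
Proof.
rewrite avgZ /avg mulrCA; congr (_ * _).
rewrite pair_big /=.
(* Exchanging [t i] with the new value [c] is an involution on the pairs [(t, c)]. *)
pose g (p : T * 'I_M) := (upd p.1 i p.2, p.1 i).
have gK : involutive g.
  move=> [t c]; rewrite /g /=; congr (_, _); last by rewrite ffunE eqxx.
  by apply/ffunP => k; rewrite !ffunE; case: eqP => // ->.
have -> : \sum_(p : T * 'I_M) f (upd p.1 i p.2) = \sum_(p : T * 'I_M) f p.1.
  by rewrite [RHS](reindex_inj (inv_inj gK)); apply: eq_bigr => p _.
rewrite -(pair_big xpredT xpredT (fun t (c : 'I_M) => f t)) /=.
have -> : \sum_t \sum_(c < M) f t = M%:R * \sum_t f t.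
  by rewrite mulr_sumr; apply: eq_bigr => t _; rewrite sumr_const card_ord mulr_natl.
by rewrite mulrA mulVf ?mul1r // pnatr_eq0.
Qed.

Lemma grid_vec_upd t i c : grid_vec (upd t i c) = grid_vec (upd t i ord0) + (c : nat)%:R *: e_ i.
Proof.
apply/rowP => k; rewrite !mxE !ffunE eqxx /=.
by case: eqP => _; rewrite ?mulr1 ?mulr0 ?addr0 ?add0r.
Qed.

Lemma norm_grid_vec_le t : `|grid_vec t| <= M'%:R.
Proof.
apply/mxnorm_leP => // k i; rewrite mxE normr_nat ler_nat.
by rewrite -ltnS.
Qed.

Variable h : R.
Hypothesis h0 : 0 < h.

Definition side j : R := h * M%:R ^+ j.

Lemma side_gt0 j : 0 < side j.
Proof. by rewrite /side mulr_gt0 ?exprn_gt0. Qed.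

Lemma sideS j : side j.+1 = M%:R * side j.
Proof. by rewrite /side exprS mulrCA. Qed.

(* Mean of [X0] over the [M^(j N)] points of a grid; [face i j] is the same mean over a facet
   orthogonal to [e_i], so that [face_incr] telescopes the difference quotients. *)
Fixpoint cube_avg (X0 : 'rV[R]_N -> R) j a : R :=
  if j is j'.+1 then avg (fun t => cube_avg X0 j' (a + side j' *: grid_vec t)) else X0 a.

Lemma cube_avg_norm_le X0 (B : R) : (forall a, `|X0 a| <= B) ->
  forall j a, `|cube_avg X0 j a| <= B.
Proof.
move=> H; elim=> [|j IH] a //=.
by apply: (avg_norm_le cardT_gt0) => t.
Qed.

Lemma cube_avg_exists_ge X0 (c : R) j k a : c <= cube_avg X0 (j + k)%N a ->
  exists b, c <= cube_avg X0 k b.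
Proof.
elim: j a => [|j IH] a; first by exists a.
by rewrite addSn /= => /(avg_exists_ge cardT_gt0)[t /IH].
Qed.

Variables (G : 'rV[R]_N -> R) (K : R).
Hypothesis K0 : 0 <= K.
Hypothesis GK : forall x y, `|G x - G y| <= K * `|x - y|.

Definition diff_quot i a : R := (G (a + h *: e_ i) - G a) / h.

Lemma diff_quot_le i a : `|diff_quot i a| <= K.
Proof.
rewrite /diff_quot normrM (normrV (unitf_gt0 h0)) (gtr0_norm h0) ler_pdivrMr //.
apply: le_trans (GK _ _) _; rewrite ler_wpM2l // addrAC subrr add0r normrZ gtr0_norm //.
by rewrite ler_piMr ?norm_delta_le // ltW.
Qed.

Fixpoint face i j a : R :=
  if j is j'.+1 then avg (fun t => face i j' (a + side j' *: grid_vec (upd t i ord0)))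
  else G a.

Lemma face_near i j a : `|face i j a - G a| <= K * side j.
Proof.
elim: j a => [|j IH] a /=.
  by rewrite subrr normr0 mulr_ge0 // ltW // side_gt0.
rewrite -(avg_cst cardT_gt0 (G a)) -avgB; apply: (avg_norm_le cardT_gt0) => t.
set b := a + _; rewrite -[_ - G a](subrKA (G b)).
apply: le_trans (ler_normD _ _) _.
rewrite sideS -[M]addn1 natrD mulrDl mul1r mulrDr addrC lerD //.
apply: le_trans (GK _ _) _; rewrite ler_wpM2l // /b addrAC subrr add0r normrZ.
by rewrite gtr0_norm ?side_gt0 // mulrC ler_wpM2r ?norm_grid_vec_le // ltW // side_gt0.
Qed.

Lemma face_incr i j a :
  side j * cube_avg (diff_quot i) j a = face i j (a + side j *: e_ i) - face i j a.
Proof.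
elim: j a => [|j IH] a.
  by rewrite /= /side expr0 mulr1 /diff_quot mulrC divfK // gt_eqF.
rewrite [LHS]/= sideS -mulrA -avgZ.
rewrite (eq_avg (fun t => IH (a + side j *: grid_vec t))) (avg_upd i) avgZ mulVKf ?pnatr_eq0 //.
rewrite [RHS]/= -avgB; apply: eq_avg => t.
pose phi (c : nat) := face i j (a + side j *: grid_vec (upd t i ord0) + (c%:R * side j) *: e_ i).
transitivity (\sum_(c < M) (phi c.+1 - phi c)).
  apply: eq_bigr => c _; rewrite grid_vec_upd /phi; congr (face _ _ _ - face _ _ _).
    by rewrite -natr1 scalerDr scalerA mulrDl mul1r scalerDl mulrC !addrA.
  by rewrite scalerDr scalerA mulrC !addrA.
rewrite -(big_mkord xpredT (fun c : nat => phi c.+1 - phi c)) telescope_sumr // /phi.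
by rewrite mul0r scale0r addr0 -sideS; congr (face _ _ _ - _); rewrite addrAC.
Qed.

Variables (j : nat) (a : 'rV[R]_N) (theta : R) (s : 'rV[R]_N).
Hypothesis th0 : 0 <= theta.
Hypothesis near_s : forall t i,
  `|cube_avg (diff_quot i) j (a + side j *: grid_vec t) - s 0 i| <= theta.

(** The telescoping of [face_incr] concerns facet means. In units of [side j], each of the at most
    [M] steps costs [theta], and replacing the mean by a point value costs [K] at each end, by
    [face_near]. *)
Lemma walk_line t i c :
  `|G (a + side j *: grid_vec (upd t i c)) - G (a + side j *: grid_vec (upd t i ord0))
     - side j * (c : nat)%:R * s 0 i| <= side j * (M%:R * theta + 2 * K).
Proof.
pose x (c : nat) := a + side j *: grid_vec (upd t i ord0) + (c%:R * side j) *: e_ i.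
have xE (d : 'I_M) : a + side j *: grid_vec (upd t i d) = x d.
  by rewrite grid_vec_upd /x scalerDr scalerA mulrC addrA.
have F m : (m <= M)%N ->
    `|face i j (x m) - face i j (x 0%N) - side j * m%:R * s 0 i| <= side j * (m%:R * theta).
  elim: m => [|m IH] mM; first by rewrite subrr mulr0 !mul0r subrr normr0 mulr0.
  have := face_incr i j (x m); set D := cube_avg _ _ _.
  have -> : x m + side j *: e_ i = x m.+1.
    by rewrite /x -natr1 mulrDl mul1r scalerDl addrA.
  move=> E.
  have nD : `|D - s 0 i| <= theta.
    by have := near_s (upd t i (Ordinal mM)) i; rewrite xE.
  rewrite (_ : _ - _ - _ = (face i j (x m) - face i j (x 0%N) - side j * m%:R * s 0 i) +
    side j * (D - s 0 i)); last by rewrite mulrBr E -natr1; ring.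
  apply: le_trans (ler_normD _ _) _.
  rewrite -natr1 mulrDl mulrDr mul1r lerD ?IH 1?ltnW //.
  by rewrite normrM gtr0_norm ?side_gt0 // ler_pM2l ?side_gt0.
rewrite !xE /=.
have := F c (ltnW (ltn_ord c)).
have := face_near i j (x c); have := face_near i j (x 0%N).
have : side j * (c%:R * theta) <= side j * (M%:R * theta).
  rewrite ler_pM2l ?side_gt0 // ler_wpM2r // ler_nat; exact: ltnW (ltn_ord c).
rewrite mulrDr !ler_norml => H /andP[H1 H2] /andP[H3 H4] /andP[H5 H6].
by apply/andP; split; move: H H1 H2 H3 H4 H5 H6; rewrite (mulrC (side j) (2 * K)) -!mulrA;
  set A := K * side j; lra.
Qed.

Lemma walk_grid t :
  `|G (a + side j *: grid_vec t) - G a - dot (side j *: grid_vec t) s|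
    <= N%:R * (side j * (M%:R * theta + 2 * K)).
Proof.
pose tr (k : nat) : T := [ffun i : 'I_N => if (i < k)%N then t i else ord0].
have F k : (k <= N)%N -> `|G (a + side j *: grid_vec (tr k)) - G a - dot (side j *: grid_vec (tr k)) s|
    <= k%:R * (side j * (M%:R * theta + 2 * K)).
  elim: k => [|k IH] kN.
    have -> : grid_vec (tr 0%N) = 0 by apply/rowP => i; rewrite !mxE ffunE.
    by rewrite scaler0 addr0 dot0l !subrr normr0 mul0r.
  pose i := Ordinal kN.
  have -> : tr k.+1 = upd (tr k) i (t i).
    apply/ffunP => l; rewrite !ffunE ltnS leq_eqVlt.
    case: (eqVneq l i) => [->|li]; first by rewrite eqxx.
    by have /negbTE-> : (l : nat) != k by apply: contra li => /eqP lk; apply/eqP/val_inj.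
  have E0 : upd (tr k) i ord0 = tr k.
    apply/ffunP => l; rewrite !ffunE; case: eqP => // ->; by rewrite ltnn.
  have := walk_line (tr k) i (t i); rewrite grid_vec_upd E0 => H.
  rewrite -natr1 mulrDl mul1r.
  apply: le_trans (lerD (IH (ltnW kN)) H); apply: le_trans (ler_normD _ _).
  rewrite (scalerDr (side j)) (dotDl (side j *: grid_vec (tr k))) !dotZl (dotC (e_ i)) dot_delta.
  by apply: eq_ler; congr `|_|; ring.
have := F N (leqnn N); congr (`|G (a + side j *: grid_vec _) - _ - dot (_ *: grid_vec _) _| <= _);
  by apply/ffunP => i; rewrite ffunE ltn_ord.
Qed.

Hypothesis sK : forall i, `|s 0 i| <= K.

(** The error is counted in units of [side j], while the subcells fill a cube of side [M * side j].
    With [theta] of order [1 / M] the relative error is thus of order [1 / M], which is what makes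
    the approximation useful. *)
Lemma affine_on_cube t x : `|x - (a + side j *: grid_vec t)| <= side j ->
  `|G x - G a - dot (x - a) s| <=
     side j * (N%:R * M%:R * theta + (3 * N%:R + 1) * K).
Proof.
set y := a + _ => xy.
have H1 := walk_grid t; rewrite -/y in H1.
have H2 : `|G x - G y| <= K * side j.
  by apply: le_trans (GK _ _) _; rewrite ler_wpM2l.
have H3 : `|dot (x - y) s| <= N%:R * (side j * K).
  apply: le_trans (dot_bound _ _) _; rewrite -mulrA ler_wpM2l // ler_pM //.
  by apply/mxnorm_leP => // k i; rewrite ord1.
have -> : G x - G a - dot (x - a) s =
    (G y - G a - dot (side j *: grid_vec t) s) + (G x - G y) - dot (x - y) s.
  rewrite (_ : x - a = (x - y) + side j *: grid_vec t); last first.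
    by rewrite /y opprD addrA subrK.
  by rewrite dotDl; ring.
have := le_trans (ler_normB _ _) (lerD (le_trans (ler_normD _ _) (lerD H1 H2)) H3).
move/le_trans; apply; apply: eq_ler; ring.
Qed.

End Grid.

(** * Contact points of semiconvex functions *)

Definition contact (R : realType) (N : nat) (rho : R) (W : 'rV[R]_N -> R)
    (z p : 'rV[R]_N) :=
  forall h, `|h| <= rho -> W (z + h) <= W z + dot p h.

Section Contact.
Variables (R : realType) (N : nat) (W : 'rV[R]_N -> R) (C rho : R).
Hypothesis C0 : 0 < C.
Hypothesis rho0 : 0 < rho.
Hypothesis semi : forall z, exists q, forall h,
  W z + dot q h - C * dot h h <= W (z + h).
Local Notation K := (C * N.+1%:R).

(** Semiconvexity puts a parabola of some slope [q] below [W] at [z], and the contact puts a plane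
    of slope [p] above. Two such bounds meeting at [z] force [q = p]. *)
Lemma contact_lower z p : contact rho W z p ->
  forall h, W z + dot p h - C * dot h h <= W (z + h).
Proof.
move=> ct; have [q qP] := semi z.
suff -> : p = q by [].
apply/rowP => i; apply/eqP; rewrite eq_sym -subr_eq0; apply/eqP.
set a := q 0 i - p 0 i.
have H t : `|t| <= rho -> a * t <= C * t ^+ 2.
  move=> tr; pose h : 'rV[R]_N := t *: delta_mx 0 i.
  have hr : `|h| <= rho.
    by rewrite normrZ (le_trans _ tr) // ler_piMr ?norm_delta_le.
  have := le_trans (qP h) (ct h hr).
  rewrite /h !dotZl !dotZr !dot_delta mxE !eqxx /= /a; lra.
apply: contrapT => /eqP a0.
have na : 0 < `|a| by rewrite normr_gt0.
pose c := Num.min (rho / `|a|) ((2 * C)^-1).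
have c0 : 0 < c by rewrite lt_min divr_gt0 // invr_gt0 mulr_gt0.
have c1 : C * c <= 1 / 2.
  have : c <= (2 * C)^-1 by rewrite ge_min lexx orbT.
  rewrite -(ler_pM2l C0) => /le_trans; apply; apply: eq_ler; field.
  by rewrite gt_eqF.
have := H (c * a); rewrite normrM gtr0_norm // => /(_ _).
have -> : c * `|a| <= rho by rewrite -ler_pdivlMr // ge_min lexx.
move=> /(_ isT).
have -> : a * (c * a) = c * a ^+ 2 by ring.
have -> : C * (c * a) ^+ 2 = (C * c) * (c * a ^+ 2) by ring.
have d0 : 0 < c * a ^+ 2 by rewrite mulr_gt0 // exprn_even_gt0.
by have := ler_wpM2r (ltW d0) c1; lra.
Qed.

Lemma contact_expansion z p h : contact rho W z p -> `|h| <= rho ->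
  `|W (z + h) - W z - dot p h| <= C * N%:R * `|h| ^+ 2.
Proof.
move=> ct hr; have := contact_lower ct h; have := ct _ hr.
have : C * dot h h <= C * N%:R * `|h| ^+ 2.
  by rewrite -mulrA ler_wpM2l ?dot_le_norm ?ltW.
have : 0 <= C * N%:R * `|h| ^+ 2 by rewrite !mulr_ge0 // ltW.
by rewrite ler_norml; move=> *; apply/andP; split; lra.
Qed.

(** The plane above at [z] and the parabolas below at [z] and [z'] are compared at [z' + k] with [k]
    along a coordinate axis, leaving [dot (p' - p) k <= C * (dot h h + dot k k)]. The factor [N.+1]
    comes from [dot h h <= N t^2] and [dot k k <= t^2]; a positive [t] in place of the distance
    covers coinciding points. *)
Lemma contact_slope_near z p z' p' t : contact rho W z p -> contact rho W z' p' ->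
  0 < t <= rho / 2 -> `|z' - z| <= t -> `|p' - p| <= K * t.
Proof.
move=> ct ct' /andP[t0 tr] zt; set h := z' - z in zt *.
have key s i : `|s| <= t -> (p' - p) 0 i * s <= K * t ^+ 2.
  move=> st; pose k : 'rV[R]_N := s *: delta_mx 0 i.
  have kt : `|k| <= t.
    by rewrite normrZ (le_trans _ st) // ler_piMr ?norm_delta_le.
  have hk : `|h + k| <= rho.
    by apply: le_trans (ler_normD _ _) _; have := lerD zt kt; lra.
  have := contact_lower ct' k; have := ct _ hk; have := contact_lower ct h.
  have zh : z + h = z' by rewrite /h addrC subrK.
  rewrite (addrA z h k) zh.
  have : C * dot h h <= C * N%:R * t ^+ 2.
    rewrite -mulrA ler_wpM2l ?(ltW C0) // (le_trans (dot_le_norm _)) // ler_wpM2l //.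
    by rewrite lerXn2r ?nnegrE ?normr_ge0 ?(ltW t0).
  have : dot k k <= t ^+ 2.
    rewrite /k dotZl dotZr dot_delta mxE !eqxx /= mulr1 -expr2 -real_normK ?num_real //.
    by rewrite lerXn2r ?nnegrE ?normr_ge0 ?(ltW t0).
  rewrite -(ler_pM2l C0) -natr1 /k !dotDr !dotZr !dot_delta !mxE; lra.
apply/mxnorm_leP => [|i k]; first by rewrite !mulr_ge0 // ltW.
rewrite ord1 ler_norml; apply/andP; split.
  by have := key (- t) k; rewrite normrN gtr0_norm // => /(_ (lexx _)); nra.
by have := key t k; rewrite gtr0_norm // => /(_ (lexx _)); nra.
Qed.

(** For distant points the estimate is just the a priori bound on [p' - p]. This is why the slopes
    are later confined to a box of size at most [K * (rho / 2)]. *)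
Lemma contact_slope z p z' p' : contact rho W z p -> contact rho W z' p' ->
  `|p' - p| <= K * (rho / 2) -> `|p' - p| <= K * `|z' - z|.
Proof.
move=> ct ct' pp; apply/ler_addgt0Pr => e e0.
have K0 : 0 < K by rewrite mulr_gt0.
set t := `|z' - z| + e / K.
have t0 : 0 < t by rewrite ltr_wpDl // divr_gt0.
have -> : K * `|z' - z| + e = K * t by rewrite mulrDr mulrCA mulfV ?mulr1 // gt_eqF.
have [tr|/ltW tr] := leP t (rho / 2).
  by apply: (contact_slope_near ct ct'); rewrite ?t0 // /t lerDl divr_ge0 // ltW.
by apply: le_trans pp _; rewrite ler_wpM2l ?(ltW K0).
Qed.

End Contact.

(* Second-order Taylor expansion along a chain of contact points whose slopes are almost
   affine: [E] and [l] measure the errors in slope and position. *)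
Lemma contact_chain (R : realType) (N M : nat) (W : 'rV[R]_N -> R)
    (z p : nat -> 'rV[R]_N) (S : 'M[R]_N) (g : 'rV[R]_N) (l K E C2 : R) :
  0 <= l -> 0 <= E -> 0 <= C2 -> `|S| <= K -> `|g| <= l ->
  (forall t, (t <= M)%N -> `|z t - z 0%N - t%:R *: g| <= l) ->
  (forall t, (t <= M)%N -> `|p t - p 0%N - (z t - z 0%N) *m S| <= E * l) ->
  (forall t k, (t <= M)%N -> `|k| <= 3 * l ->
     `|W (z t + k) - W (z t) - dot (p t) k| <= C2 * `|k| ^+ 2) ->
  `|W (z 0%N + M%:R *: g) - W (z 0%N) - dot (p 0%N) (M%:R *: g)
      - 2^-1 * dot ((M%:R *: g) *m S) (M%:R *: g)|
    <= M.+1%:R * ((9 * C2 + 3 * N%:R * E + 5 * N%:R ^+ 2 * K) * l ^+ 2).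
Proof.
move=> l0 E0 C20 SK gl zl pS Wk.
have K0 : 0 <= K by apply: le_trans SK.
set c := _ * l ^+ 2.
pose e t := z t - z 0%N - t%:R *: g.
have zE t : z t = z 0%N + (t%:R *: g + e t) by apply/rowP => i; rewrite /e !mxE; ring.
have dE (x y : 'rV[R]_N) (a b : R) : 0 <= a -> 0 <= b -> `|x| <= a -> `|y| <= b ->
    `|dot x y| <= N%:R * (a * b).
  move=> a0 b0 xa yb; apply: le_trans (dot_bound _ _) _.
  by rewrite -mulrA ler_wpM2l // ler_pM.
have qE (x y : 'rV[R]_N) : `|x| <= l -> `|y| <= l ->
    `|dot (x *m S) y| <= N%:R ^+ 2 * K * l ^+ 2.
  move=> xl yl; apply: le_trans (quad_bound _ _ _) _.
  rewrite expr2 !mulrA; do 2![apply: ler_pM; rewrite ?mulr_ge0 ?sqr_ge0 //].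
  by rewrite ler_wpM2l // mulr_ge0.
(* The last term is a summation by parts. The increments contain [t * dot (g *m S) (e t.+1 - e t)],
   of size [t * l^2]; with the correction they telescope, and each step loses only a multiple of
   [l^2]. *)
have claim t : (t <= M)%N ->
    `|W (z t) - W (z 0%N) - dot (p 0%N) (z t - z 0%N)
      - 2^-1 * t%:R ^+ 2 * dot (g *m S) g - t%:R * dot (g *m S) (e t)| <= t%:R * c.
  elim: t => [_|t IH tM].
    by rewrite !subrr !dot_lin expr0n /= !(mulr0, mul0r) !subr0 normr0.
  have {}IH := IH (ltnW tM).
  set k := g + (e t.+1 - e t).
  have zk : z t + k = z t.+1.
    rewrite (zE t) (zE t.+1) -natr1 /k; apply/rowP => i; rewrite !mxE; ring.
  have et : `|e t| <= l by apply: zl; apply: ltnW.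
  have et1 : `|e t.+1| <= l by apply: zl.
  have kl : `|k| <= 3 * l.
    apply: le_trans (ler_normD _ _) _.
    by have := ler_normB (e t.+1) (e t); lra.
  have H1 := Wk t k (ltnW tM) kl; rewrite zk in H1.
  have {}H1 : `|W (z t.+1) - W (z t) - dot (p t) k| <= 9 * C2 * l ^+ 2.
    apply: le_trans H1 _; rewrite (_ : 9 * C2 * l ^+ 2 = C2 * (3 * l) ^+ 2); last by ring.
    by rewrite ler_wpM2l // lerXn2r ?nnegrE ?normr_ge0 ?mulr_ge0.
  have H2 : `|dot (p t - p 0%N - (z t - z 0%N) *m S) k| <= 3 * N%:R * E * l ^+ 2.
    apply: le_trans (dE _ _ _ _ _ _ (pS t (ltnW tM)) kl) _; rewrite ?mulr_ge0 //.
    by apply: eq_ler; ring.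
  have Q1 := qE _ _ et gl; have Q2 := qE _ _ et et1; have Q3 := qE _ _ et et.
  have Q4 := qE _ _ gl gl; have Q5 := qE _ _ gl et1.
  have -> : W (z t.+1) - W (z 0%N) - dot (p 0%N) (z t.+1 - z 0%N)
      - 2^-1 * t.+1%:R ^+ 2 * dot (g *m S) g - t.+1%:R * dot (g *m S) (e t.+1) =
    (W (z t) - W (z 0%N) - dot (p 0%N) (z t - z 0%N)
      - 2^-1 * t%:R ^+ 2 * dot (g *m S) g - t%:R * dot (g *m S) (e t)) +
    (W (z t.+1) - W (z t) - dot (p t) k) +
    dot (p t - p 0%N - (z t - z 0%N) *m S) k +
    (dot (e t *m S) g + dot (e t *m S) (e t.+1) - dot (e t *m S) (e t)
      - 2^-1 * dot (g *m S) g - dot (g *m S) (e t.+1)).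
    have -> : z t.+1 - z 0%N = (z t - z 0%N) + k by rewrite -zk addrAC.
    have -> : z t - z 0%N = t%:R *: g + e t by rewrite {1}(zE t) addrC addKr.
    rewrite /k !quad_lin -(natr1 t).
    lra.
  rewrite -(natr1 t) mulrDl mul1r.
  move: IH H1 H2 Q1 Q2 Q3 Q4 Q5; rewrite /c.
  set x1 := `|_ - _|; set X1 := _ - _ in x1 *.
  rewrite !ler_norml => /andP[a1 b1] /andP[a2 b2] /andP[a3 b3] /andP[a4 b4]
    /andP[a5 b5] /andP[a6 b6] /andP[a7 b7] /andP[a8 b8].
  apply/andP; split; lra.
set h := M%:R *: g.
have eM : `|e M| <= l by apply: zl.
have Hc := claim M (leqnn M).
have zM : z 0%N + h = z M + (- e M) by rewrite /e -/h; apply/rowP => i; rewrite !mxE; ring.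
have eM3 : `|- e M| <= 3 * l by rewrite normrN; lra.
have H1 := Wk M (- e M) (leqnn M) eM3; rewrite -zM normrN in H1.
have {}H1 : `|W (z 0%N + h) - W (z M) - dot (p M) (- e M)| <= C2 * l ^+ 2.
  by apply: le_trans H1 _; rewrite ler_wpM2l // lerXn2r ?nnegrE ?normr_ge0.
have H2 : `|dot (p M - p 0%N - (z M - z 0%N) *m S) (e M)| <= N%:R * E * l ^+ 2.
  apply: le_trans (dE _ _ _ _ _ _ (pS M (leqnn M)) eM) _; rewrite ?mulr_ge0 //.
  by apply: eq_ler; ring.
have Q := qE _ _ eM eM.
have -> : W (z 0%N + h) - W (z 0%N) - dot (p 0%N) h - 2^-1 * dot (h *m S) h =
   (W (z 0%N + h) - W (z M) - dot (p M) (- e M)) +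
   (W (z M) - W (z 0%N) - dot (p 0%N) (z M - z 0%N)
      - 2^-1 * M%:R ^+ 2 * dot (g *m S) g - M%:R * dot (g *m S) (e M))
   - dot (p M - p 0%N - (z M - z 0%N) *m S) (e M) - dot (e M *m S) (e M).
  have -> : z M - z 0%N = h + e M by rewrite {1}(zE M) addrC addKr.
  by rewrite /h !quad_lin; lra.
rewrite -(natr1 M) mulrDl mul1r.
have P1 : 0 <= C2 * l ^+ 2 by rewrite mulr_ge0 ?sqr_ge0.
have P2 : 0 <= N%:R * E * l ^+ 2 by rewrite !mulr_ge0 ?sqr_ge0.
have P3 : 0 <= N%:R ^+ 2 * K * l ^+ 2 by rewrite !mulr_ge0 ?sqr_ge0.
move: Hc H1 H2 Q; rewrite /c.
rewrite !ler_norml => /andP[a1 b1] /andP[a2 b2] /andP[a3 b3] /andP[a4 b4].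
apply/andP; split; lra.
Qed.

Section Cells.
Variables (R : realType) (N M' : nat).
Local Notation M := (M'.+1).
Local Notation T := {ffun 'I_N -> 'I_M}.

(** Half-open, so that truncating the rescaled coordinates always finds a subcell in
    [cell_split]. *)
Definition cell (a : 'rV[R]_N) (l : R) (z : 'rV[R]_N) : bool :=
  [forall k, (a 0 k <= z 0 k) && (z 0 k < a 0 k + l)].

Lemma cell_dist a l z z' : 0 <= l -> cell a l z -> cell a l z' -> `|z - z'| <= l.
Proof.
move=> l0 /forallP H /forallP H'; apply/mxnorm_leP => // i k; rewrite ord1 !mxE.
by have /andP[h1 h2] := H k; have /andP[h3 h4] := H' k; rewrite ler_norml; lra.
Qed.

Lemma cell_dist_corner a l z : 0 <= l -> cell a l z -> `|z - a| <= l.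
Proof.
move=> l0 /forallP H; apply/mxnorm_leP => // i k; rewrite ord1 !mxE.
by have /andP[h1 h2] := H k; rewrite ler_norml; lra.
Qed.

Lemma cell_split a (l : R) z : 0 < l -> cell a (M%:R * l) z ->
  exists t : T, cell (a + l *: grid_vec R t) l z.
Proof.
move=> l0 /forallP H.
pose q k : R := (z 0 k - a 0 k) / l.
have x0 k : 0 <= q k.
  by have /andP[h1 _] := H k; rewrite divr_ge0 ?subr_ge0 // ltW.
have tM (k : 'I_N) : (Num.truncn (q k) < M)%N.
  rewrite -(ltr_nat R); apply: le_lt_trans (proj1 (andP (truncn_itv (x0 k)))) _.
  by rewrite ltr_pdivrMr // ltrBlDl; case/andP: (H k).
exists [ffun k => Ordinal (tM k)]; apply/forallP => k; rewrite !mxE ffunE /=.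
have /andP[] := truncn_itv (x0 k); rewrite ler_pdivlMr // ltr_pdivrMr // -natr1.
set y := (Num.truncn _)%:R.
by rewrite mulrDl mul1r => A B; apply/andP; split; [lra|lra].
Qed.

Lemma cell_sub a l z (t : T) : 0 < l -> cell (a + l *: grid_vec R t) l z ->
  cell a (M%:R * l) z.
Proof.
move=> l0 /forallP H; apply/forallP => k; have := H k; rewrite !mxE => /andP[h1 h2].
have t0 : 0 <= l * (t k)%:R by rewrite mulr_ge0 // ltW.
have tM : l * (t k)%:R <= l * M'%:R by rewrite ler_pM2l // ler_nat -ltnS.
by rewrite -natr1 mulrDl mul1r mulrC; apply/andP; split; lra.
Qed.

Variables (P : finType) (Z : P -> 'rV[R]_N) (h : R).
Hypothesis h0 : 0 < h.

Definition cell_count a l : R := \sum_i (cell a l (Z i))%:R.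

Lemma cell_count_le j a :
  cell_count a (side M' h j) <= (M ^ N)%:R ^+ j * cube_avg M' h (cell_count ^~ h) j a.
Proof.
elim: j a => [|j IH] a.
  by rewrite /side !expr0 mulr1 mul1r.
rewrite /= exprS -mulrA mulrCA /avg.
have -> : #|{ffun 'I_N -> 'I_M}| = (M ^ N)%N by rewrite card_ffun !card_ord.
have MN : (M ^ N)%:R != 0 :> R by rewrite pnatr_eq0 -lt0n expn_gt0.
rewrite mulVKf //.
rewrite mulr_sumr; apply: (@le_trans _ _ (\sum_(t : T) cell_count (a + side M' h j *: grid_vec R t) (side M' h j))).
  rewrite /cell_count exchange_big; apply: ler_sum => i _.
  case: (boolP (cell a _ _)) => [|_]; last by apply: sumr_ge0.
  rewrite sideS => /(cell_split (side_gt0 M' h0 j))[t ct].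
  by rewrite (bigD1 t) //= ct lerDl; apply: sumr_ge0.
by apply: ler_sum => t _; exact: IH.
Qed.

Lemma cell_count_gt0 j a : 0 < cube_avg M' h (cell_count ^~ h) j a ->
  exists i, cell a (side M' h j) (Z i).
Proof.
elim: j a => [|j IH] a /=.
  rewrite /side expr0 mulr1 => c0; apply: contrapT => /forallNP H.
  by move: c0; rewrite /cell_count big1 ?ltxx // => i _; move/negP/negbTE: (H i) => ->.
move=> c0; have [t /(lt_le_trans c0)/IH[i ci]] := avg_exists_ge (cardT_gt0 N M') (lexx
  (avg (fun t : T => cube_avg M' h (cell_count ^~ h) j (a + side M' h j *: grid_vec R t)))).
by exists i; rewrite sideS; apply: (cell_sub (side_gt0 M' h0 j) ci).
Qed.

End Cells.

Lemma expn_unbounded (R : realType) (M : nat) (x : R) : (1 < M)%N ->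
  exists j, x <= (M ^ j)%:R.
Proof.
move=> M1; exists (Num.bound `|x|).
apply: le_trans (ler_norm x) _; apply: le_trans (ltW (archi_boundP (normr_ge0 x))) _.
by rewrite ler_nat ltnW // ltn_expl.
Qed.

(** The starting cell lies at distance [r] from the lower faces of a cube of side [4 * r], which
    leaves room for a walk of length [r] in every direction. *)
Lemma cell_walk (R : realType) (b z s r l : R) : - r <= s -> s <= r ->
  b + r <= z -> z < b + r + l -> l <= r -> b <= z + s /\ z + s < b + 4 * r.
Proof. by move=> *; split; lra. Qed.

Lemma natr_dist_lt1 (R : realType) (a b : nat) : `|a%:R - b%:R| < 1 :> R -> a == b.
Proof.
rewrite ltr_norml => /andP[h1 h2].
case: ltngtP => //; rewrite -(ler_nat R) -natr1 => h; exfalso; lra.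
Qed.

Lemma half_dist (R : realType) (k x : R) : 0 < k -> 2 * k * x <= k -> x < 1.
Proof. by move=> k0; rewrite mulrAC -[leRHS]mul1r (ler_pM2r k0) => H; lra. Qed.

(* Replaces the theorems of Alexandrov and Jensen: since the slopes of contact points depend in
   a Lipschitz way on the points, the contact points of the many slopes of a fine lattice fill a
   positive fraction of some cube on which [regular_node] makes the slope almost affine. The
   expansion is only obtained at one small scale [r], which is all a viscosity test requires. *)
Lemma second_order_contact (R : realType) (N : nat) (W : 'rV[R]_N -> R)
    (C rho d0 : R) (z0 : 'rV[R]_N) :
  0 < C -> 0 < rho -> 0 < d0 ->
  (forall z, exists q, forall h, W z + dot q h - C * dot h h <= W (z + h)) ->
  (forall p : 'rV[R]_N, (forall i, 0 <= p 0 i <= d0) ->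
     exists z, `|z - z0| <= rho /\ contact rho W z p) ->
  forall dl, 0 < dl -> exists (z p : 'rV[R]_N) (H : 'M[R]_N) (r : R),
    [/\ 0 < r <= dl, `|z - z0| <= rho, `|p| <= dl & contact rho W z p] /\
    [/\ H^T = H, r * `|H| <= dl &
       forall h, `|h| <= r ->
         `|W (z + h) - W z - dot p h - 2^-1 * dot (h *m H) h| <= dl * r ^+ 2].
Proof.
move=> C0 rho0 d00 semi cont dl dl0.
pose K := C * N.+1%:R.
have K0 : 0 < K by rewrite mulr_gt0.
(* Twice the constant of [affine_on_cube] when [M * theta <= 1], because a difference of slopes
   involves two points. *)
pose E := 2 * (N%:R + (3 * N%:R + 1) * K).
have E0 : 0 <= E by rewrite mulr_ge0 // addr_ge0 // mulr_ge0 ?(ltW K0) // addr_ge0 // mulr_ge0.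
pose c := 9 * (C * N%:R) + 3 * N%:R * E + 5 * N%:R ^+ 2 * K.
have c0 : 0 <= c.
  have := ltW C0; have := ltW K0; have : 0 <= N%:R :> R by [].
  by move=> *; rewrite /c; do ![apply: addr_ge0 | apply: mulr_ge0 | exact: sqr_ge0 | by []].
pose D0 := Num.min d0 (Num.min dl (K * (rho / 2))).
have D00 : 0 < D0 by rewrite !lt_min d00 dl0 mulr_gt0 // divr_gt0.
have D0d : D0 <= d0 by rewrite ge_min lexx.
have D0l : D0 <= dl by rewrite !ge_min lexx orbT.
have D0K : D0 <= K * (rho / 2) by rewrite !ge_min lexx !orbT.
(* With cells of side [l] and [r = M * l / 4], where [M = M'.+1], the error [(M + 1) * c * l^2] of
   [contact_chain] is at most [dl * r^2] precisely under [cM]. Taking [M] to be a multiple of 4 puts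
   a cell corner at distance exactly [r] from the lower faces. *)
pose m := Num.bound (32 * c / dl).
pose M' := (4 * m + 3)%N.
have ME : M'.+1 = (4 * m.+1)%N by rewrite mulnS /M' addnC.
have MR : M'.+1%:R = 4 * m.+1%:R :> R by rewrite ME natrM.
have cM : 16 * (M'.+2%:R * c) <= dl * M'.+1%:R ^+ 2.
  have : 32 * c <= dl * M'.+1%:R.
    have /archi_boundP : 0 <= 32 * c / dl by rewrite divr_ge0 ?mulr_ge0 // ltW.
    rewrite -/m ltr_pdivrMr // => /ltW /le_trans; apply; rewrite [leLHS]mulrC.
    by rewrite ler_wpM2l ?(ltW dl0) // MR -natr1; have : 0 <= m%:R :> R by []; lra.
  have M1 : 1 <= M'.+1%:R :> R by rewrite ler1n.
  rewrite -(ler_pM2r (lt_le_trans ltr01 M1)) -[X in 16 * (X%:R * _)]addn1 natrD.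
  have : M'.+1%:R * c <= M'.+1%:R * M'.+1%:R * c.
    by rewrite -mulrA ler_peMl ?mulr_ge0.
  have : 1 * c <= M'.+1%:R * c by rewrite ler_wpM2r.
  rewrite expr2; move: (M'.+1%:R) => x; nra.
have M1 : (1 < M'.+1)%N by rewrite /M' addn3.
have [j0 j0P] := expn_unbounded (6 * K * rho / D0) M1.
(* Density of the contact points: [mm ^ N] slopes with [mm = M ^ (j1 + J)] are spread over
   [M ^ (N * (j0 + j1 + J))] small cells. The ratio involves neither [j1] nor [J], so [J] may be
   chosen afterwards as a function of [d]. *)
pose d : R := ((M'.+1 ^ N)%:R ^+ j0)^-1.
have MN0 : 0 < (M'.+1 ^ N)%:R :> R by rewrite ltr0n expn_gt0.
have d_gt0 : 0 < d by rewrite invr_gt0 exprn_gt0.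
pose theta := Num.min (M'.+1%:R^-1) (d / 4).
have th0 : 0 < theta by rewrite lt_min invr_gt0 ltr0n divr_gt0.
have thM : M'.+1%:R * theta <= 1.
  by rewrite mulrC -ler_pdivlMr ?ltr0n // mul1r ge_min lexx.
have thd : theta <= d / 4 by rewrite ge_min lexx orbT.
pose T := {ffun 'I_N -> 'I_M'.+1}.
(* The component [None] carries the density of contact points, and [Some (i, k)] the difference
   quotient in direction [i] of the [k]-th slope coordinate. *)
have [J JP] := @regular_node R T (option ('I_N * 'I_N)%type) None (K + 1) d theta
  (cardT_gt0 N M') d_gt0 th0.
(* The extra [j1] levels make the cube supplied by [regular_node] small compared with [rho], [dl]
   and [dl / K], whichever of the [J] levels it is found at. *)
have [j1 j1P] := expn_unbounded (3 * rho / Num.min rho (Num.min dl (dl / K))) M1.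
pose Jt := (j0 + j1 + J)%N.
pose h := 3 * rho / (M'.+1 ^ Jt)%:R.
have MJ j : 0 < (M'.+1 ^ j)%:R :> R by rewrite ltr0n expn_gt0.
have h0 : 0 < h by rewrite divr_gt0 // mulr_gt0.
have sideE j k : (j + k = Jt)%N -> side M' h j * (M'.+1 ^ k)%:R = 3 * rho.
  move=> jk; rewrite /side /h -jk expnD natrM -natrX.
  by rewrite -mulrA mulfVK // mulf_neq0 // gt_eqF.
pose mm := (M'.+1 ^ (j1 + J))%N.
have mm0 : (0 < mm)%N by rewrite expn_gt0.
(* The lattice spacing is twice the slope variation [K * h] allowed inside a cell of side [h], so
   every smallest cell contains at most one chosen contact point and the counts lie in [0, 1]. *)
pose tau := 2 * K * h.
have tau0 : 0 < tau by apply: mulr_gt0 => //; apply: mulr_gt0.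
have hE : h * (M'.+1 ^ Jt)%:R = 3 * rho by rewrite /h divfK // gt_eqF.
have taumm : tau * mm%:R <= D0.
  have : 6 * K * rho <= D0 * (M'.+1 ^ j0)%:R by rewrite [leRHS]mulrC -ler_pdivrMr.
  move=> H; rewrite -(ler_pM2r (MJ j0)); apply: le_trans H.
  have -> : 6 * K * rho = 2 * K * (3 * rho) by ring.
  by rewrite -hE /tau /Jt -addnA expnD natrM -/mm; apply: eq_ler; ring.
pose P := {ffun 'I_N -> 'I_mm}.
pose i0 : P := [ffun=> Ordinal mm0].
pose slope (i : P) : 'rV[R]_N := \row_k (tau * (i k : nat)%:R).
have slopeD i k : 0 <= slope i 0 k <= D0.
  rewrite mxE mulr_ge0 ?(ltW tau0) //=; apply: le_trans taumm.
  by rewrite ler_pM2l // ler_nat ltnW.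
have slope_norm i : `|slope i| <= D0.
  by apply/mxnorm_leP => [|a k]; rewrite ?(ltW D00) // ord1 ger0_norm; case/andP: (slopeD i k).
have /choice[Z ZP] : forall i : P, exists z,
    `|z - z0| <= rho /\ contact rho W z (slope i).
  move=> i; apply: cont => k; case/andP: (slopeD i k) => -> /= /le_trans; exact.
have slopeK i j : `|slope i - slope j| <= K * `|Z i - Z j|.
  apply: (contact_slope C0 rho0 semi (ZP j).2 (ZP i).2); apply: le_trans D0K.
  apply/mxnorm_leP => [|a k]; rewrite ?(ltW D00) // ord1 3!mxE.
  have := slopeD i k; have := slopeD j k; rewrite !mxE => /andP[a1 a2] /andP[a3 a4].
  by rewrite ler_norml; apply/andP; split; lra.
have /choice[G GP] : forall k : 'I_N, exists g : 'rV[R]_N -> R,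
    (forall i, g (Z i) = slope i 0 k) /\ forall x y, `|g x - g y| <= K * `|x - y|.
  move=> k; apply: (mcshane i0) => [|i j]; first exact: ltW.
  apply: le_trans (slopeK i j); apply: le_trans (coord_le_mxnorm _ 0 k).
  by rewrite !mxE ler_norm.
pose X j (a : 'rV[R]_N) (o : option ('I_N * 'I_N)) : R :=
  if o is Some (i, k) then cube_avg M' h (diff_quot h (G k) i) j a
  else cube_avg M' h (fun a => cell_count Z a h) j a.
have Kle : 0 <= K by apply: ltW.
have XK j a i k : `|X j a (Some (i, k))| <= K.
  by apply: cube_avg_norm_le => b; apply: diff_quot_le => //; exact: (GP k).2.
have c01 a : 0 <= cell_count Z a h <= 1.
  rewrite /cell_count -natr_sum ler0n -[leRHS]/(1%:R) ler_nat /=.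
  have -> : (\sum_i (cell a h (Z i) : nat) = #|[pred i | cell a h (Z i)]|)%N.
    by rewrite -sum1_card [RHS]big_mkcond; apply: eq_bigr => i _; rewrite inE; case: (cell _ _ _).
  apply/card_le1_eqP => i i' ci ci'.
  have sl : `|slope i - slope i'| <= K * h.
    apply: le_trans (slopeK i i') _; rewrite ler_wpM2l //.
    by apply: (cell_dist (ltW h0) ci ci').
  apply/ffunP => k; apply/val_inj/eqP => /=.
  have /mxnorm_leP/(_ 0 k) := sl; rewrite !mxE => /(_ (ltW (mulr_gt0 K0 h0))).
  rewrite -mulrBr normrM gtr0_norm // => H; apply: (@natr_dist_lt1 R).
  have Kh : 0 < K * h by rewrite mulr_gt0.
  have tauE : 2 * (K * h) = tau by rewrite /tau mulrA.
  by apply: (half_dist Kh); rewrite tauE distrC.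
have [a1 a1P] : exists a, d <= X J a None.
  pose a0 : 'rV[R]_N := z0 - const_mx rho.
  have JtE : (j0 + j1 + J)%N = Jt by [].
  apply: (@cube_avg_exists_ge R N M' h _ d (j0 + j1)%N J a0); rewrite JtE.
  rewrite /d -[leLHS]mul1r ler_pdivrMr ?exprn_gt0 // mulrC.
  have := @cell_count_le R N M' P Z h h0 Jt a0.
  have -> : cell_count Z a0 (side M' h Jt) = ((M'.+1 ^ N)%:R ^+ (j1 + J)).
    rewrite /cell_count (eq_bigr (fun=> 1)) => [|i _].
      rewrite sumr_const -[RHS]natrX; congr (_%:R).
      by rewrite card_ffun !card_ord /mm -!expnM mulnC.
    suff ci : cell a0 (side M' h Jt) (Z i) by rewrite ci.
    apply/forallP => k; rewrite !mxE.
    have /mxnorm_leP/(_ 0 k) := (ZP i).1; rewrite !mxE => /(_ (ltW rho0)).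
    by rewrite /side -natrX hE ler_norml; lra.
  move=> H; rewrite -(ler_pM2l (exprn_gt0 (j1 + J) MN0)) mulr1; apply: le_trans H _.
  by rewrite /Jt -addnA exprD -mulrA mulrCA.
have [|||j [b [jJ db near]]] := JP _ (fun j a t => a + side M' h j *: grid_vec R t) X a1 _ _ _ a1P.
- by move=> j a [[i k]|].
- move=> a [[i k]|]; first by apply: le_trans (XK _ _ _ _) _; rewrite lerDl.
  have /andP[n0 n1] := c01 a.
  by rewrite [X _ _ _]/= ger0_norm //; apply: le_trans n1 _; rewrite lerDr.
- by move=> a; exact: c01.
clear JP.
set l := side M' h j in near *.
have l0 : 0 < l by apply: side_gt0.
pose S : 'M[R]_N := \matrix_(i, k) X j.+1 b (Some (i, k)).
have SK : `|S| <= K by apply/mxnorm_leP => // i k; rewrite mxE; exact: XK.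
have Ml : M'.+1%:R * l <= Num.min rho (Num.min dl (dl / K)).
  rewrite -sideS.
  have : side M' h j.+1 <= side M' h J.
    by rewrite /side ler_pM2l // ler_eXn2l // ltr1n.
  move=> /le_trans; apply.
  rewrite -(ler_pM2r (MJ (j0 + j1)%N)).
  have -> : side M' h J * (M'.+1 ^ (j0 + j1))%:R = 3 * rho.
    by rewrite /side -mulrA -natrX -natrM -expnD addnC -/Jt hE.
  have min0 : 0 < Num.min rho (Num.min dl (dl / K)) by rewrite !lt_min rho0 dl0 divr_gt0.
  move: j1P; rewrite ler_pdivrMr // => H; apply: le_trans H _.
  rewrite [leLHS]mulrC ler_wpM2l ?(ltW min0) //.
  by rewrite ler_nat leq_pexp2l // leq_addl.
have Mlr : M'.+1%:R * l <= rho by move: Ml; rewrite le_min => /andP[].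
have Mld : M'.+1%:R * l <= dl by move: Ml; rewrite !le_min => /and3P[].
have MldK : M'.+1%:R * l * K <= dl.
  by move: Ml; rewrite !le_min => /and3P[_ _]; rewrite ler_pdivlMr.
(* Every child has density at least [d / 2 - theta >= d / 4], so no subcell is empty. *)
have child (t : T) : exists i, cell (b + l *: grid_vec R t) l (Z i).
  apply: (@cell_count_gt0 R N M' P Z h h0 j).
  have := near t None; rewrite ler_norml => /andP[+ _].
  rewrite -[cube_avg _ _ _ _ _]/(X j (b + l *: grid_vec R t) None).
  by move: db thd d_gt0; clear; move: (X _ _ _) (X _ _ _) => x y; lra.
have aff (t : T) x k : `|x - (b + l *: grid_vec R t)| <= l ->
    `|G k x - G k b - ((x - b) *m S) 0 k| <= E / 2 * l.
  move=> xt; pose s : 'rV[R]_N := \row_i S i k.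
  have sE i : s 0 i = S i k by rewrite mxE.
  have -> : ((x - b) *m S) 0 k = dot (x - b) s.
    by rewrite dotE mxE; apply: eq_bigr => i _; rewrite sE.
  have n1 (u : T) i : `|cube_avg M' h (diff_quot h (G k) i) j (b + l *: grid_vec R u) - s 0 i| <= theta.
    by rewrite sE mxE; exact: (near u (Some (i, k))).
  have n2 i : `|s 0 i| <= K by rewrite sE; apply: le_trans (coord_le_mxnorm _ _ _) SK.
  apply: le_trans (affine_on_cube h0 Kle (GP k).2 (ltW th0) n1 n2 xt) _.
  have -> : E / 2 = N%:R + (3 * N%:R + 1) * K by rewrite /E mulrAC mulfV ?mul1r // pnatr_eq0.
  rewrite [leRHS]mulrC -/l ler_wpM2l ?(ltW l0) // lerD2r.
  by rewrite -mulrA ler_piMr.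
have mM : (m.+1 < M'.+1)%N by rewrite ME ltn_Pmull.
have [ic icP] := child [ffun=> Ordinal mM].
pose r := l * m.+1%:R.
have r0 : 0 < r by rewrite mulr_gt0.
have rE : M'.+1%:R * l = 4 * r by rewrite MR /r; ring.
exists (Z ic), (slope ic), (2^-1 *: (S + S^T)), r.
have SsymK : `|2^-1 *: (S + S^T)| <= K.
  have STK : `|S^T| <= K.
    by apply/mxnorm_leP => // i k; rewrite mxE; apply: le_trans (coord_le_mxnorm _ _ _) SK.
  rewrite normrZ ger0_norm ?invr_ge0 //; have := le_trans (ler_normD S S^T) (lerD SK STK).
  by move: `|S + S^T| => x; clear; lra.
have rd : r <= dl by move: Mld r0; rewrite rE; clear; lra.
split; first split.
- by rewrite r0.
- exact: (ZP ic).1.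
- exact: le_trans (slope_norm ic) D0l.
- exact: (ZP ic).2.
split.
- by rewrite linearZ linearD /= trmxK addrC.
- apply: le_trans (_ : r * K <= _); first by rewrite ler_wpM2l ?(ltW r0).
  move: MldK; rewrite rE -mulrA => H; apply: le_trans H.
  by have := mulr_ge0 (ltW r0) Kle; move: (r * K) => q; clear; lra.
move=> y yr; set g := M'.+1%:R^-1 *: y.
have yE : y = M'.+1%:R *: g by rewrite scalerA mulfV ?scale1r // pnatr_eq0.
have gl : `|g| <= l.
  rewrite normrZ normfV normr_nat mulrC ler_pdivrMr ?ltr0n // mulrC rE.
  by apply: le_trans yr _; move: r0; clear; lra.
(* Contact points following the segment from [Z ic] to [Z ic + y] in [M'.+1] steps [g]: each target
   lies in the cube, and the contact point in its subcell is at distance at most [l]. *)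
have pt (t : nat) : exists i, (t = 0%N -> i = ic) /\ ((t <= M'.+1)%N ->
    `|Z i - Z ic - t%:R *: g| <= l /\ exists u : T, cell (b + l *: grid_vec R u) l (Z i)).
  case: t => [|t].
    exists ic; split=> // _; rewrite subrr scale0r subr0 normr0 (ltW l0); split=> //.
    by exists [ffun=> Ordinal mM].
  have [tM|] := leqP t.+1 M'.+1; last by move=> tM; exists ic; split=> // /leq_ltn_trans/(_ tM); rewrite ltnn.
  set x := Z ic + t.+1%:R *: g.
  have xc : cell b (M'.+1%:R * l) x.
    apply/forallP => k; rewrite rE /x !mxE.
    have /forallP/(_ k) := icP; rewrite !mxE ffunE /= -/r => /andP[A B].
    have ty : `|t.+1%:R * (M'.+1%:R^-1 * y 0 k)| <= r.
      rewrite mulrA normrM (le_trans _ yr) // ger0_norm ?divr_ge0 //.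
      apply: (@le_trans _ _ (1 * `|y 0 k|)); last by rewrite mul1r coord_le_mxnorm.
      by rewrite ler_wpM2r // ler_pdivrMr ?ltr0n // mul1r ler_nat.
    have lr : l <= r by rewrite /r ler_peMr ?(ltW l0) // ler1n.
    move: ty; rewrite ler_norml => /andP[h1 h2].
    exact/andP/(cell_walk h1 h2 A B lr).
  have [u xu] := cell_split l0 xc.
  have [i iu] := child u; exists i; split=> // _; split; last by exists u.
  by rewrite -addrA -opprD; apply: (cell_dist (ltW l0) iu xu).
have /choice[it itP] := pt.
have it0 : it 0%N = ic by apply: (itP 0%N).1.
have := @contact_chain R N M'.+1 W (fun t => Z (it t)) (fun t => slope (it t)) S g l K E (C * N%:R).
rewrite /= it0 -yE => H.
rewrite (_ : dot (y *m (2^-1 *: (S + S^T))) y = dot (y *m S) y); last first.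
  rewrite mulmx_scaler dotZl mulmxDr dotDl (dot_mul_tr S^T) trmxK (dotC y).
  by move: (dot _ _) => q; clear; lra.
apply: le_trans (H _ _ _ _ _ _ _ _) _ => //.
- exact: ltW.
- by rewrite mulr_ge0 ?(ltW C0).
- by move=> t tM; case: ((itP t).2 tM).
- move=> t tM; have [_ [u tu]] := (itP t).2 tM.
  apply/mxnorm_leP => [|a k]; first by rewrite mulr_ge0 ?(ltW l0).
  rewrite ord1.
  have A1 := aff u _ k (cell_dist_corner (ltW l0) tu).
  have A2 := aff _ _ k (cell_dist_corner (ltW l0) icP).
  rewrite !(GP k).1 in A1 A2.
  have -> : Z (it t) - Z ic = (Z (it t) - b) - (Z ic - b) by rewrite opprB addrA subrK.
  rewrite mulmxBl; move: A1 A2.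
  move: ((Z (it t) - b) *m S) ((Z ic - b) *m S) => v1 v2.
  rewrite [(slope _ - _ - _) 0 k]mxE [(slope _ - _) 0 k]mxE [(- slope _) 0 k]mxE.
  rewrite [(- (v1 - v2)) 0 k]mxE [(v1 - v2) 0 k]mxE [(- v2) 0 k]mxE.
  move: (slope (it t) 0 k) (slope ic 0 k) (v1 0 k) (v2 0 k) (G k b) => s1 s2 w1 w2 q.
  rewrite !ler_norml; clear; move=> /andP[h1 h2] /andP[h3 h4].
  by apply/andP; split; lra.
- move=> t k tM k3; apply: (contact_expansion C0 rho0 semi (ZP (it t)).2).
  apply: le_trans k3 _; apply: le_trans Mlr; rewrite ler_pM2r //.
  by rewrite MR -natr1; have : 0 <= m%:R :> R by []; clear; lra.
rewrite -/c mulrA.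
have -> : dl * r ^+ 2 = (dl * M'.+1%:R ^+ 2 / 16) * l ^+ 2 by rewrite MR /r; field.
by rewrite ler_wpM2r ?sqr_ge0 // ler_pdivlMr // mulrC.
Qed.

(** * Pucci operators and quadratic test functions *)

Section Continuity.
Variables (R : realType).

Lemma cvg_bigsum (T : Type) (F : set_system T) (FF : Filter F) (I : Type) (r : seq I)
    (P : pred I) (f : I -> T -> R) (l : I -> R) :
  (forall i, f i x @[x --> F] --> l i) ->
  (\sum_(i <- r | P i) f i x) @[x --> F] --> \sum_(i <- r | P i) l i.
Proof.
move=> fl; elim: r => [|i r IH].
  rewrite big_nil; under eq_fun do rewrite big_nil; exact: cvg_cst.
rewrite big_cons; under eq_fun do rewrite big_cons.
by case: (P i) => //; apply: cvgD.
Qed.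

Variable n : nat.

Lemma continuous_dot (T : topologicalType) (f g : T -> 'rV[R]_n) (x : T) :
  (forall k, {for x, continuous (fun y => f y 0 k)}) ->
  (forall k, {for x, continuous (fun y => g y 0 k)}) ->
  {for x, continuous (fun y => dot (f y) (g y))}.
Proof.
move=> fc gc; rewrite /prop_for /continuous_at dotE.
under eq_fun do rewrite dotE.
by apply: cvg_bigsum => k; apply: cvgM; [exact: fc|exact: gc].
Qed.

Lemma continuous_mulmx (T : topologicalType) (f : T -> 'rV[R]_n) (A : 'M[R]_n) (x : T) :
  (forall k, {for x, continuous (fun y => f y 0 k)}) ->
  forall k, {for x, continuous (fun y => (f y *m A) 0 k)}.
Proof.
move=> fc k; rewrite /prop_for /continuous_at mxE.
under eq_fun do rewrite mxE.
by apply: cvg_bigsum => j; apply: cvgM; [exact: fc|exact: cvg_cst].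
Qed.

Lemma continuous_coordB (x0 x : 'rV[R]_n) k :
  {for x, continuous (fun y : 'rV[R]_n => (y - x0) 0 k)}.
Proof.
rewrite (_ : (fun y => _) = (fun y : 'rV[R]_n => y 0 k) \- cst (x0 0 k)); last first.
  by apply/funext => y; rewrite !mxE.
by apply: continuousB; [exact: coord_continuous|exact: cst_continuous].
Qed.

Lemma compact_cball (x0 : 'rV[R]_n) (r : R) : compact [set x | `|x - x0| <= r].
Proof.
apply: bounded_closed_compact.
  exists (r + `|x0|); split; first exact: num_real.
  move=> M rM x /= xr; apply: le_trans (ltW rM).
  by rewrite -(subrK x0 x) (le_trans (ler_normD _ _)) // lerD2r.
rewrite (_ : [set x | _] = (fun x => `|x - x0|) @^-1` [set y | y <= r]) //.
apply: preimage_closed; last exact: closed_le.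
move=> x _; apply: (@continuous_comp _ _ _ (fun y : 'rV[R]_n => y - x0) (fun y => `|y|)).
  by apply: continuousB; [exact: cvg_id|exact: cst_continuous].
exact: norm_continuous.
Qed.

End Continuity.

Section Ellipticity.
Variables (R : realType) (n : nat).
Implicit Types (A M N : 'M[R]_n) (v x : 'rV[R]_n).

(** The quadratic form attains its minimum [m] on the unit sphere at some [w]. Moving [w] in the
    direction [z = w *m A - m *: w] would lower the quotient unless [z = 0], so [m] is an
    eigenvalue. *)
Lemma rayleigh_min A (c : R) : A^T = A -> (forall a, eigenvalue A a -> c <= a) ->
  forall v, c * dot v v <= dot (v *m A) v.
Proof.
move=> sA Ac v; have [->|v0] := eqVneq v 0.
  by rewrite !dot_lin mulr0.
pose S := [set x : 'rV[R]_n | dot x x = 1].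
pose unit_ (x : 'rV[R]_n) := (Num.sqrt (dot x x))^-1 *: x.
have unitP x : x != 0 -> S (unit_ x) /\ x = Num.sqrt (dot x x) *: unit_ x.
  move=> x0; have s0 : Num.sqrt (dot x x) != 0 by rewrite gt_eqF // sqrtr_gt0 dot_gt0.
  rewrite /S /unit_ /= dotZl dotZr; split; last by rewrite scalerA mulfV ?scale1r.
  by rewrite -{3}(sqr_sqrtr (dot_ge0 x)); field.
have contq x : {for x, continuous (fun y : 'rV[R]_n => dot (y *m A) y)}.
  by apply: continuous_dot; [apply: continuous_mulmx => k|move=> k]; exact: coord_continuous.
have contd x : {for x, continuous (fun y : 'rV[R]_n => dot y y)}.
  by apply: continuous_dot => k; exact: coord_continuous.
have cS : compact S.
  apply: (@subclosed_compact _ _ [set x : 'rV[R]_n | `|x - 0| <= 1]).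
  - rewrite (_ : S = (fun x => dot x x) @^-1` [set 1]) //.
    by apply: preimage_closed; [move=> x _; exact: contd|exact: closed_eq].
  - exact: compact_cball.
  move=> x /= Sx; rewrite subr0 -(ler_sqr (normr_ge0 _) ler01) expr1n -Sx.
  exact: norm_le_dot.
have S0 : S !=set0 by exists (unit_ v); exact: (unitP v v0).1.
have [w wS wmin] := EVT_min_rV S0 cS (continuous_subspaceT contq).
rewrite inE in wS.
set m := dot (w *m A) w in wmin.
have mle x : m * dot x x <= dot (x *m A) x.
  have [->|x0] := eqVneq x 0; first by rewrite !dot_lin mulr0.
  have [Su xE] := unitP x x0.
  have := wmin (unit_ x); rewrite inE => /(_ Su) H.
  rewrite [in leRHS]xE mulmx_scalel !dotZl dotZr mulrA -expr2 sqr_sqrtr ?dot_ge0 //.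
  by rewrite mulrC ler_pM2l // dot_gt0.
apply: le_trans (mle v); rewrite ler_wpM2r ?dot_ge0 //; apply: Ac.
apply/eigenvalueP; exists w; [apply/eqP|]; last first.
  by apply/eqP => w0; move: wS; rewrite /S /= w0 dot0l => /eqP; rewrite eq_sym oner_eq0.
have [z zE] : exists z, z = w *m A - m *: w by eexists.
rewrite -subr_eq0 -zE.
suff : dot z z = 0 by move/dot_eq0 ->.
have key t : 0 <= 2 * t * dot z z + t ^+ 2 * (dot (z *m A) z - m * dot z z).
  have := mle (w + t *: z).
  rewrite !quad_lin (dot_sym z w sA) wS (dotC z w) -/m.
  have : dot (w *m A) z = dot z z + m * dot w z.
    by rewrite {2}zE !dot_lin (dotC w z) subrK.
  by move=> ->; nra.
set b := dot (z *m A) z - m * dot z z in key.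
apply: contrapT => /eqP zz0.
have zz : 0 < dot z z by rewrite lt_neqAle eq_sym zz0 dot_ge0.
have b0 : 0 < `|b| + 1 by rewrite ltr_wpDl.
have := key (- (dot z z / (`|b| + 1))).
have : b <= `|b| by exact: ler_norm.
set B := `|b| in b0 *; set q := dot z z / (B + 1) => bB.
have q0 : 0 < q by rewrite divr_gt0.
have qE : dot z z = q * (B + 1) by rewrite /q divfK // gt_eqF.
rewrite qE => K.
have : q ^+ 2 * b <= q ^+ 2 * B by rewrite ler_wpM2l ?sqr_ge0.
have : 0 < q ^+ 2 by rewrite exprn_gt0.
have : 0 <= q ^+ 2 * B by rewrite mulr_ge0 ?sqr_ge0 ?normr_ge0.
rewrite (_ : (- q) ^+ 2 * b = q ^+ 2 * b) in K; last by ring.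
rewrite (_ : 2 * - q * (q * (B + 1)) = - 2 * (q ^+ 2 * B) - 2 * q ^+ 2) in K; last by ring.
by lra.
Qed.

Definition psd N := N^T = N /\ forall v, 0 <= dot (v *m N) v.

Lemma quad_rank1 v x : dot (x *m (v^T *m v)) x = dot x v ^+ 2.
Proof.
rewrite mulmxA (mx11_scalar (x *m v^T)) mul_scalar_mx dotZl.
by rewrite -/(dot x v) (dotC v) expr2.
Qed.

(** Cholesky elimination, by induction on the number of rows not yet zero. A zero diagonal entry
    forces its whole row to vanish; otherwise subtracting the rank-one matrix of the normalized row
    clears that row and keeps positivity by completing the square. *)
Lemma psd_sum_rank1 N : psd N -> exists vs : seq 'rV[R]_n, N = \sum_(v <- vs) v^T *m v.
Proof.
suff H k N' : (k <= n)%N -> (forall i j : 'I_n, (i < n - k)%N -> N' i j = 0) -> psd N' ->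
    exists vs : seq 'rV[R]_n, N' = \sum_(v <- vs) v^T *m v.
  by move=> pN; apply: (H n N (leqnn n)) => // i j; rewrite subnn.
elim: k N' => [|k IH] {}N kn z [sN pN].
  exists [::]; rewrite big_nil; apply/matrixP => i j.
  by rewrite mxE; apply: z; rewrite subn0.
have iP : (n - k.+1 < n)%N by rewrite ltn_subrL /= (leq_trans _ kn).
pose i := Ordinal iP.
have iE : (n - k = (i : nat).+1)%N by rewrite /= subnSK.
have sNij a b : N a b = N b a by rewrite -{1}sN mxE.
have q2 a b (t : R) : 0 <= t ^+ 2 * N a a + 2 * t * N a b + N b b.
  have := pN (t *: delta_mx 0 a + delta_mx 0 b).
  by rewrite !quad_lin !quad_delta (sNij b a); nra.
have [Nii|Nii] := eqVneq (N i i) 0.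
  apply: (IH N (ltnW kn)) => // a b; rewrite iE ltnS leq_eqVlt => /orP[/eqP ai|]; last exact: z.
  have -> : a = i by apply/val_inj.
  apply: contrapT => /eqP Nb.
  have := q2 i b (- ((N b b + 1) / (2 * N i b))); rewrite Nii.
  rewrite (_ : 2 * _ * N i b = - (N b b + 1)); last by field.
  by lra.
have a0 : 0 < N i i by rewrite lt_neqAle eq_sym Nii -quad_delta pN.
set a := N i i in Nii a0.
pose v : 'rV[R]_n := (Num.sqrt a)^-1 *: row i N.
have vv b c : (v^T *m v) b c = N i b * N i c / a.
  rewrite mxE big_ord1 !mxE -[in RHS](sqr_sqrtr (ltW a0)).
  by field; rewrite gt_eqF // sqrtr_gt0.
have [vs vsE] : exists vs : seq 'rV[R]_n, N - v^T *m v = \sum_(v <- vs) v^T *m v.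
  apply: (IH _ (ltnW kn)) => [b c|].
    rewrite iE ltnS leq_eqVlt => /orP[/eqP bi|bi].
      have -> : b = i by apply/val_inj.
      by rewrite [LHS]mxE [X in _ + X]mxE vv -/a mulrAC mulfV // mul1r subrr.
    have zb d : N b d = 0 by apply: z.
    by rewrite [LHS]mxE [X in _ + X]mxE vv (sNij i b) !zb !mul0r subr0.
  split=> [|x]; first by rewrite linearB /= sN trmx_mul trmxK.
  set s := dot (row i N) x.
  have := pN (x - (s / a) *: delta_mx 0 i).
  have e1 : dot (delta_mx 0 i *m N) x = s by rewrite -rowE.
  have e2 : dot (x *m N) (delta_mx 0 i) = s by rewrite (dot_sym _ _ sN).
  have e3 : dot (x *m (v^T *m v)) x = s ^+ 2 / a.
    rewrite quad_rank1 dotC /v dotZl -/s exprMn exprVn sqr_sqrtr ?(ltW a0) //.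
    by rewrite mulrC.
  rewrite mulmxDr mulmxN (dotDl (x *m N)) dotNl e3 !quad_lin e1 e2 quad_delta -/a.
  have -> : s ^+ 2 / a = (s / a) ^+ 2 * a by field.
  have -> : s = s / a * a by field.
  set t := s / a; have -> : t * a / a = t by field.
  by nra.
by exists (v :: vs); rewrite big_cons -vsE addrC subrK.
Qed.

Lemma trace_rank1 A v : \tr (A *m (v^T *m v)) = dot (v *m A) v.
Proof. by rewrite mulmxA mxtrace_mulC /dot mulmxA /mxtrace big_ord1. Qed.

Lemma trace_psd_ge A N (c : R) : psd N -> (forall v, c * dot v v <= dot (v *m A) v) ->
  c * \tr N <= \tr (A *m N).
Proof.
move=> /psd_sum_rank1[vs ->] H; rewrite mulmx_sumr !raddf_sum /= mulr_sumr.
apply: ler_sum => v _; rewrite trace_rank1; apply: le_trans (H v).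
by rewrite -{1}(mul1mx (v^T *m v)) trace_rank1 mulmx1.
Qed.

Lemma trace_psd_le A N (c : R) : psd N -> (forall v, dot (v *m A) v <= c * dot v v) ->
  \tr (A *m N) <= c * \tr N.
Proof.
move=> pN H; have := @trace_psd_ge (- A) N (- c) pN.
rewrite mulNmx linearN /= mulNr lerN2; apply=> v.
by rewrite mulmxN dotNl mulNr lerN2.
Qed.

Lemma quad_le_trace N v : psd N -> dot (v *m N) v <= \tr N * dot v v.
Proof.
move=> pN; rewrite -trace_rank1 mxtrace_mulC mulrC.
by apply: trace_psd_le => // x; rewrite quad_rank1 mulrC CS_dot.
Qed.

End Ellipticity.

Section Pucci.
Variables (R : realType) (n : nat) (gam Gam : R).
Hypothesis gam0 : 0 < gam.
Hypothesis gamGam : gam <= Gam.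
Implicit Types (A M N : 'M[R]_n) (v x : 'rV[R]_n).
Local Notation PM := (@pucci_minus R n gam Gam).

Lemma ellip_ge A v : ellip_set gam Gam A -> gam * dot v v <= dot (v *m A) v.
Proof. by move=> [sA eA]; apply: rayleigh_min => // a /eA /andP[]. Qed.

Lemma ellip_le A v : ellip_set gam Gam A -> dot (v *m A) v <= Gam * dot v v.
Proof.
move=> [sA eA].
have : - Gam * dot v v <= dot (v *m - A) v.
  apply: rayleigh_min => [|a]; first by rewrite linearN /= sA.
  move=> /eigenvalueP[x xA x0]; rewrite lerNl.
  have /eA/andP[] // : eigenvalue A (- a).
  by apply/eigenvalueP; exists x; rewrite // scaleNr -xA mulmxN opprK.
by rewrite mulmxN dotNl mulNr lerN2.
Qed.

Lemma ellip_nonempty : @ellip_set R n gam Gam !=set0.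
Proof.
exists gam%:M; split; first by rewrite /Defs.symmetric tr_scalar_mx.
move=> a /eigenvalueP[v]; rewrite mul_mx_scalar => /eqP.
rewrite -subr_eq0 -scalerBl scaler_eq0 subr_eq0 => /orP[/eqP <- _|-> //].
by rewrite lexx.
Qed.

Lemma pucci_minus_ge M (c : R) :
  (forall A, ellip_set gam Gam A -> c <= - \tr (A *m M)) -> c <= PM M.
Proof.
move=> H; apply: lb_le_inf.
  by have [A EA] := ellip_nonempty; exists (- \tr (A *m M)); exists A.
by move=> _ [A EA <-]; exact: H.
Qed.

Lemma psd_shift M : M^T = M -> psd (M + (n%:R ^+ 2 * `|M|)%:M).
Proof.
move=> sM; split; first by rewrite linearD /= tr_scalar_mx sM.
move=> v; rewrite mulmxDr dotDl mul_mx_scalar dotZl.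
have := quad_bound v M v; rewrite -mulrA -expr2 ler_norml => /andP[+ _].
have : n%:R ^+ 2 * `|M| * `|v| ^+ 2 <= n%:R ^+ 2 * `|M| * dot v v.
  by rewrite ler_wpM2l ?norm_le_dot // mulr_ge0 ?sqr_ge0.
by lra.
Qed.

Lemma mulmx_scal_trace A (c : R) : \tr (A *m c%:M) = c * \tr A.
Proof. by rewrite mul_mx_scalar linearZ. Qed.

Lemma psd1 : psd (1%:M : 'M[R]_n).
Proof. by split=> [|v]; rewrite ?tr_scalar_mx // mulmx1 dot_ge0. Qed.

Lemma ellip_trace A : ellip_set gam Gam A -> 0 <= \tr A <= Gam * n%:R.
Proof.
move=> EA; have tr1 : \tr (1%:M : 'M[R]_n) = n%:R by rewrite mxtrace1.
have := trace_psd_ge psd1 (fun v => ellip_ge v EA).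
have := trace_psd_le psd1 (fun v => ellip_le v EA).
rewrite mulmx1 tr1 => -> /= ; rewrite andbT; apply: le_trans.
by rewrite mulr_ge0 // ltW.
Qed.

(** [inf] takes a default value on sets without a lower bound, so one has to be exhibited: [M] plus
    a multiple of the identity is positive semidefinite, and its trace against elliptic matrices is
    at most [Gam] times its own trace. *)
Lemma pucci_minus_le M A : M^T = M -> ellip_set gam Gam A ->
  PM M <= - \tr (A *m M).
Proof.
move=> sM EA; apply: ge_inf; last by exists A.
set c := n%:R ^+ 2 * `|M|.
exists (- (Gam * \tr (M + c%:M))) => _ [B EB <-].
rewrite lerN2.
have := trace_psd_le (psd_shift sM) (fun v => ellip_le v EB).
rewrite mulmxDr linearD /= mulmx_scal_trace -/c; apply: le_trans.
rewrite lerDl mulr_ge0 //; last by case/andP: (ellip_trace EB).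
by rewrite mulr_ge0 ?sqr_ge0.
Qed.

Lemma pucci_minus_sub_psd M N : M^T = M -> psd N ->
  PM M + gam * \tr N <= PM (M - N).
Proof.
move=> sM pN; apply: pucci_minus_ge => A EA.
rewrite mulmxBr linearB /= opprB addrC lerD //; last exact: pucci_minus_le.
by apply: trace_psd_ge => // v; exact: ellip_ge.
Qed.

Lemma pucci_minus_add_scal M (c : R) : M^T = M -> 0 <= c ->
  PM M - c * (Gam * n%:R) <= PM (M + c%:M).
Proof.
move=> sM c0; apply: pucci_minus_ge => A EA.
rewrite mulmxDr linearD /= mulmx_scal_trace opprD lerD ?pucci_minus_le // lerN2.
by rewrite ler_wpM2l //; case/andP: (ellip_trace EA).
Qed.

End Pucci.

Section QuadraticTest.
Variables (R : realType) (n : nat).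
Implicit Types (p x v : 'rV[R]_n) (M : 'M[R]_n) (O : set 'rV[R]_n).

Lemma derive_quotient (f : 'rV[R]_n -> R) x v (a b : R) :
  (forall h, f (h *: v + x) - f x = h * (a + h * b)) ->
  derivable f x v /\ derive f x v = a.
Proof.
move=> H.
suff L : h^-1 *: (f (h *: v + x) - f x) @[h --> 0^'] --> a.
  by split; [apply/cvg_ex; exists a|exact: cvg_lim].
have L : (a + h * b) @[h --> 0^'] --> a.
  rewrite -[X in _ --> X]addr0 -[X in _ --> _ + X](mul0r b).
  apply: cvgD; first exact: cvg_cst.
  apply: cvgM; last exact: cvg_cst.
  by apply: cvg_within_filter; exact: cvg_id.
apply: cvg_trans L; apply: near_eq_cvg.
near=> h; have h0 : h != 0 by near: h; exact: nbhs_dnbhs_neq.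
by rewrite H /= /GRing.scale /= mulKf.
Unshelve. all: by end_near.
Qed.

Definition qform p M x0 : 'rV[R]_n -> R :=
  fun x => dot p (x - x0) + 2^-1 * dot ((x - x0) *m M) (x - x0).

Lemma qform_derive p M x0 i x : M^T = M ->
  derivable (qform p M x0) x (basis_vec R i) /\
  partial i (qform p M x0) x = p 0 i + ((x - x0) *m M) 0 i.
Proof.
move=> sM; apply: (@derive_quotient _ _ _ _ (2^-1 * M i i)) => h.
rewrite /qform -(addrA (h *: _)) -/(basis_vec R i) -(dot_delta p) -(dot_delta (_ *m M)).
rewrite -(quad_delta M) -/(basis_vec R i).
move: (x - x0) (basis_vec R i) => y e.
by rewrite !quad_lin (dot_sym e y sM); field.
Qed.

Lemma qform_derive2 p M x0 i j x : M^T = M ->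
  derivable (partial i (qform p M x0)) x (basis_vec R j) /\
  partial j (partial i (qform p M x0)) x = M i j.
Proof.
move=> sM; have -> : partial i (qform p M x0) = fun x => p 0 i + ((x - x0) *m M) 0 i.
  by apply/funext => y; exact: (qform_derive p x0 i y sM).2.
apply: (@derive_quotient _ _ _ _ 0) => h.
rewrite -(addrA (h *: _)) mulmxDl mulmx_scalel -!(dot_delta _ i) dotDl dotZl (dot_delta (_ *m M) i).
have -> : (basis_vec R j *m M) 0 i = M i j by rewrite -rowE mxE -{1}sM mxE.
by ring.
Qed.

Lemma qform_C2 p M x0 O : M^T = M -> C2_on O (qform p M x0).
Proof.
move=> sM x _.
have cB := @continuous_coordB R n x0 x.
have cM := continuous_mulmx (A := M) cB.
split=> [|i|i j].
- apply: continuousD; first by apply: continuous_dot => // k; exact: cst_continuous.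
  by apply: continuousM; [exact: cst_continuous|exact: continuous_dot].
- split; first exact: (qform_derive p x0 i x sM).1.
  have -> : partial i (qform p M x0) = fun x => p 0 i + ((x - x0) *m M) 0 i.
    by apply/funext => y; exact: (qform_derive p x0 i y sM).2.
  by apply: continuousD; [exact: cst_continuous|exact: cM].
- split; first exact: (qform_derive2 p x0 i j x sM).1.
  have -> : partial j (partial i (qform p M x0)) = fun=> M i j.
    by apply/funext => y; exact: (qform_derive2 p x0 i j y sM).2.
  exact: cst_continuous.
Qed.

Lemma qform_grad p M x0 : M^T = M -> grad (qform p M x0) x0 = p.
Proof.
move=> sM; apply/rowP => i; rewrite mxE (qform_derive p x0 i x0 sM).2.
by rewrite subrr mul0mx mxE addr0.
Qed.

Lemma qform_hess p M x0 : M^T = M -> hess (qform p M x0) x0 = M.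
Proof.
by move=> sM; apply/matrixP => i j; rewrite mxE (qform_derive2 p x0 i j x0 sM).2.
Qed.

Lemma visc_sub_quad (F : NLop R n) O u f p M x0 : visc_sub F O u f -> O x0 -> M^T = M ->
  (\forall y \near x0, u y <= u x0 + qform p M x0 y) -> F M p (u x0) x0 <= f x0.
Proof.
move=> Vu Ox sM H; have := Vu _ x0 (@qform_C2 p M x0 O sM) Ox.
rewrite qform_grad // qform_hess //; apply; rewrite /local_max.
have -> : qform p M x0 x0 = 0 by rewrite /qform subrr !(mul0mx, dot_lin, mulr0, addr0).
by rewrite subr0; apply: filterS H => y; rewrite lerBlDr.
Qed.

Lemma visc_super_quad (F : NLop R n) O u f p M x0 : visc_super F O u f -> O x0 -> M^T = M ->
  (\forall y \near x0, u x0 + qform p M x0 y <= u y) -> f x0 <= F M p (u x0) x0.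
Proof.
move=> Vu Ox sM H; have := Vu _ x0 (@qform_C2 p M x0 O sM) Ox.
rewrite qform_grad // qform_hess //; apply; rewrite /local_min.
have -> : qform p M x0 x0 = 0 by rewrite /qform subrr !(mul0mx, dot_lin, mulr0, addr0).
by rewrite subr0; apply: filterS H => y; rewrite lerBrDr.
Qed.

End QuadraticTest.

(** * Doubling of variables *)

Lemma qformN (R : realType) (n : nat) (p : 'rV[R]_n) (Y : 'M[R]_n) x z :
  qform (- p) (- Y) x z = - qform p Y x z.
Proof. by rewrite /qform mulmxN !dotNl; ring. Qed.

Section NearNorm.
Variables (R : realType) (n : nat).
Implicit Types (x c z : 'rV[R]_n).

Lemma near_normP c (P : 'rV[R]_n -> Prop) : (\forall z \near c, P z) <->
  exists e : R, 0 < e /\ forall z, `|z - c| < e -> P z.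
Proof.
split=> [/nbhs_ballP[e /= e0 H]|[e [e0 H]]].
  by exists e; split=> // z zc; apply: H; rewrite -ball_normE /ball_ /= distrC.
by apply/nbhs_ballP; exists e => //= z; rewrite -ball_normE /ball_ /= distrC; exact: H.
Qed.

Lemma continuous_normP (f : 'rV[R]_n -> R) c : {for c, continuous f} <->
  forall eps : R, 0 < eps -> exists e : R, 0 < e /\
    forall z, `|z - c| < e -> `|f z - f c| <= eps.
Proof.
split=> [cf eps e0|H].
  have /cvgrPdist_le/(_ eps e0)/near_normP[e [e1 eP]] := cf.
  by exists e; split=> // z zc; rewrite distrC; exact: eP.
apply/(@cvgrPdist_le _ _ _ (nbhs c) _ f (f c)) => eps e0; apply/near_normP; have [e [e1 eP]] := H _ e0.
by exists e; split=> // z zc; rewrite distrC; exact: eP.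
Qed.

Lemma within_normP (A : set 'rV[R]_n) (f : 'rV[R]_n -> R) : {within A, continuous f} <->
  forall c, A c -> forall eps : R, 0 < eps -> exists e : R, 0 < e /\
    forall z, A z -> `|z - c| < e -> `|f z - f c| <= eps.
Proof.
rewrite subspace_continuousP; split=> H c Ac.
  move=> eps e0; have /cvgrPdist_le/(_ eps e0) := H c Ac.
  rewrite near_withinE => /near_normP[e [e1 eP]].
  by exists e; split=> // z Az zc; rewrite distrC; exact: eP.
apply/cvgrPdist_le => eps e0; rewrite near_withinE; apply/near_normP.
have [e [e1 eP]] := H c Ac _ e0.
by exists e; split=> // z zc Az; rewrite distrC; exact: eP.
Qed.

Lemma within_continuous_at (A : set 'rV[R]_n) (f : 'rV[R]_n -> R) :
  (forall y, A y -> {for y, continuous f}) -> {within A, continuous f}.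
Proof.
move=> H; apply/within_normP => c Ac eps e0.
by have [e [e1 eP]] := (continuous_normP f c).1 (H c Ac) _ e0; exists e; split=> // z _; exact: eP.
Qed.

Lemma cball_max (f : 'rV[R]_n -> R) x (r : R) : 0 <= r ->
  (forall y, `|y - x| <= r -> {for y, continuous f}) ->
  exists c, `|c - x| <= r /\ forall y, `|y - x| <= r -> f y <= f c.
Proof.
move=> r0 cf; pose B := [set y | `|y - x| <= r].
have B0 : B !=set0 by exists x; rewrite /B /= subrr normr0.
have [c cB cmax] := EVT_max_rV B0 (@compact_cball R n x r) (within_continuous_at cf).
rewrite inE in cB; exists c; split=> // y yB.
by apply: cmax; rewrite inE.
Qed.

Lemma qformB p (X : 'M[R]_n) x c z : X^T = X ->
  qform p X x z - qform p X x c = qform (p + (c - x) *m X) X c z.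
Proof.
move=> sX; rewrite /qform (_ : z - x = (c - x) + (z - c)); last by rewrite [RHS]addrC addrA subrK.
move: (c - x) (z - c) => a b.
by rewrite !quad_lin (dot_sym b a sX); field.
Qed.

Lemma qform_continuous p (X : 'M[R]_n) x : X^T = X -> continuous (qform p X x).
Proof. by move=> sX y; have [] := @qform_C2 _ _ p X x setT sX y I. Qed.

Lemma qform_center p (X : 'M[R]_n) x : qform p X x x = 0.
Proof. by rewrite /qform subrr !(mul0mx, dot_lin, mulr0, addr0). Qed.

(** This is why an expansion at a single scale suffices. Adding [4 * dl] to the Hessian raises the
    test function by at least [2 * dl * r ^+ 2] where [|h| = r], more than the error [dl * r ^+ 2];
    the maximum of the difference is then interior and yields an exact jet at a nearby point. *)
Lemma interior_max (u : 'rV[R]_n -> R) x (r dl : R) p (X : 'M[R]_n) :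
  0 < r -> 0 < dl -> X^T = X ->
  (forall y, `|y - x| <= r -> {for y, continuous u}) ->
  (forall h, `|h| <= r -> u (x + h) <= u x + dot p h + 2^-1 * dot (h *m X) h + dl * r ^+ 2) ->
  let X' := X + (4 * dl)%:M in
  exists h1, `|h1| < r /\ \forall z \near (x + h1),
    u z <= u (x + h1) + qform (p + h1 *m X') X' (x + h1) z.
Proof.
move=> r0 d0 sX cu H X'.
have sX' : X'^T = X' by rewrite linearD /= sX tr_scalar_mx.
pose psi y := u y - qform p X' x y.
have [y yr|c [cB cmax]] := @cball_max psi x r (ltW r0).
  by apply: continuousB; [exact: cu|exact: qform_continuous].
have cx : `|c - x| < r.
  rewrite lt_neqAle cB andbT; apply/negP => /eqP cr.
  have := cmax x; rewrite subrr normr0 => /(_ (ltW r0)).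
  rewrite /psi qform_center subr0 => ux.
  have := H (c - x); rewrite subrKC => /(_ cB).
  move: ux; rewrite /qform /X' mulmxDr mul_mx_scalar dotDl dotZl.
  have := norm_le_dot (c - x); rewrite cr => rc.
  have : 0 < dl * r ^+ 2 by rewrite mulr_gt0 ?exprn_gt0.
  have : dl * r ^+ 2 <= dl * dot (c - x) (c - x) by rewrite ler_pM2l.
  by lra.
exists (c - x); split=> //; rewrite subrKC.
apply/near_normP; exists (r - `|c - x|); split=> [|z zc]; first by rewrite subr_gt0.
have zmax := cmax z.
have {}zmax : psi z <= psi c.
  apply: zmax; rewrite (_ : z - x = (z - c) + (c - x)); last by rewrite addrA subrK.
  by apply: le_trans (ler_normD _ _) _; rewrite -lerBrDr ltW.
rewrite -qformB //; move: zmax; rewrite /psi; move: (qform _ _ _ _) (qform _ _ _ _) => a b; lra.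
Qed.

Lemma supconv (u : 'rV[R]_n -> R) x0 (r c : R) : 0 < r -> 0 < c ->
  (forall y, `|y - x0| <= r -> {for y, continuous u}) ->
  exists (U : 'rV[R]_n -> R) (pr : 'rV[R]_n -> 'rV[R]_n), forall x,
    [/\ `|pr x - x0| <= r, U x = u (pr x) - c * dot (x - pr x) (x - pr x) &
     forall x', `|x' - x0| <= r -> u x' - c * dot (x - x') (x - x') <= U x].
Proof.
move=> r0 c0 cu.
have ex x : exists y, `|y - x0| <= r /\ forall x', `|x' - x0| <= r ->
    u x' - c * dot (x - x') (x - x') <= u y - c * dot (x - y) (x - y).
  have [y yr|y [yB ymax]] := @cball_max (fun y => u y - c * dot (y - x) (y - x)) x0 r (ltW r0).
    apply: continuousB; first exact: cu.
    apply: continuousM; first exact: cst_continuous.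
    by apply: continuous_dot => k; exact: continuous_coordB.
  exists y; split=> // x' /ymax.
  by rewrite -(opprB x x') -(opprB x y) !dotNl !dotNr !opprK.
have /choice[pr prP] := ex.
exists (fun x => u (pr x) - c * dot (x - pr x) (x - pr x)), pr => x.
by have [h1 h2] := prP x.
Qed.

End NearNorm.

Section RowPairs.
Variables (R : realType) (n : nat).
Implicit Types (a b : 'rV[R]_n) (z : 'rV[R]_(n + n)).

Lemma norm_lsubmx z : `|lsubmx z| <= `|z|.
Proof. by apply/mxnorm_leP => // i k; rewrite mxE; exact: coord_le_mxnorm. Qed.

Lemma norm_rsubmx z : `|rsubmx z| <= `|z|.
Proof. by apply/mxnorm_leP => // i k; rewrite mxE; exact: coord_le_mxnorm. Qed.

Lemma norm_row_mx a b (c : R) : `|a| <= c -> `|b| <= c -> `|row_mx a b| <= c.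
Proof.
move=> ac bc; have c0 : 0 <= c by apply: le_trans ac.
apply/mxnorm_leP => // i k; rewrite mxE.
by case: (fintype.split k) => j; apply: le_trans (coord_le_mxnorm _ _ _) _.
Qed.

Lemma dot_row_mx a b a' b' : dot (row_mx a b) (row_mx a' b') = dot a a' + dot b b'.
Proof. by rewrite /dot tr_row_mx mul_row_col mxE. Qed.

Lemma quad_row_mxl (H : 'M[R]_(n + n)) a :
  dot (row_mx a 0 *m H) (row_mx a 0) = dot (a *m ulsubmx H) a.
Proof.
by rewrite -{1}(submxK H) mul_row_block !mul0mx !addr0 dot_row_mx dot0r addr0.
Qed.

Lemma quad_row_mxr (H : 'M[R]_(n + n)) a :
  dot (row_mx 0 a *m H) (row_mx 0 a) = dot (a *m drsubmx H) a.
Proof.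
by rewrite -{1}(submxK H) mul_row_block !mul0mx !add0r dot_row_mx dot0r add0r.
Qed.

Lemma norm_ulsubmx (H : 'M[R]_(n + n)) : `|ulsubmx H| <= `|H|.
Proof. by apply/mxnorm_leP => // i k; rewrite !mxE; exact: coord_le_mxnorm. Qed.

Lemma norm_drsubmx (H : 'M[R]_(n + n)) : `|drsubmx H| <= `|H|.
Proof. by apply/mxnorm_leP => // i k; rewrite !mxE; exact: coord_le_mxnorm. Qed.

Lemma continuous_lsubmx (f : 'rV[R]_n -> R) z : {for lsubmx z, continuous f} ->
  {for z, continuous (fun z : 'rV[R]_(n + n) => f (lsubmx z))}.
Proof.
move=> /continuous_normP cf; apply/continuous_normP => eps /cf[e [e0 eP]].
exists e; split=> // y yz; apply: eP; rewrite -linearB.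
exact: le_lt_trans (norm_lsubmx _) yz.
Qed.

Lemma continuous_rsubmx (f : 'rV[R]_n -> R) z : {for rsubmx z, continuous f} ->
  {for z, continuous (fun z : 'rV[R]_(n + n) => f (rsubmx z))}.
Proof.
move=> /continuous_normP cf; apply/continuous_normP => eps /cf[e [e0 eP]].
exists e; split=> // y yz; apply: eP; rewrite -linearB.
exact: le_lt_trans (norm_rsubmx _) yz.
Qed.

Lemma continuous_subl_subr (f : 'rV[R]_n -> R) z : {for lsubmx z - rsubmx z, continuous f} ->
  {for z, continuous (fun z : 'rV[R]_(n + n) => f (lsubmx z - rsubmx z))}.
Proof.
move=> /continuous_normP cf; apply/continuous_normP => eps /cf[e [e0 eP]].
exists (e / 2); split=> [|y yz]; first by rewrite divr_gt0.
apply: eP.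
have -> : lsubmx y - rsubmx y - (lsubmx z - rsubmx z) = lsubmx (y - z) - rsubmx (y - z).
  by apply/rowP => k; rewrite !mxE; ring.
apply: le_lt_trans (ler_normB _ _) _.
by have := norm_lsubmx (y - z); have := norm_rsubmx (y - z); move: yz; lra.
Qed.

End RowPairs.

(** * Sup-convolutions and jets of a sum *)

Section SupConvolution.
Variables (R : realType) (n : nat) (u : 'rV[R]_n -> R) (x0 : 'rV[R]_n) (r c : R).
Variables (U : 'rV[R]_n -> R) (pr : 'rV[R]_n -> 'rV[R]_n).
Hypothesis c0 : 0 < c.
Hypothesis UP : forall x,
    [/\ `|pr x - x0| <= r, U x = u (pr x) - c * dot (x - pr x) (x - pr x) &
     forall x', `|x' - x0| <= r -> u x' - c * dot (x - x') (x - x') <= U x].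

(** The maximizer for [x] is a competitor at [x + h]. This is the semiconvexity of [U], with an
    explicit slope. *)
Lemma supconv_ge x h :
  U x - 2 * c * dot (x - pr x) h - c * dot h h <= U (x + h).
Proof.
have [h1 h2 _] := UP x; have [_ _ /(_ _ h1)] := UP (x + h).
rewrite h2 (addrAC x h) !quad_lin; apply: le_trans.
rewrite (dotC h x) (dotC h (pr x)) (dotC (pr x) x).
by apply: eq_ler; ring.
Qed.

(** Increments of [u] from [pr x] are dominated by those of [U] from [x], so an upper expansion of
    [U] at [x] transfers to [u] at [pr x] with the same slope and Hessian. *)
Lemma supconv_translate x h : `|pr x + h - x0| <= r ->
  u (pr x + h) - u (pr x) <= U (x + h) - U x.
Proof.
move=> hr; have [_ h2 _] := UP x; have [_ _ /(_ _ hr)] := UP (x + h).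
rewrite h2 opprD addrACA subrr addr0; lra.
Qed.

Lemma supconv_continuous x : {for x, continuous U}.
Proof.
apply/continuous_normP => eps e0.
pose B := `|x - x0| + r + 1.
have r0 : 0 <= r by have [h1 _ _] := UP x; apply: le_trans h1.
have B0 : 0 < B by rewrite ltr_wpDl // addr_ge0.
have near y : `|y - x| <= 1 -> `|y - pr y| <= B.
  move=> yx; have [h1 _ _] := UP y; rewrite distrC in h1.
  have -> : y - pr y = (y - x) + (x - x0) + (x0 - pr y) by rewrite !addrA !subrK.
  by have := ler_normD (y - x + (x - x0)) (x0 - pr y); have := ler_normD (y - x) (x - x0); rewrite /B; lra.
have half y k : `|y - pr y| <= B -> `|k| <= 1 ->
    U y - U (y + k) <= c * n%:R * (2 * B + 1) * `|k|.
  move=> yB k1; have := supconv_ge y k.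
  have h1 : dot (y - pr y) k <= n%:R * B * `|k|.
    apply: le_trans (ler_norm _) _; apply: le_trans (dot_bound _ _) _.
    by rewrite ler_wpM2r // ler_wpM2l.
  have h2 : dot k k <= n%:R * 1 * `|k|.
    apply: le_trans (dot_le_norm k) _; rewrite expr2 -mulrA ler_wpM2l // ler_wpM2r //.
  have := ler_wpM2l (ltW c0) h1; have := ler_wpM2l (ltW c0) h2; lra.
pose K := c * n%:R * (2 * B + 1) + 1.
have K0 : 0 < K by rewrite ltr_wpDl // !mulr_ge0 ?(ltW c0) // addr_ge0 // mulr_ge0 // ltW.
exists (Num.min 1 (eps / K)); split; first by rewrite lt_min ltr01 divr_gt0.
move=> z; rewrite lt_min => /andP[z1]; rewrite ltr_pdivlMr // => zK.
have z1' := ltW z1.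
have b1 : `|z - pr z| <= B by exact: near.
have b2 : `|x - pr x| <= B by apply: near; rewrite subrr normr0.
have := half x (z - x) b2 z1'; rewrite subrKC.
have z1'' : `|x - z| <= 1 by rewrite distrC.
have := half z (x - z) b1 z1''; rewrite subrKC (distrC x z).
have : c * n%:R * (2 * B + 1) * `|z - x| <= eps.
  have : 0 <= `|z - x| by []. move: zK; rewrite /K; lra.
rewrite ler_norml; lra.
Qed.

End SupConvolution.

Lemma qform_incr (R : realType) (n : nat) p (X : 'M[R]_n) x0 x h : X^T = X ->
  qform p X x0 (x + h) - qform p X x0 x =
    dot (p + (x - x0) *m X) h + 2^-1 * dot (h *m X) h.
Proof. by move=> sX; rewrite qformB // /qform addrAC subrr add0r. Qed.

Lemma quad_le_dot (R : realType) (n : nat) (A : 'M[R]_n) x :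
  `|dot (x *m A) x| <= n%:R ^+ 2 * `|A| * dot x x.
Proof.
apply: le_trans (quad_bound _ _ _) _; rewrite -mulrA -expr2.
by rewrite ler_wpM2l ?norm_le_dot // mulr_ge0 ?sqr_ge0.
Qed.

Lemma dot_subr_le (R : realType) (n : nat) (a b : 'rV[R]_n) :
  dot (a - b) (a - b) <= 2 * dot a a + 2 * dot b b.
Proof. by have := dot_ge0 (a + b); rewrite !dot_lin (dotC b a); lra. Qed.

Section LinearBounds.
Variable R : realFieldType.
Implicit Types (a b c d e q r x y : R).

Lemma double_le1 a r : a <= 2 * r -> 4 * r <= 1 -> 0 < r -> a <= 1.
Proof. lra. Qed.

Lemma eighth_le_half q r : q <= r / 8 -> 0 < r -> q <= r / 2.
Proof. lra. Qed.

Lemma quarter_eighth a b q r : a <= r / 4 -> b <= q -> q <= r / 8 -> 0 < r -> a + b <= r.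
Proof. lra. Qed.

Lemma quarter_tau a b tau r : a <= tau -> b <= r / 4 -> tau <= r / 8 -> 0 < r -> a + b <= r / 2.
Proof. lra. Qed.

Lemma half_half a b r : a <= r / 2 -> b <= r / 2 -> a + b <= r.
Proof. lra. Qed.

Lemma le_of_expansion a b c d e x y : x - y - c - d <= e -> a - b <= x - y -> a <= b + c + d + e.
Proof. lra. Qed.

Lemma slope_arith a b c d e x y z : a <= b + x -> x <= y + z -> y <= c -> z <= 8 * d ->
  b <= d -> c + 9 * d <= e -> a <= e.
Proof. lra. Qed.

Lemma untilt a b c d : a - (c + d) <= b - c -> a <= b + d.
Proof. lra. Qed.

Lemma le_half_of32 d q r : 32 * d <= r -> 0 < d -> q <= d -> q <= r / 2.
Proof. lra. Qed.

Lemma half_le a b : a <= b -> 0 < a -> a / 2 <= b.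
Proof. lra. Qed.

Lemma le_of_half a b c : a <= b -> b <= c / 2 -> 0 < c -> a <= c.
Proof. lra. Qed.

Lemma add_scalar_part a b c d e x y :
  a + b <= c + 24 * d * (x + y) -> 32 * d * (x + y) <= e ->
  a + 4 * (2 * d) * x + (b + 4 * (2 * d) * y) <= c + e.
Proof. lra. Qed.

End LinearBounds.

Section SumJets.
Variables (R : realType) (n : nat) (u1 u2 : 'rV[R]_n -> R) (x0 : 'rV[R]_n) (r : R).
Variables (p : 'rV[R]_n) (M1 : 'M[R]_n).
Variables (Psi : 'rV[R]_n -> R) (D : 'rV[R]_n -> 'rV[R]_n) (S : 'rV[R]_n -> 'M[R]_n) (CP : R).
Hypothesis r0 : 0 < r.
Hypothesis r1 : 4 * r <= 1.
Hypothesis sM1 : M1^T = M1.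
Hypothesis sS : forall z, (S z)^T = S z.
Hypothesis CP0 : 0 <= CP.
Hypothesis cu1 : forall y, `|y - x0| <= r -> {for y, continuous u1}.
Hypothesis cu2 : forall y, `|y - x0| <= r -> {for y, continuous u2}.
Hypothesis PsiT : forall z h, `|z| <= 1 -> `|h| <= 1 ->
  `|Psi (z + h) - Psi z - dot (D z) h - 2^-1 * dot (h *m S z) h| <= CP * `|h| ^+ 3.
Hypothesis PsiC : forall z h, Psi (z + h) <= Psi z + dot (D z) h + CP * dot h h.
Hypothesis PsiL : forall z h, `|z| <= 1 -> `|h| <= 1 -> `|Psi (z + h) - Psi z| <= CP * `|h|.
Hypothesis PsiS : forall z, `|z| <= 1 -> `|S z| <= CP.

Definition pen x y := qform p M1 x0 x + Psi (x - y).
Definition obj x y := u1 x + u2 y - pen x y.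

Lemma pen_incr x y h1 h2 : pen (x + h1) (y + h2) - pen x y =
  dot (p + (x - x0) *m M1) h1 + 2^-1 * dot (h1 *m M1) h1 +
  (Psi ((x - y) + (h1 - h2)) - Psi (x - y)).
Proof.
rewrite -(qform_incr p x0 x h1 sM1) /pen.
have -> : x + h1 - (y + h2) = x - y + (h1 - h2) by rewrite opprD addrACA.
by ring.
Qed.

Lemma sub_ball x y : `|x - x0| <= r -> `|y - x0| <= r -> `|x - y| <= 2 * r.
Proof.
move=> xr yr; rewrite (_ : x - y = (x - x0) - (y - x0)).
  by have := ler_normB (x - x0) (y - x0); lra.
by rewrite opprB addrA subrK.
Qed.

Lemma pen_lip : exists CL, 0 <= CL /\ forall x y x' y',
  `|x - x0| <= r -> `|y - x0| <= r -> `|x' - x0| <= r -> `|y' - x0| <= r ->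
  `|pen x y - pen x' y'| <= CL * (`|x - x'| + `|y - y'|).
Proof.
pose C1 := n%:R * (`|p| + n%:R * `|M1|) + n%:R ^+ 2 * `|M1|.
have C10 : 0 <= C1 by rewrite addr_ge0 // !mulr_ge0 ?sqr_ge0 // addr_ge0 // mulr_ge0.
exists (C1 + CP); split=> [|x y x' y' xr yr x'r y'r]; first exact: addr_ge0.
have hx : `|x - x'| <= 1 by apply: le_trans (sub_ball xr x'r) _; move: r1 r0; lra.
have hy : `|y - y'| <= 1 by apply: le_trans (sub_ball yr y'r) _; move: r1 r0; lra.
have := pen_incr x' y' (x - x') (y - y'); rewrite !subrKC => ->.
have x'1 : `|x' - x0| <= 1 by apply: le_trans x'r _; move: r1 r0; lra.
have A1 : `|dot (p + (x' - x0) *m M1) (x - x')| <= n%:R * (`|p| + n%:R * `|M1|) * `|x - x'|.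
  apply: le_trans (dot_bound _ _) _; rewrite ler_wpM2r // ler_wpM2l //.
  apply: le_trans (ler_normD _ _) _; rewrite lerD2l.
  apply: le_trans (mulmx_bound _ _) _; rewrite ler_wpM2r //.
  by rewrite ler_piMr.
have A2 : `|dot ((x - x') *m M1) (x - x')| <= n%:R ^+ 2 * `|M1| * `|x - x'|.
  apply: le_trans (quad_bound _ _ _) _; rewrite ler_piMr // !mulr_ge0 ?sqr_ge0 //.
have A3 : `|Psi (x' - y' + (x - x' - (y - y'))) - Psi (x' - y')| <= CP * (`|x - x'| + `|y - y'|).
  have e : `|x - x' - (y - y')| <= `|x - x'| + `|y - y'| by exact: ler_normB.
  apply: le_trans (PsiL _ _) _.
  - by apply: le_trans (sub_ball x'r y'r) _; move: r1 r0; lra.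
  - rewrite (_ : x - x' - (y - y') = (x - y) - (x' - y')); last by apply/rowP => k; rewrite !mxE; ring.
    by have := ler_normB (x - y) (x' - y'); have := sub_ball xr yr; have := sub_ball x'r y'r; move: r1; lra.
  by rewrite ler_wpM2l.
have : 0 <= C1 * `|y - y'| by rewrite mulr_ge0.
have : 0 <= n%:R ^+ 2 * `|M1| * `|x - x'| by rewrite !mulr_ge0 ?sqr_ge0.
move: A1 A2 A3; rewrite /C1.
move: (dot _ _) (dot _ _) (Psi _ - Psi _) => d1 d2 d3.
rewrite !mulrDl !mulrDr.
rewrite !ler_norml => /andP[a1 a2] /andP[a3 a4] /andP[a5 a6] a7 a8.
by apply/andP; split; lra.
Qed.

Lemma obj_bound : exists Bd, 0 <= Bd /\ forall x y, `|x - x0| <= r -> `|y - x0| <= r ->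
  obj x y <= obj x0 x0 + Bd.
Proof.
have [y yr|b1 [_ b1P]] := @cball_max _ _ (fun x => u1 x - qform p M1 x0 x) x0 r (ltW r0).
  by apply: continuousB; [exact: cu1|exact: qform_continuous].
have [//|b2 [_ b2P]] := @cball_max _ _ u2 x0 r (ltW r0).
have B0 : 0 <= (u1 b1 - qform p M1 x0 b1) + u2 b2 - Psi 0 + CP - obj x0 x0.
  have := b1P x0; have := b2P x0; rewrite /obj /pen subrr normr0 => /(_ (ltW r0)) + /(_ (ltW r0)).
  by move: CP0; lra.
exists (u1 b1 - qform p M1 x0 b1 + u2 b2 - Psi 0 + CP - obj x0 x0); split=> // x y xr yr.
have := b1P x xr; have := b2P y yr; rewrite /obj /pen.
have xy : `|x - y| <= 1 by apply: le_trans (sub_ball xr yr) _; move: r1 r0; lra.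
have := PsiL (_ : `|0 : 'rV[R]_n| <= 1) xy; rewrite normr0 add0r => /(_ ler01).
have : CP * `|x - y| <= CP by rewrite ler_piMr.
by rewrite ler_norml => h /andP[h1 h2]; lra.
Qed.

Section Conv.
Variables (c : R) (U1 U2 : 'rV[R]_n -> R) (pr1 pr2 : 'rV[R]_n -> 'rV[R]_n).
Hypothesis c0 : 0 < c.
Hypothesis U1P : forall x,
    [/\ `|pr1 x - x0| <= r, U1 x = u1 (pr1 x) - c * dot (x - pr1 x) (x - pr1 x) &
     forall x', `|x' - x0| <= r -> u1 x' - c * dot (x - x') (x - x') <= U1 x].
Hypothesis U2P : forall x,
    [/\ `|pr2 x - x0| <= r, U2 x = u2 (pr2 x) - c * dot (x - pr2 x) (x - pr2 x) &
     forall x', `|x' - x0| <= r -> u2 x' - c * dot (x - x') (x - x') <= U2 x].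

Definition regobj (z : 'rV[R]_(n + n)) :=
  U1 (lsubmx z) + U2 (rsubmx z) - pen (lsubmx z) (rsubmx z).

Lemma regobj_row x y : regobj (row_mx x y) = U1 x + U2 y - pen x y.
Proof. by rewrite /regobj row_mxKl row_mxKr. Qed.

Lemma regobj_semiconvex z : exists q, forall h,
  regobj z + dot q h - (c + n%:R ^+ 2 * `|M1| + 2 * CP + 1) * dot h h <= regobj (z + h).
Proof.
rewrite -[z]hsubmxK; move: (lsubmx z) (rsubmx z) => x y.
exists (row_mx (- (2 * c) *: (x - pr1 x) - (p + (x - x0) *m M1) - D (x - y))
               (- (2 * c) *: (y - pr2 y) + D (x - y))) => h.
rewrite -[h]hsubmxK; move: (lsubmx h) (rsubmx h) => h1 h2.
rewrite add_row_mx !regobj_row !dot_row_mx.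
have A1 := supconv_ge U1P x h1; have A2 := supconv_ge U2P y h2.
have A3 := pen_incr x y h1 h2.
have A4 := PsiC (x - y) (h1 - h2).
have A5 := ler_wpM2l CP0 (dot_subr_le h1 h2).
have := quad_le_dot M1 h1; rewrite ler_norml => /andP[_ A6].
have A7 : 0 <= n%:R ^+ 2 * `|M1| * dot h2 h2 by rewrite !mulr_ge0 ?dot_ge0 ?sqr_ge0.
have A8 : 0 <= n%:R ^+ 2 * `|M1| * dot h1 h1 by rewrite !mulr_ge0 ?dot_ge0 ?sqr_ge0.
have A9 := dot_ge0 h1; have A10 := dot_ge0 h2.
have E1 : dot (- (2 * c) *: (x - pr1 x) - (p + (x - x0) *m M1) - D (x - y)) h1 =
   - (2 * c * dot (x - pr1 x) h1) - dot (p + (x - x0) *m M1) h1 - dot (D (x - y)) h1.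
  by rewrite [in LHS]dotDl [in LHS]dotDl dotZl !dotNl mulNr.
have E2 : dot (- (2 * c) *: (y - pr2 y) + D (x - y)) h2 =
   - (2 * c * dot (y - pr2 y) h2) + dot (D (x - y)) h2.
  by rewrite [in LHS]dotDl dotZl mulNr.
rewrite E1 E2; move: A4; rewrite dotDr dotNr => A4.
move: A1 A2 A3 A4 A5 A6 A7 A8 A9 A10; clear.
move: (dot h1 h1) (dot h2 h2) (dot (D (x - y)) h1) (dot (D (x - y)) h2) => a1 a2 a3 a4.
move: (dot (p + _) h1) (dot (x - pr1 x) h1) (dot (y - pr2 y) h2) (dot (h1 *m M1) h1) => a5 a6 a7 a8.
move: (U1 _) (U1 _) (U2 _) (U2 _) (pen _ _) (pen _ _) (Psi _) (Psi _) (dot _ _) => b1 b2 b3 b4 b5 b6 b7 b8 b9.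
move: (n%:R ^+ 2 * `|M1|) => q; lra.
Qed.

Lemma regobj_continuous z : `|z - row_mx x0 x0| <= r -> {for z, continuous regobj}.
Proof.
move=> zr.
have lr : `|lsubmx z - x0| <= r.
  by rewrite -(row_mxKl x0 x0) -linearB (le_trans (norm_lsubmx _)).
have rr : `|rsubmx z - x0| <= r.
  by rewrite -(row_mxKr x0 x0) -linearB (le_trans (norm_rsubmx _)).
apply: continuousB; first apply: continuousD.
- exact/continuous_lsubmx/(supconv_continuous c0 U1P).
- exact/continuous_rsubmx/(supconv_continuous c0 U2P).
apply: continuousD.
  exact/continuous_lsubmx/qform_continuous.
apply: continuous_subl_subr; apply/continuous_normP => eps e0.
have K0 : 0 < CP + 1 by rewrite ltr_wpDl.
exists (Num.min 1 (eps / (CP + 1))); split; first by rewrite lt_min ltr01 divr_gt0.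
move=> y; rewrite lt_min => /andP[y1]; rewrite ltr_pdivlMr // => yK.
have := @PsiL (lsubmx z - rsubmx z) (y - (lsubmx z - rsubmx z)) _ (ltW y1).
rewrite subrKC => H; apply: le_trans (H _) _.
  by apply: le_trans (sub_ball lr rr) _; move: r1 r0; lra.
by move: yK; have : 0 <= `|y - (lsubmx z - rsubmx z)| by []; lra.
Qed.

(** Moving from [x] to [pr1 x] costs [c] times a squared distance, while the objective can gain at
    most [Bd + 1 + CL]. For large [c] the displacements are therefore below [tau], and near maxima
    of the regularized objective give near maxima of [obj]. *)
Lemma regobj_near_max (Bd CL tau e0 : R) x y :
  0 <= CL -> 0 < tau -> 0 <= e0 <= 1 ->
  (forall x y, `|x - x0| <= r -> `|y - x0| <= r -> obj x y <= obj x0 x0 + Bd) ->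
  (forall x y x' y',
    `|x - x0| <= r -> `|y - x0| <= r -> `|x' - x0| <= r -> `|y' - x0| <= r ->
    `|pen x y - pen x' y'| <= CL * (`|x - x'| + `|y - y'|)) ->
  Bd + 1 + CL <= c * tau ^+ 2 ->
  `|x - x0| <= r -> `|y - x0| <= r ->
  regobj (row_mx x0 x0) <= regobj (row_mx x y) + e0 ->
  [/\ `|x - pr1 x| <= tau, `|y - pr2 y| <= tau &
     obj x0 x0 <= obj (pr1 x) (pr2 y) + e0 + 2 * CL * tau].
Proof.
move=> CL0 tau0 e01 Bmax Lmax cbig xr yr.
rewrite !regobj_row.
have [p1 -> _] := U1P x; have [p2 -> _] := U2P y.
have [_ _ /(_ x0)] := U1P x0; have [_ _ /(_ x0)] := U2P x0.
rewrite !subrr normr0 !dot0l mulr0 !subr0 => /(_ (ltW r0)) q2 /(_ (ltW r0)) q1 H.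
have L := Lmax x y (pr1 x) (pr2 y) xr yr p1 p2.
have B := Bmax _ _ p1 p2.
have t1 := norm_le_dot (x - pr1 x); have t2 := norm_le_dot (y - pr2 y).
have d1 := sub_ball xr p1; have d2 := sub_ball yr p2.
have s1 := ler_wpM2l (ltW c0) t1; have s2 := ler_wpM2l (ltW c0) t2.
have CLt : CL * (`|x - pr1 x| + `|y - pr2 y|) <= CL.
  by rewrite ler_piMr //; move: d1 d2 r1; lra.
have n1 : 0 <= c * `|x - pr1 x| ^+ 2 by rewrite mulr_ge0 ?sqr_ge0 ?(ltW c0).
have n2 : 0 <= c * `|y - pr2 y| ^+ 2 by rewrite mulr_ge0 ?sqr_ge0 ?(ltW c0).
have key : obj x0 x0 + c * `|x - pr1 x| ^+ 2 + c * `|y - pr2 y| ^+ 2 <=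
   obj (pr1 x) (pr2 y) + e0 + CL * (`|x - pr1 x| + `|y - pr2 y|).
  move: L q1 q2 H s1 s2; rewrite /obj ler_norml.
  by move=> /andP[L1 L2] h1 h2 h3 h4 h5; lra.
have sqle (a : R) : 0 <= a -> c * a ^+ 2 <= c * tau ^+ 2 -> a <= tau.
  by move=> a0; rewrite ler_pM2l // ler_sqr ?nnegrE // ltW.
have le1 : `|x - pr1 x| <= tau.
  by apply: sqle => //; move: key B CLt n2 cbig e01; lra.
have le2 : `|y - pr2 y| <= tau.
  by apply: sqle => //; move: key B CLt n1 cbig e01; lra.
split=> //.
have := ler_wpM2l CL0 (lerD le1 le2).
by move: key n1 n2; lra.
Qed.

(** Increments [(h, 0)] and [(0, h)] separate the expansion of [regobj] into expansions of [U1] and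
    [U2]. The contact inequality at [(a, b)] bounds the sum of the two quadratic forms at scale [q],
    and homogeneity extends the bound to all [a] and [b]. *)
Lemma regobj_expansion x y p1 p2 (H : 'M[R]_(n + n)) (d q : R) :
  contact (r / 2) regobj (row_mx x y) (row_mx p1 p2) ->
  `|x - x0| <= r -> `|y - x0| <= r -> 0 < q <= r / 2 -> CP * q <= d ->
  (forall h, `|h| <= q -> `|regobj (row_mx x y + h) - regobj (row_mx x y)
     - dot (row_mx p1 p2) h - 2^-1 * dot (h *m H) h| <= d * q ^+ 2) ->
  let X := ulsubmx H + M1 + S (x - y) in
  let Y := drsubmx H + S (x - y) in
  let px := p1 + (p + (x - x0) *m M1) + D (x - y) in
  let py := p2 - D (x - y) in
  [/\ forall h, `|h| <= q ->
        `|U1 (x + h) - U1 x - dot px h - 2^-1 * dot (h *m X) h| <= 2 * d * q ^+ 2,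
      forall h, `|h| <= q ->
        `|U2 (y + h) - U2 y - dot py h - 2^-1 * dot (h *m Y) h| <= 2 * d * q ^+ 2 &
      forall a b, dot (a *m X) a + dot (b *m Y) b <=
        dot (a *m M1) a + dot ((a - b) *m S (x - y)) (a - b)
        + 24 * d * (dot a a + dot b b)].
Proof.
move=> ct xr yr /andP[q0 qr] CPq exp X Y px py.
have zeta1 : `|x - y| <= 1 by apply: le_trans (sub_ball xr yr) _; move: r1 r0; lra.
have q1 : 2 * q <= 1 by move: qr r1 r0; lra.
have cub (h : 'rV[R]_n) (s : R) : 0 <= s -> `|h| <= s * q -> CP * `|h| ^+ 3 <= s ^+ 3 * (d * q ^+ 2).
  move=> s0 hs; apply: (@le_trans _ _ (CP * (s * q) ^+ 3)).
    by rewrite ler_wpM2l // lerXn2r ?nnegrE // mulr_ge0 // ltW.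
  rewrite (_ : CP * (s * q) ^+ 3 = (CP * q) * (s ^+ 3 * q ^+ 2)); last by ring.
  by rewrite [leRHS]mulrCA ler_wpM2r // mulr_ge0 ?exprn_ge0 ?(ltW q0).
have Psi1 h : `|h| <= q ->
    `|Psi (x - y + h) - Psi (x - y) - dot (D (x - y)) h - 2^-1 * dot (h *m S (x - y)) h|
      <= d * q ^+ 2.
  move=> hq; apply: le_trans (PsiT zeta1 _) _; first by move: hq q1 q0; lra.
  by have := @cub h 1 ler01; rewrite expr1n !mul1r; exact.
have E1 h : `|h| <= q ->
    `|U1 (x + h) - U1 x - dot px h - 2^-1 * dot (h *m X) h| <= 2 * d * q ^+ 2.
  move=> hq; have := exp (row_mx h 0) (norm_row_mx hq _).
  rewrite normr0 => /(_ (ltW q0)).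
  rewrite add_row_mx addr0 !regobj_row dot_row_mx dot0r addr0 quad_row_mxl => F1.
  have := Psi1 h hq; have := pen_incr x y h 0; rewrite addr0 subr0 => F2 F3.
  move: F1 F2 F3; rewrite /px /X !mulmxDr !dotDl -!/(dot _ _).
  move: (dot _ _) (dot _ _) (dot _ _) (dot _ _) (dot _ _) (dot _ _) (dot _ _).
  move=> d1 d2 d3 d4 d5 d6 d7.
  move: (U1 _) (U1 _) (U2 _) (pen _ _) (pen _ _) (Psi _) (Psi _) => b1 b2 b3 b4 b5 b6 b7.
  by rewrite !ler_norml => /andP[f1 f2] f3 /andP[f4 f5]; apply/andP; split; lra.
have E2 h : `|h| <= q ->
    `|U2 (y + h) - U2 y - dot py h - 2^-1 * dot (h *m Y) h| <= 2 * d * q ^+ 2.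
  move=> hq; have := exp (row_mx 0 h) (norm_row_mx _ hq).
  rewrite normr0 => /(_ (ltW q0)).
  rewrite add_row_mx addr0 !regobj_row dot_row_mx dot0r add0r quad_row_mxr => F1.
  have := Psi1 (- h); rewrite normrN => /(_ hq).
  have := pen_incr x y 0 h; rewrite addr0 sub0r !(dot0r, mul0mx, dot0l, mulr0, add0r) => F2 F3.
  move: F1 F2 F3; rewrite /py /Y !mulmxDr !dotDl mulNmx !dotNl !dotNr opprK.
  move: (dot _ _) (dot _ _) (dot _ _) (dot _ _) => d1 d2 d3 d4.
  move: (U1 _) (U2 _) (U2 _) (pen _ _) (pen _ _) (Psi _) (Psi _) => b1 b2 b3 b4 b5 b6 b7.
  by rewrite !ler_norml => /andP[f1 f2] f3 /andP[f4 f5]; apply/andP; split; lra.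
split=> //.
(* The constant is [24 = 2 * (2 + 2 + 8)]: two expansion errors, and [2 ^ 3] from the cubic
   remainder of [Psi] at [|a - b| <= 2 * q], doubled by the factor [2^-1] of the quadratic forms. *)
have small a b : `|a| <= q -> `|b| <= q -> dot (a *m X) a + dot (b *m Y) b <=
    dot (a *m M1) a + dot ((a - b) *m S (x - y)) (a - b) + 24 * d * q ^+ 2.
  move=> aq bq.
  have abq : `|a - b| <= 2 * q by have := ler_normB a b; lra.
  have := ct (row_mx a b); rewrite add_row_mx !regobj_row dot_row_mx => /(_ _) F1.
  have {}F1 := F1 (norm_row_mx (le_trans aq qr) (le_trans bq qr)).
  have F2 := pen_incr x y a b.
  have := PsiT zeta1 (le_trans abq q1); rewrite ler_norml => /andP[_ F3].
  have := cub (a - b) 2 (ler0n _ 2) abq => F4.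
  have := E1 a aq; rewrite ler_norml => /andP[F5 _].
  have := E2 b bq; rewrite ler_norml => /andP[F6 _].
  move: F1 F2 F3 F4 F5 F6; rewrite /px /py !dotDl !dotNl dotDr dotNr.
  move: (dot (a *m X) a) (dot (b *m Y) b) (dot (a *m M1) a) (dot (_ *m S _) _) => d1 d2 d3 d4.
  move: (dot p1 a) (dot p2 b) (dot p a) (dot (_ *m M1) a) (dot (D _) a) (dot (D _) b) => d5 d6 d7 d8 d9 d10.
  move: (U1 _) (U1 _) (U2 _) (U2 _) (pen _ _) (pen _ _) (Psi _) (Psi _) => b1 b2 b3 b4 b5 b6 b7 b8.
  move: (CP * _) => c1; lra.
move=> a b; pose m := Num.max `|a| `|b|.
have am : `|a| <= m by rewrite le_max lexx.
have bm : `|b| <= m by rewrite le_max lexx orbT.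
have m2 : m ^+ 2 <= dot a a + dot b b.
  have [ab|/ltW ab] := leP `|a| `|b|.
    by rewrite /m (max_r ab); apply: le_trans (norm_le_dot _) _; rewrite lerDr dot_ge0.
  by rewrite /m (max_l ab); apply: le_trans (norm_le_dot _) _; rewrite lerDl dot_ge0.
have d0 : 0 <= d by apply: le_trans CPq; rewrite mulr_ge0 // ltW.
have [m0|m0] := eqVneq m 0.
  have a0 : a = 0 by apply/eqP; rewrite -normr_le0 -m0.
  have b0 : b = 0 by apply/eqP; rewrite -normr_le0 -m0.
  by rewrite a0 b0 !(subrr, mul0mx, dot0l, addr0, mulr0).
have mp : 0 < m by rewrite lt_neqAle eq_sym m0 (le_trans _ am).
pose t := q / m.
have t0 : 0 < t by rewrite divr_gt0.
have tm : t * m = q by rewrite /t divfK.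
have := small (t *: a) (t *: b).
have tle (h : 'rV[R]_n) : `|h| <= m -> `|t *: h| <= q.
  by move=> hm; rewrite normrZ gtr0_norm // -tm ler_pM2l.
move=> /(_ (tle a am) (tle b bm)); rewrite -tm.
rewrite -scalerBr !mulmx_scalel !dotZl !dotZr.
rewrite [leLHS](_ : _ = t ^+ 2 * (dot (a *m X) a + dot (b *m Y) b)); last by ring.
rewrite [leRHS](_ : _ = t ^+ 2 * (dot (a *m M1) a + dot ((a - b) *m S (x - y)) (a - b)
   + 24 * d * m ^+ 2)); last by ring.
rewrite ler_pM2l ?exprn_gt0 // => /le_trans; apply; rewrite lerD2l.
by rewrite ler_wpM2l // mulr_ge0.
Qed.

End Conv.
(** An approximate theorem on sums. Each function receives a genuine jet, at its own point near the
    doubled pair, and the matrix inequality holds up to [dl]. The strictness hypothesis keeps near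
    maxima away from the edge of the ball, so that the tilted maxima below are contact points. *)
Lemma sum_jets (m0 : R) : 0 < m0 ->
  (forall x y, `|x - x0| <= r -> `|y - x0| <= r ->
     obj x y <= obj x0 x0 - m0 \/ (`|x - x0| <= r / 4 /\ `|y - x0| <= r / 4)) ->
  forall dl, 0 < dl -> exists x y x' y' xx yy px py (X Y : 'M[R]_n),
  [/\ [/\ X^T = X, Y^T = Y, `|x' - x0| <= r / 4, `|y' - x0| <= r / 4 &
          obj x0 x0 <= obj x' y' + dl],
      [/\ `|x - x'| <= dl, `|y - y'| <= dl, `|xx - x| <= dl & `|yy - y| <= dl],
      `|px - (p + (x - x0) *m M1 + D (x - y))| <= dl /\ `|py + D (x - y)| <= dl,
      (\forall z \near xx, u1 z <= u1 xx + qform px X xx z) /\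
      (\forall z \near yy, u2 z <= u2 yy + qform py Y yy z) &
      forall a b, dot (a *m X) a + dot (b *m Y) b <=
        dot (a *m M1) a + dot ((a - b) *m S (x - y)) (a - b)
        + dl * (dot a a + dot b b)].
Proof.
move=> m00 strict dl dl0.
have [Bd [Bd0 BdP]] := obj_bound.
have [CL [CL0 CLP]] := pen_lip.
pose dm := Num.min dl (Num.min m0 1).
have dm0 : 0 < dm by rewrite !lt_min dl0 m00 ltr01.
have dml : dm <= dl by rewrite ge_min lexx.
have dmm : dm <= m0 by rewrite !ge_min lexx orbT.
have dm1 : dm <= 1 by rewrite !ge_min lexx !orbT.
pose tau := Num.min (dl / 2) (Num.min (r / 8) (dm / (8 * (CL + 1)))).
have CL1 : 0 < 8 * (CL + 1) by rewrite mulr_gt0 // ltr_wpDl.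
have tau0 : 0 < tau by rewrite !lt_min !divr_gt0.
have taul : tau <= dl / 2 by rewrite ge_min lexx.
have taur : tau <= r / 8 by rewrite !ge_min lexx orbT.
have taum : 2 * CL * tau <= dm / 4.
  have : tau <= dm / (8 * (CL + 1)) by rewrite !ge_min lexx !orbT.
  by rewrite ler_pdivlMr // mulrDr mulr1; move: tau0 CL0; nra.
pose e0 := dm / 4.
have e00 : 0 < e0 by rewrite divr_gt0.
have e01 : 0 <= e0 <= 1 by rewrite (ltW e00) /=; move: dm1; rewrite /e0; lra.
pose c := (Bd + 1 + CL) / tau ^+ 2 + 1.
have c0 : 0 < c.
  by rewrite ltr_wpDl // divr_ge0 ?sqr_ge0 // !addr_ge0.
have cbig : Bd + 1 + CL <= c * tau ^+ 2.
  by rewrite /c mulrDl divfK ?mul1r ?lerDl ?sqr_ge0 // sqrf_eq0 gt_eqF.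
have [U1 [pr1 U1P]] := supconv r0 c0 cu1.
have [U2 [pr2 U2P]] := supconv r0 c0 cu2.
pose W := regobj U1 U2.
pose z0 : 'rV[R]_(n + n) := row_mx x0 x0.
have near x y : `|x - x0| <= r -> `|y - x0| <= r -> W z0 <= W (row_mx x y) + e0 ->
   [/\ `|x - pr1 x| <= tau, `|y - pr2 y| <= tau, `|pr1 x - x0| <= r / 4, `|pr2 y - x0| <= r / 4 &
     obj x0 x0 <= obj (pr1 x) (pr2 y) + dm / 2].
  move=> xr yr Wz.
  have [h1 h2 h3] := regobj_near_max c0 U1P U2P CL0 tau0 e01 BdP CLP cbig xr yr Wz.
  have h4 : obj x0 x0 <= obj (pr1 x) (pr2 y) + dm / 2.
    by move: h3 taum; rewrite /e0; lra.
  have [p1r _ _] := U1P x; have [p2r _ _] := U2P y.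
  have [h5|[h5 h6]] := strict _ _ p1r p2r; last by split.
  by exfalso; move: h4 h5 dmm dm0; lra.
pose nn := (n + n)%:R * r + 1 : R.
have nn0 : 0 < nn by rewrite ltr_wpDl // mulr_ge0 // ltW.
(* Slopes of this size change the objective by at most [e0] on the ball, so the maxima of all tilted
   objectives are still near maxima. *)
pose d0 := e0 / nn.
have d00 : 0 < d0 by rewrite divr_gt0.
have dotd0 (q k : 'rV[R]_(n + n)) : `|q| <= d0 -> `|k| <= r -> dot q k <= e0.
  move=> qd kr; apply: le_trans (ler_norm _) _; apply: le_trans (dot_bound _ _) _.
  apply: (@le_trans _ _ ((n + n)%:R * d0 * r)).
    by rewrite ler_pM ?mulr_ge0 // ler_wpM2l.
  rewrite mulrAC /d0 mulrA ler_pdivrMr // mulrC ler_wpM2l ?(ltW e00) //.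
  by rewrite /nn lerDl.
have splitz (z : 'rV[R]_(n + n)) (s : R) : `|z - z0| <= s ->
    `|lsubmx z - x0| <= s /\ `|rsubmx z - x0| <= s.
  move=> zs; have := norm_lsubmx (z - z0); have := norm_rsubmx (z - z0).
  rewrite !linearB /= /z0 row_mxKl row_mxKr -/z0 => h1 h2.
  by split; [apply: le_trans h2 zs|apply: le_trans h1 zs].
have r2 : 0 < r / 2 by rewrite divr_gt0.
have r2r : r / 2 <= r by move: r0; lra.
pose Cs := c + n%:R ^+ 2 * `|M1| + 2 * CP + 1.
have Cs0 : 0 < Cs.
  apply: ltr_wpDl ltr01; apply: addr_ge0; last exact: mulr_ge0.
  by apply: addr_ge0; [exact: ltW|apply: mulr_ge0; rewrite ?sqr_ge0].
have contactW (q : 'rV[R]_(n + n)) : (forall i, 0 <= q 0 i <= d0) ->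
    exists z, `|z - z0| <= r / 2 /\ contact (r / 2) W z q.
  move=> qd.
  have qn : `|q| <= d0.
    apply/mxnorm_leP => [|i k]; first exact: ltW.
    by rewrite ord1; have /andP[h1 h2] := qd k; rewrite ger0_norm.
  have [z zr|z [zr zmax]] := @cball_max _ _ (fun z => W z - dot q z) z0 r (ltW r0).
    apply: continuousB; first exact: (regobj_continuous c0 U1P U2P).
    by apply: continuous_dot => k; [exact: cst_continuous|exact: coord_continuous].
  exists z; have [lr rr] := splitz z r zr.
  have Wz : W z0 <= W (row_mx (lsubmx z) (rsubmx z)) + e0.
    rewrite hsubmxK; have := zmax z0; rewrite subrr normr0 => /(_ (ltW r0)).
    have := dotd0 q (z0 - z) qn; rewrite distrC => /(_ zr); rewrite dotDr dotNr.
    by move: (W z0) (W z) => w1 w2; lra.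
  have [t1 t2 p1r p2r _] := near _ _ lr rr Wz.
  have zr2 : `|z - z0| <= r / 2.
    rewrite -(hsubmxK z) /z0 opp_row_mx add_row_mx; apply: norm_row_mx.
      rewrite -(subrKA (pr1 (lsubmx z))); apply: le_trans (ler_normD _ _) _.
      exact: quarter_tau t1 p1r taur r0.
    rewrite -(subrKA (pr2 (rsubmx z))); apply: le_trans (ler_normD _ _) _.
    exact: quarter_tau t2 p2r taur r0.
  split=> // h hr; have := zmax (z + h); rewrite addrAC dotDr => H.
  have /H : `|z - z0 + h| <= r by apply: le_trans (ler_normD _ _) (half_half zr2 hr).
  exact: untilt.
pose K1 := n%:R * (1 + `|M1| + CP) + 9.
have K10 : 0 < K1 by rewrite ltr_wpDl // mulr_ge0 // !addr_ge0.
pose d := Num.min (dl / 32) (dl / K1).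
have d_gt0 : 0 < d by rewrite lt_min !divr_gt0.
have d32 : 32 * d <= dl.
  have : d <= dl / 32 by rewrite ge_min lexx.
  by lra.
have dK1 : d * K1 <= dl by rewrite -ler_pdivlMr // ge_min lexx orbT.
have CP1 : 0 < CP + 1 by rewrite ltr_wpDl.
pose da := Num.min (d / (CP + 1)) (Num.min d0 (Num.min (r / 8) 1)).
have da0 : 0 < da by rewrite !lt_min (divr_gt0 d_gt0 CP1) d00 ltr01 divr_gt0.
have [z [ph [H [q [[/andP[q0 qda] zr pda ct] [sH qH ex]]]]]] :=
  second_order_contact Cs0 r2 d00 (regobj_semiconvex U1P U2P) contactW da0.
have dad : da <= d.
  apply: (@le_trans _ _ (d / (CP + 1))); first by rewrite ge_min lexx.
  by rewrite ler_pdivrMr // ler_peMr ?(ltW d_gt0) // lerDr.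
have da0' : da <= d0 by rewrite !ge_min lexx !orbT.
have dar : da <= r / 8 by rewrite !ge_min lexx !orbT.
have da1 : da <= 1 by rewrite !ge_min lexx !orbT.
have daCP : da * (CP + 1) <= d by rewrite -ler_pdivlMr // ge_min lexx.
have CPq : CP * q <= d.
  apply: le_trans daCP; rewrite mulrC; apply: (@le_trans _ _ (da * CP)).
    by rewrite ler_wpM2r.
  by rewrite ler_wpM2l ?(ltW da0) // lerDl.
set x := lsubmx z; set y := rsubmx z; set p1 := lsubmx ph; set p2 := rsubmx ph.
have [xr2 yr2] := splitz z _ zr.
have xr := le_trans xr2 r2r; have yr := le_trans yr2 r2r.
have Wz : W z0 <= W (row_mx x y) + e0.
  rewrite hsubmxK -{1}(subrKC z z0); apply: le_trans (ct (z0 - z) _) _; rewrite 1?distrC //.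
  by rewrite lerD2l dotd0 ?(le_trans pda) // distrC (le_trans zr).
have [t1 t2 p1r p2r om] := near _ _ xr yr Wz.
have qr8 : q <= r / 8 := le_trans qda dar.
have qr2 : 0 < q <= r / 2 by rewrite q0 (eighth_le_half qr8 r0).
have ct' : contact (r / 2) W (row_mx x y) (row_mx p1 p2) by rewrite !hsubmxK.
have ex' : forall h, `|h| <= q -> `|W (row_mx x y + h) - W (row_mx x y)
     - dot (row_mx p1 p2) h - 2^-1 * dot (h *m H) h| <= d * q ^+ 2.
  move=> h hq; rewrite !hsubmxK; apply: le_trans (ex h hq) _.
  by rewrite ler_wpM2r ?sqr_ge0.
have [E1 E2 E3] := regobj_expansion ct' xr yr qr2 CPq ex'.
move: E1 E2 E3.
set X := ulsubmx H + M1 + S (x - y); set Y := drsubmx H + S (x - y).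
set px := p1 + _ + _; set py := p2 - _ => E1 E2 E3.
have zeta1 : `|x - y| <= 1 := double_le1 (sub_ball xr yr) r1 r0.
have sX : X^T = X.
  by rewrite /X !linearD /= sM1 sS trmx_ulsub sH.
have sY : Y^T = Y by rewrite /Y linearD /= sS trmx_drsub sH.
have d2 : 0 < 2 * d by rewrite mulr_gt0.
have inball (w h : 'rV[R]_n) : `|w - x0| <= r / 4 -> `|h| <= q -> `|w + h - x0| <= r.
  move=> wr hq; rewrite addrAC; apply: le_trans (ler_normD _ _) _.
  exact: quarter_eighth wr hq qr8 r0.
have nX : q * `|X| <= d * (1 + `|M1| + CP).
  have : `|X| <= `|H| + `|M1| + CP.
    apply: le_trans (ler_normD _ _) _; rewrite lerD ?PsiS //.
    by apply: le_trans (ler_normD _ _) _; rewrite lerD // norm_ulsubmx.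
  rewrite -(ler_pM2l q0) => /le_trans; apply.
  rewrite !mulrDr mulr1 !lerD ?ler_wpM2r ?(le_trans qda) //; exact: le_trans qH dad.
have nY : q * `|Y| <= d * (1 + `|M1| + CP).
  have : `|Y| <= `|H| + CP.
    by apply: le_trans (ler_normD _ _) _; rewrite lerD ?PsiS // norm_drsubmx.
  rewrite -(ler_pM2l q0) => /le_trans; apply.
  rewrite !mulrDr mulr1 lerD ?ler_wpM2r ?(le_trans qda) //.
  rewrite (le_trans (le_trans qH dad)) // lerDl mulr_ge0 //; exact: ltW.
have slope (A : 'M[R]_n) (h pp : 'rV[R]_n) : q * `|A| <= d * (1 + `|M1| + CP) ->
    `|h| <= q -> `|pp| <= d -> `|pp + h *m (A + (4 * (2 * d))%:M)| <= dl.
  move=> qA hq pd; apply: le_trans dK1.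
  rewrite mulmxDr mul_mx_scalar.
  have a1 := ler_normD pp (h *m A + 4 * (2 * d) *: h).
  have a2 := ler_normD (h *m A) (4 * (2 * d) *: h).
  have a3 : `|h *m A| <= n%:R * (d * (1 + `|M1| + CP)).
    apply: le_trans (mulmx_bound _ _) _; rewrite -mulrA ler_wpM2l //.
    by apply: le_trans qA; rewrite ler_wpM2r.
  have a4 : `|4 * (2 * d) *: h| <= 8 * d.
    rewrite normrZ gtr0_norm ?mulr_gt0 // mulrA -natrM ler_piMr ?mulr_ge0 ?(ltW d_gt0) //.
    by apply: le_trans hq (le_trans qda da1).
  by apply: (slope_arith a1 a2 a3 a4 pd); apply: eq_ler; rewrite /K1; ring.
have pn1 : `|p1| <= d by apply: le_trans (norm_lsubmx _) (le_trans pda dad).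
have pn2 : `|p2| <= d by apply: le_trans (norm_rsubmx _) (le_trans pda dad).
have [|h hq|h1 [h1q J1]] := @interior_max _ _ u1 (pr1 x) q (2 * d) px X q0 d2 sX.
- by move=> w wq; apply: cu1; rewrite -(subrKC (pr1 x) w); apply: inball.
- have := E1 h hq; rewrite ler_norml => /andP[_ e1].
  exact: le_of_expansion e1 (supconv_translate U1P (inball _ _ p1r hq)).
have [|h hq|h2 [h2q J2]] := @interior_max _ _ u2 (pr2 y) q (2 * d) py Y q0 d2 sY.
- by move=> w wq; apply: cu2; rewrite -(subrKC (pr2 y) w); apply: inball.
- have := E2 h hq; rewrite ler_norml => /andP[_ e1].
  exact: le_of_expansion e1 (supconv_translate U2P (inball _ _ p2r hq)).
have qdl : q <= dl / 2 := le_half_of32 d32 d_gt0 (le_trans qda dad).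
exists x, y, (pr1 x), (pr2 y), (pr1 x + h1), (pr2 y + h2).
eexists; eexists; eexists; eexists; split; [split| | |split; [exact: J1|exact: J2]|].
- by rewrite linearD /= sX tr_scalar_mx.
- by rewrite linearD /= sY tr_scalar_mx.
- exact: p1r.
- exact: p2r.
- by apply: le_trans om _; rewrite lerD2l; exact: half_le dml dm0.
- split; [exact: le_of_half t1 taul dl0|exact: le_of_half t2 taul dl0| |].
    rewrite addrAC; apply: le_trans (ler_normD _ _) _; rewrite distrC.
    exact: half_half (le_trans t1 taul) (le_trans (ltW h1q) qdl).
  rewrite addrAC; apply: le_trans (ler_normD _ _) _; rewrite distrC.
  exact: half_half (le_trans t2 taul) (le_trans (ltW h2q) qdl).
- split.
    rewrite (_ : px + _ - _ = p1 + h1 *m (X + (4 * (2 * d))%:M)); last first.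
      by rewrite /px -[p1 + _ + _]addrA addrAC addrK.
    exact: slope nX (ltW h1q) pn1.
  rewrite (_ : py + _ + _ = p2 + h2 *m (Y + (4 * (2 * d))%:M)); last first.
    by rewrite /py addrAC subrK.
  exact: slope nY (ltW h2q) pn2.
move=> a b; rewrite !(mulmxDr _ _ (_%:M)) !mul_mx_scalar (dotDl (a *m X)) (dotDl (b *m Y)) !dotZl.
apply: (add_scalar_part (E3 a b)).
by rewrite ler_wpM2r // addr_ge0 ?dot_ge0.
Qed.

End SumJets.

(** * The penalization and the matrix gap *)

Lemma sqrt_taylor (R : realFieldType) (a b s s' : R) : 0 < s -> s' ^+ 2 = s ^+ 2 + 2 * a + b ->
  s' - s - a / s - 2^-1 * (b / s - a ^+ 2 / s ^+ 3) =
    ((s' - s) ^+ 2 - b) * ((s' - s) * (s' + 3 * s) - b) / (8 * s ^+ 3).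
Proof.
move=> s0 ss; have -> : a = (s' ^+ 2 - s ^+ 2 - b) / 2 by rewrite ss; field.
by field; rewrite gt_eqF.
Qed.

Section Penalty.
Variables (R : realType) (n : nat) (L e : R).
Hypothesis L0 : 0 < L.
Hypothesis e0 : 0 < e.
Implicit Types (z h : 'rV[R]_n).

(* The concave term [- dot z z] makes the radial second derivative at most [- L] as soon as
   [e ^ 2 <= sabs z ^ 3], which forces the trace of the matrix gap to grow with [L]. *)
Definition sabs z := Num.sqrt (e ^+ 2 + dot z z).
Definition penalty z := L * (sabs z - dot z z).
Definition penalty_grad z : 'rV[R]_n := L *: ((sabs z)^-1 *: z - 2 *: z).
Definition penalty_hess z : 'M[R]_n :=
  L *: (((sabs z)^-1)%:M - (sabs z) ^- 3 *: (z^T *m z) - 2%:M).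

Lemma sabs_sqr z : sabs z ^+ 2 = e ^+ 2 + dot z z.
Proof. by rewrite sqr_sqrtr // addr_ge0 ?sqr_ge0 ?dot_ge0. Qed.

Lemma sabs_ge z : e <= sabs z.
Proof.
rewrite -(ler_sqr (ltW e0)) ?nnegrE ?sqrtr_ge0 // sabs_sqr lerDl dot_ge0 //.
Qed.

Lemma sabs_gt0 z : 0 < sabs z.
Proof. exact: lt_le_trans (sabs_ge z). Qed.

Lemma sabs_le z : `|z| <= 1 -> sabs z <= e + n%:R.
Proof.
move=> z1; have en : 0 <= e + n%:R by rewrite addr_ge0 // ltW.
rewrite -ler_sqr ?nnegrE ?sqrtr_ge0 // sabs_sqr.
have : dot z z <= n%:R.
  by apply: le_trans (dot_le_norm z) _; rewrite ler_piMr // exprn_ile1.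
have : n%:R <= n%:R ^+ 2 :> R by rewrite -natrX ler_nat -mulnn; case: (n) => // m; rewrite leq_pmulr.
have : 0 <= e * n%:R by rewrite mulr_ge0 // ltW.
by rewrite sqrrD; lra.
Qed.

Lemma sabsD z h : sabs (z + h) ^+ 2 = sabs z ^+ 2 + 2 * dot z h + dot h h.
Proof. by rewrite !sabs_sqr !dot_lin (dotC h z); ring. Qed.

Lemma penalty_hess_sym z : (penalty_hess z)^T = penalty_hess z.
Proof.
by apply/matrixP => i j; rewrite !mxE !big_ord1 !mxE (eq_sym j i) (mulrC (z 0 j)).
Qed.

Lemma penalty_hess_quad z h : dot (h *m penalty_hess z) h =
  L * (dot h h / sabs z - dot z h ^+ 2 / sabs z ^+ 3 - 2 * dot h h).
Proof.
rewrite /penalty_hess mulmx_scaler dotZl !mulmxDr !mulmxN !mul_mx_scalar.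
rewrite mulmx_scaler !dotDl !dotNl !dotZl quad_rank1 (dotC h z).
by rewrite [_ / sabs z]mulrC [_ / _ ^+ 3]mulrC.
Qed.

Lemma penalty_grad_dot z h : dot (penalty_grad z) h = L * (dot z h / sabs z - 2 * dot z h).
Proof.
by rewrite /penalty_grad dotZl dotDl dotNl !dotZl [_ / sabs z]mulrC.
Qed.

(** By [2 s s' <= s^2 + s'^2] the square root lies below its tangent, and the subtracted square only
    helps. The bound holds for all [z] and [h], as needed for global semiconvexity. *)
Lemma penalty_upper z h :
  penalty (z + h) <= penalty z + dot (penalty_grad z) h + L / (2 * e) * dot h h.
Proof.
rewrite penalty_grad_dot /penalty.
have s0 := sabs_gt0 z.
have H : sabs (z + h) <= sabs z + dot z h / sabs z + dot h h / (2 * e).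
  have : dot h h / (2 * sabs z) <= dot h h / (2 * e).
    rewrite ler_wpM2l ?dot_ge0 // lef_pV2 ?posrE ?mulr_gt0 // ler_pM2l //; exact: sabs_ge.
  have : sabs (z + h) <= sabs z + dot z h / sabs z + dot h h / (2 * sabs z).
    rewrite -(ler_pM2l (mulr_gt0 (ltr0n _ 2) s0)).
    have -> : 2 * sabs z * (sabs z + dot z h / sabs z + dot h h / (2 * sabs z)) =
       sabs z ^+ 2 + sabs (z + h) ^+ 2 by rewrite sabsD; field; rewrite gt_eqF.
    by have := sqr_ge0 (sabs z - sabs (z + h)); lra.
  by lra.
have := ler_wpM2l (ltW L0) H.
have : 0 <= L * dot h h by rewrite mulr_ge0 ?dot_ge0 // ltW.
rewrite !dot_lin (dotC h z) => h1 h2.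
have -> : L / (2 * e) * dot h h = L * (dot h h / (2 * e)) by ring.
lra.
Qed.

Lemma sabs_incr z h : `|z| <= 1 -> `|h| <= 1 ->
  `|sabs (z + h) - sabs z| <= 3 * n%:R / e * `|h|.
Proof.
move=> z1 h1; have s0 := sabs_gt0 z; have s1 := sabs_gt0 (z + h).
have : `|2 * dot z h + dot h h| <= 3 * n%:R * `|h|.
  have := dot_bound z h; have := dot_bound h h.
  have : n%:R * `|z| * `|h| <= n%:R * `|h| by rewrite ler_wpM2r // ler_piMr.
  have : n%:R * `|h| * `|h| <= n%:R * `|h| by rewrite ler_piMr // mulr_ge0.
  rewrite !ler_norml => a1 a2 /andP[a3 a4] /andP[a5 a6].
  by apply/andP; split; lra.
have -> : 2 * dot z h + dot h h = (sabs (z + h) - sabs z) * (sabs (z + h) + sabs z).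
  by rewrite -subr_sqr sabsD; ring.
rewrite normrM (gtr0_norm (addr_gt0 s1 s0)) => H.
rewrite mulrAC ler_pdivlMr //; apply: le_trans H; rewrite ler_wpM2l //.
by have := sabs_ge z; lra.
Qed.

(** The constant blows up as [e] tends to 0. This is harmless: [sum_jets] is applied at a fixed [e],
    and its conclusion does not mention [CP]. *)
Lemma penalty_bounds : exists CP, [/\ 0 <= CP,
  forall z h, `|z| <= 1 -> `|h| <= 1 -> `|penalty (z + h) - penalty z
     - dot (penalty_grad z) h - 2^-1 * dot (h *m penalty_hess z) h| <= CP * `|h| ^+ 3,
  forall z h, penalty (z + h) <= penalty z + dot (penalty_grad z) h + CP * dot h h,
  forall z h, `|z| <= 1 -> `|h| <= 1 -> `|penalty (z + h) - penalty z| <= CP * `|h| &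
  forall z, `|z| <= 1 -> `|penalty_hess z| <= CP].
Proof.
pose k := 3 * n%:R / e : R.
have k0 : 0 <= k by rewrite divr_ge0 ?mulr_ge0 // ltW.
pose C1 := L * ((k ^+ 2 + n%:R) * (k * (4 * (e + n%:R) + k) + n%:R) / (8 * e ^+ 3)).
pose C2 := L / (2 * e).
pose C3 := L * (k + 3 * n%:R).
pose C4 := L * (e^-1 + e ^- 3 + 2).
have en : 0 <= e + n%:R by rewrite addr_ge0 // ltW.
have C10 : 0 <= C1.
  apply: mulr_ge0 (ltW L0) _; apply: divr_ge0; last by rewrite mulr_ge0 ?exprn_ge0 // ltW.
  by do ![exact: k0 | exact: en | exact: sqr_ge0 | done | apply: addr_ge0 | apply: mulr_ge0].
have C20 : 0 <= C2 by rewrite divr_ge0 ?mulr_ge0 ?(ltW L0) ?(ltW e0).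
have C30 : 0 <= C3 by rewrite mulr_ge0 ?(ltW L0) // addr_ge0 // mulr_ge0.
have C40 : 0 <= C4 by rewrite mulr_ge0 ?(ltW L0) // !addr_ge0 // invr_ge0 ?exprn_ge0 // ltW.
exists (C1 + C2 + C3 + C4); split.
- by rewrite !addr_ge0.
- move=> z h z1 h1; apply: (@le_trans _ _ (C1 * `|h| ^+ 3)); last first.
    by rewrite ler_wpM2r ?exprn_ge0 //; lra.
  have s0 := sabs_gt0 z; have se := sabs_ge z; have sn := sabs_le z1.
  have inc := sabs_incr z1 h1; rewrite -/k in inc.
  rewrite penalty_grad_dot penalty_hess_quad /penalty.
  set s := sabs z in s0 se sn inc *; set s' := sabs (z + h) in inc *.
  set a := dot z h; set b := dot h h.
  have -> : L * (s' - dot (z + h) (z + h)) - L * (s - dot z z) - L * (a / s - 2 * a)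
     - 2^-1 * (L * (b / s - a ^+ 2 / s ^+ 3 - 2 * b)) =
     L * (s' - s - a / s - 2^-1 * (b / s - a ^+ 2 / s ^+ 3)).
    by rewrite !dot_lin (dotC h z) -/a -/b; field; rewrite gt_eqF.
  (* In the exact remainder the first factor is quadratic in [h] and the second linear, which gives
     the cubic bound. *)
  rewrite (@sqrt_taylor _ a b s s' s0); last by rewrite /s' sabsD.
  rewrite normrM (gtr0_norm L0) /C1 -[leRHS]mulrA ler_pM2l // normrM normfV.
  have s30 : 0 < 8 * s ^+ 3 by rewrite mulr_gt0 // exprn_gt0.
  have e30 : 0 < 8 * e ^+ 3 by rewrite mulr_gt0 // exprn_gt0.
  rewrite (gtr0_norm s30) mulrAC.
  have b1 : b <= n%:R * `|h| ^+ 2 by exact: dot_le_norm.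
  have b0 : 0 <= b by exact: dot_ge0.
  have b2 : n%:R * `|h| ^+ 2 <= n%:R * `|h| by rewrite ler_wpM2l // expr2 ler_piMr.
  set y := `|h| in inc b1 b2 h1 *.
  have y0 : 0 <= y by exact: normr_ge0.
  have n0 : 0 <= n%:R :> R by [].
  set N := n%:R in n0 b1 b2 sn *.
  set dd := s' - s in inc *.
  have f1 : `|dd ^+ 2 - b| <= (k ^+ 2 + N) * y ^+ 2.
    apply: le_trans (ler_normB _ _) _; rewrite normrX (ger0_norm b0) mulrDl lerD //.
    have ky0 : 0 <= k * y by exact: mulr_ge0.
    by rewrite -(exprMn 2 k y) lerXn2r // nnegrE.
  have f2 : `|dd * (s' + 3 * s) - b| <= (k * (4 * (e + N) + k) + N) * y.
    apply: le_trans (ler_normB _ _) _; rewrite (ger0_norm b0) [leRHS]mulrDl lerD ?(le_trans b1) //.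
    rewrite normrM mulrAC ler_pM //.
    rewrite (_ : s' + 3 * s = dd + 4 * s); last by rewrite /dd; ring.
    apply: le_trans (ler_normD _ _) _; rewrite addrC lerD //.
      by rewrite ger0_norm ?mulr_ge0 ?(ltW s0) // ler_pM2l.
    by apply: le_trans inc _; rewrite ler_piMr.
  rewrite normrM (_ : y ^+ 3 = y ^+ 2 * y); last by ring.
  rewrite [leRHS](_ : _ = ((k ^+ 2 + N) * y ^+ 2) * ((k * (4 * (e + N) + k) + N) * y) / (8 * e ^+ 3)); last by ring.
  apply: ler_pM; rewrite ?mulr_ge0 ?invr_ge0 ?(ltW s30) //; first by apply: ler_pM.
  by rewrite lef_pV2 ?posrE // ler_pM2l // lerXn2r ?nnegrE ?(ltW e0) ?(ltW s0).
- move=> z h; apply: le_trans (penalty_upper z h) _; rewrite lerD2l ler_wpM2r ?dot_ge0 //.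
  by rewrite -/C2; lra.
- move=> z h z1 h1; apply: (@le_trans _ _ (C3 * `|h|)); last by rewrite ler_wpM2r //; lra.
  rewrite /penalty -mulrBr normrM (gtr0_norm L0) /C3 -[leRHS]mulrA ler_pM2l // mulrDl.
  rewrite (_ : _ - _ = (sabs (z + h) - sabs z) - (2 * dot z h + dot h h)); last first.
    by rewrite !dot_lin (dotC h z); ring.
  apply: le_trans (ler_normB _ _) _; rewrite lerD ?sabs_incr //.
  have := dot_bound z h; have := dot_bound h h.
  have : n%:R * `|z| * `|h| <= n%:R * `|h| by rewrite ler_wpM2r // ler_piMr.
  have : n%:R * `|h| * `|h| <= n%:R * `|h| by rewrite ler_piMr // mulr_ge0.
  rewrite !ler_norml => a1 a2 /andP[a3 a4] /andP[a5 a6].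
  by apply/andP; split; lra.
move=> z z1; apply: (@le_trans _ _ C4); last by lra.
have s0 := sabs_gt0 z; have se := sabs_ge z.
apply/mxnorm_leP => // i j; rewrite /penalty_hess /C4.
rewrite mxE normrM (gtr0_norm L0) ler_pM2l // [X in `|X|]mxE.
apply: le_trans (ler_normD _ _) _; apply: lerD; last first.
  by rewrite !mxE normrN normrMn; case: (_ == _); rewrite ?mulr0n // mulr1n ger0_norm.
rewrite mxE; apply: le_trans (ler_normD _ _) _; apply: lerD.
  rewrite mxE normrMn; apply: (@le_trans _ _ `|(sabs z)^-1|).
    by case: (_ == _); rewrite ?mulr0n // mulr1n.
  by rewrite ger0_norm ?invr_ge0 ?(ltW s0) // lef_pV2 ?posrE.
rewrite mxE normrN mxE normrM mxE big_ord1 mxE normrM.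
rewrite -[leRHS]mulr1; apply: ler_pM => //.
  rewrite ger0_norm ?invr_ge0 ?exprn_ge0 ?(ltW s0) // lef_pV2 ?posrE ?exprn_gt0 //.
  by rewrite lerXn2r ?nnegrE ?(ltW e0) ?(ltW s0).
by rewrite -[leRHS]mulr1 ler_pM // (le_trans (coord_le_mxnorm _ _ _)).
Qed.

End Penalty.

(** Uniform continuity in the form needed for doubling: up to the small constant [sg], the variation
    of [v] is linear in the distance and can be absorbed by the penalization once [L] exceeds
    [C]. *)
Lemma cball_modulus (R : realType) (n : nat) (v : 'rV[R]_n -> R) x0 (r sg : R) :
  0 <= r -> 0 < sg -> (forall y, `|y - x0| <= r -> {for y, continuous v}) ->
  exists C, 0 <= C /\ forall x y, `|x - x0| <= r -> `|y - x0| <= r ->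
    `|v x - v y| <= sg + C * `|x - y|.
Proof.
move=> r0 s0 cv.
pose P (d : R) (x : 'rV[R]_n) := forall y, `|y - x0| <= r -> `|x - y| < d ->
  `|x - x0| <= r -> `|v x - v y| <= sg.
have /compact_near_coveringP cB := @compact_cball R n x0 r.
have cover : \forall d \near (0 : R)^'+, [set x | `|x - x0| <= r] `<=` P d.
  apply: cB => x xr.
  have [e [e0 eP]] := (continuous_normP v x).1 (cv x xr) (sg / 2) (divr_gt0 s0 (ltr0n _ 2)).
  have e2 : 0 < e / 2 by rewrite divr_gt0.
  exists ([set x' | `|x' - x| < e / 2], [set d : R | d < e / 2]) => /=.
    split; first by apply/near_normP; exists (e / 2).
    exact: nbhs_right_lt.
  move=> [x' d] /= [x'x de] y yr x'y _.
  have h1 : `|v x' - v x| <= sg / 2 by apply: eP; apply: lt_trans x'x _; lra.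
  have h2 : `|v y - v x| <= sg / 2.
    apply: eP; rewrite -(subrKA x'); apply: le_lt_trans (ler_normD _ _) _.
    by move: x'x x'y de; rewrite (distrC y x'); lra.
  rewrite -(subrKA (v x)); apply: le_trans (ler_normD _ _) _.
  by rewrite (distrC (v x)); lra.
have [d [d0 dP]] : exists d : R, 0 < d /\ [set x | `|x - x0| <= r] `<=` P d.
  near (0 : R)^'+ => d; exists d; split; last by near: d.
  by near: d; exact: nbhs_right_gt.
have cvN y : `|y - x0| <= r -> {for y, continuous (fun y => - v y)}.
  by move=> yr; apply: continuousN; exact: cv.
have [a [_ aP]] := cball_max r0 cv.
have [b [_ bP]] := cball_max r0 cvN.
have V0 : 0 <= v a - v b.
  have := aP x0; have := bP x0; rewrite subrr normr0 => /(_ r0) + /(_ r0); lra.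
exists ((v a - v b) / d); split=> [|x y xr yr]; first by rewrite divr_ge0 // ltW.
have [xyd|dxy] := ltP `|x - y| d.
  by apply: le_trans (dP x xr y yr xyd xr) _; rewrite lerDl mulr_ge0 // divr_ge0 // ltW.
apply: (@le_trans _ _ (v a - v b)).
  by have := aP x xr; have := aP y yr; have := bP x xr; have := bP y yr; rewrite ler_norml; lra.
apply: ler_wpDl; first exact: ltW.
by rewrite mulrAC ler_pdivlMr // ler_wpM2l.
Unshelve. all: by end_near.
Qed.

Lemma powR_sqrt_small (R : realType) (nu C sg : R) : 1 / 2 < nu -> 0 < C -> 0 < sg ->
  exists s1 : R, 0 < s1 /\ forall s : R, 0 < s <= s1 -> C * (s `^ nu / Num.sqrt s) <= sg.
Proof.
move=> nu2 C0 sg0.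
have k0 : 0 < nu - 2^-1 by lra.
exists ((sg / C) `^ (nu - 2^-1)^-1); split; first by rewrite powR_gt0 // divr_gt0.
move=> s /andP[s0 ss1].
rewrite -powR12_sqrt ?(ltW s0) // -powRB; last by apply/implyP => _; rewrite gt_eqF.
rewrite mulrC -ler_pdivlMr //.
apply: le_trans (ge0_ler_powR (ltW k0) _ _ ss1) _; rewrite ?nnegrE ?(ltW s0) ?powR_ge0 //.
by rewrite -powRrM mulVf ?gt_eqF // powRr1 // divr_ge0 ?(ltW sg0) ?(ltW C0).
Qed.

Lemma modulus_small (R : realType) (omega : R -> R) (eta : R) :
  {within [set s | 0 <= s], continuous omega} -> omega 0 = 0 -> 0 < eta ->
  exists sg : R, 0 < sg /\ forall s, 0 <= s <= sg -> omega s <= eta.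
Proof.
move=> /subspace_continuousP/(_ 0 (lexx _)) /cvgrPdist_le H w0 e0.
have := H _ e0; rewrite near_withinE => /nbhs_ballP[e /= e1 eP].
exists (e / 2); split=> [|s /andP[s0 se]]; first by rewrite divr_gt0.
have bs : ball (0 : R) e s.
  by rewrite /ball /= sub0r normrN ger0_norm // (le_lt_trans se) //; lra.
have : `|omega 0 - omega s| <= eta := eP s bs s0.
by rewrite w0 sub0r normrN => H1; apply: le_trans H1; exact: ler_norm.
Qed.

Section GapArith.
Variable R : realFieldType.
Implicit Types (t y x m s k T dl Lam : R).

Lemma gap_arith_pos t y x m s k T dl Lam :
  x - (1 - t) * ((1 - t) * y) <= m + t * (t * s) + dl * (k + (1 - t) * ((1 - t) * k)) ->
  m + 2 * dl * k - (x - y) <= (T - 1) * k ->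
  t ^+ 2 * s <= t ^+ 2 * (Lam * k) -> dl * k <= 1 / 8 * k -> 0 <= dl * k ->
  dl * ((1 - t) * ((1 - t) * k)) <= dl * k -> t * (t * y) <= t * y -> 0 <= k ->
  t * y <= (T + t ^+ 2 * Lam) * k.
Proof. lra. Qed.

Lemma gap_arith_neg t y x m s k T dl Lam :
  x - (1 + t) * ((1 + t) * y) <= m + - t * (- t * s) + dl * (k + (1 + t) * ((1 + t) * k)) ->
  m + 2 * dl * k - (x - y) <= (T - 1) * k ->
  t ^+ 2 * s <= t ^+ 2 * (Lam * k) -> dl * k <= 1 / 8 * k -> 0 <= dl * k ->
  dl * ((1 + t) * ((1 + t) * k)) <= 4 * (dl * k) -> t * (t * y) <= 0 -> t * y <= 0 ->
  0 <= k -> t * - y <= (T + t ^+ 2 * Lam) * k.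
Proof. lra. Qed.

End GapArith.

Section Ellipticity2.
Variables (R : realType) (n : nat).
Implicit Types (X Y M S : 'M[R]_n).

Lemma norm_le_quad Y (c : R) : 0 <= c -> Y^T = Y ->
  (forall a, `|dot (a *m Y) a| <= c * dot a a) -> `|Y| <= 2 * c.
Proof.
move=> c0 sY H; apply/mxnorm_leP => [|i j]; first by rewrite mulr_ge0.
have dd (k : 'I_n) : dot (delta_mx 0 k) (delta_mx 0 k) = 1 :> R.
  by rewrite dot_delta mxE !eqxx.
have [->|ij] := eqVneq i j.
  by have := H (delta_mx 0 j); rewrite quad_delta dd; lra.
have := dot_delta (delta_mx 0 i : 'rV[R]_n) j; rewrite mxE eqxx eq_sym (negbTE ij) /= => dij.
have := H (delta_mx 0 i); have := H (delta_mx 0 j); have := H (delta_mx 0 i + delta_mx 0 j).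
rewrite !quad_lin !quad_delta !dd (dotC (delta_mx 0 j) (delta_mx 0 i)) dij.
have -> : Y j i = Y i j by rewrite -{1}sY mxE.
move: (Y i i) (Y j j) (Y i j) => a b d.
by rewrite !ler_norml => /andP[h1 h2] /andP[h3 h4] /andP[h5 h6]; lra.
Qed.

Variables (X Y M S : 'M[R]_n) (dl Lam : R).
Hypothesis sX : X^T = X.
Hypothesis sY : Y^T = Y.
Hypothesis sM : M^T = M.
Hypothesis dl01 : 0 <= dl <= 1 / 8.
Hypothesis Lam0 : 0 < Lam.
Hypothesis XYle : forall a b, dot (a *m X) a - dot (b *m Y) b <=
  dot (a *m M) a + dot ((a - b) *m S) (a - b) + dl * (dot a a + dot b b).
Hypothesis Sle : forall a, dot (a *m S) a <= Lam * dot a a.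

(** The shift [2 * dl] pays for the error term of [XYle] at [a = b], so that the gap is positive
    semidefinite. *)
Definition gap := M + (2 * dl)%:M - (X - Y).

Lemma gap_quad a : dot (a *m gap) a =
  dot (a *m M) a + 2 * dl * dot a a - (dot (a *m X) a - dot (a *m Y) a).
Proof. by rewrite /gap !mulmxDr mulmxN mulmxDr mulmxN mul_mx_scalar !dot_lin; ring. Qed.

Lemma gap_psd : psd gap.
Proof.
split=> [|a].
  by apply/matrixP => i j; rewrite !mxE eq_sym -{1}sX -{1}sY -{1}sM !mxE.
have := XYle a a; rewrite subrr mul0mx dot0l addr0 gap_quad; lra.
Qed.

Lemma gap_trace_ge0 : 0 <= \tr gap.
Proof.
have := trace_psd_ge (A := 1%:M) (c := 0) gap_psd; rewrite mul0r mul1mx; apply=> v.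
by rewrite mul0r mulmx1 dot_ge0.
Qed.

(** The pair [z], [- z] tests [S] at [2 *: z] and so counts the radial value [- L] four times. *)
Lemma gap_trace_large z (L : R) : z != 0 -> dot (z *m S) z <= - L * dot z z ->
  4 * L <= \tr gap.
Proof.
move=> z0 zS; have zz := dot_gt0 z0.
rewrite -(ler_pM2r zz); apply: le_trans (quad_le_trace z gap_psd).
have := XYle z (- z); rewrite gap_quad opprK !quad_lin !opprK; lra.
Qed.

(** Testing [XYle] with [a] and [(1 - t) *: a] or [(1 + t) *: a] gives [t * |Y| <= T + t^2 * Lam] on
    quadratic forms, with [T = tr gap + 1]. The best [t] is the square root of [T / Lam], capped at
    1; the outer factor 2 is polarization. *)
Lemma gap_norm_le : `|Y| <= 4 * (Num.sqrt ((\tr gap + 1) * Lam) + (\tr gap + 1)).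
Proof.
set T := \tr gap + 1.
have T1 : 1 <= T by rewrite lerDr gap_trace_ge0.
have T0 : 0 < T by apply: lt_le_trans T1.
set q := Num.sqrt (T * Lam).
have q0 : 0 < q by rewrite sqrtr_gt0 mulr_gt0.
have qq : q * q = T * Lam by rewrite -expr2 sqr_sqrtr // mulr_ge0 // ltW.
rewrite (_ : 4 * (q + T) = 2 * (2 * (q + T))); last by ring.
apply: norm_le_quad => // [|a]; first by rewrite mulr_ge0 // addr_ge0 // ltW.
have key (t : R) : 0 < t <= 1 ->
   t * `|dot (a *m Y) a| <= (T + t ^+ 2 * Lam) * dot a a.
  move=> /andP[t0 t1].
  have N1 := quad_le_trace a gap_psd; rewrite gap_quad in N1.
  have H1 := XYle a ((1 - t) *: a); have H2 := XYle a ((1 + t) *: a).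
  rewrite (_ : a - (1 - t) *: a = t *: a) in H1; last by rewrite scalerBl scale1r subKr.
  rewrite (_ : a - (1 + t) *: a = - t *: a) in H2; last first.
    by rewrite scalerDl scale1r opprD addrA subrr sub0r scaleNr.
  rewrite !mulmx_scalel !dotZl !dotZr in H1 H2.
  have Sa := Sle a; have aa := dot_ge0 a.
  have t2 : 0 <= t ^+ 2 by rewrite sqr_ge0.
  have tS := ler_wpM2l t2 Sa.
  have trE : \tr gap = T - 1 by rewrite /T addrK.
  rewrite trE in N1.
  have d1 : dl * dot a a <= 1 / 8 * dot a a by rewrite ler_wpM2r //; case/andP: dl01.
  have d0 : 0 <= dl * dot a a by rewrite mulr_ge0 //; case/andP: dl01.
  have d2 : dl * ((1 + t) * ((1 + t) * dot a a)) <= 4 * (dl * dot a a).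
    rewrite [leLHS](_ : _ = (1 + t) ^+ 2 * (dl * dot a a)); last by ring.
    by rewrite ler_wpM2r //; nra.
  have d3 : dl * ((1 - t) * ((1 - t) * dot a a)) <= dl * dot a a.
    rewrite [leLHS](_ : _ = (1 - t) ^+ 2 * (dl * dot a a)); last by ring.
    by rewrite ler_piMl //; nra.
  have [Y0|Y0] := leP 0 (dot (a *m Y) a).
    rewrite ger0_norm //.
    have tY : t * (t * dot (a *m Y) a) <= t * dot (a *m Y) a by rewrite ler_piMl ?mulr_ge0 // ltW.
    exact: gap_arith_pos H1 N1 tS d1 d0 d3 tY aa.
  rewrite ltr0_norm //.
  have tY : t * (t * dot (a *m Y) a) <= 0.
    by rewrite pmulr_rle0 // pmulr_rle0 // ltW.
  have tY2 : t * dot (a *m Y) a <= 0 by rewrite pmulr_rle0 // ltW.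
  exact: gap_arith_neg H2 N1 tS d1 d0 d2 tY tY2 aa.
have aa := dot_ge0 a.
have [TL|LT] := leP T Lam.
  have Tq : T <= q.
    rewrite -(ler_sqr (ltW T0)) ?nnegrE ?(ltW q0) // !expr2 qq.
    by rewrite ler_wpM2l // ltW.
  have t01 : 0 < T / q <= 1 by rewrite divr_gt0 //= ler_pdivrMr // mul1r.
  have := key _ t01.
  rewrite (_ : T + (T / q) ^+ 2 * Lam = (T / q) * (2 * q)); last first.
    rewrite exprMn exprVn [q ^+ 2]expr2 qq; field.
    by rewrite !gt_eqF.
  rewrite -[leRHS]mulrA ler_pM2l ?divr_gt0 // => /le_trans; apply.
  by rewrite ler_wpM2r // mulrDr lerDl mulr_ge0 // ltW.
have := key 1; rewrite ltr01 lexx mul1r expr1n mul1r => /(_ isT)/le_trans; apply.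
rewrite ler_wpM2r //; have := ltW LT; have := ltW q0; lra.
Qed.

End Ellipticity2.

Section TwoPoint.
Variables (R : realType) (n : nat) (Omega : set 'rV[R]_n) (F : NLop R n).
Variables (d1 d0 gam Gam : R).
Hypothesis HF2 : cond_F2 F Omega d1 d0 gam Gam.
Hypothesis HF3 : cond_F3 F Omega.

(* Homogeneity upgrades the x-continuity of [F] to all scales of [(Y, p, w)]. *)
Lemma F1_scaled (K nu T : R) (omega : R -> R) Y py w x y :
  (forall M p z x y, M^T = M -> Omega x -> Omega y -> `|p| <= K -> `|z| <= K ->
     `|F M p z x - F M p z y| <= omega (`|x - y| `^ nu * (`|M| + 1))) ->
  0 < T -> Y^T = Y -> Omega x -> Omega y -> `|py| <= K * T -> `|w| <= K * T ->
  `|F Y py w x - F Y py w y| <= T * omega (`|x - y| `^ nu * (`|Y| / T + 1)).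
Proof.
move=> HF1 T0 sY Ox Oy pK wK.
have Ti : 0 <= T^-1 by rewrite invr_ge0 ltW.
have sc z : Omega z -> F Y py w z = T * F (T^-1 *: Y) (T^-1 *: py) (T^-1 * w) z.
  move=> Oz; rewrite -HF3 ?(ltW T0) //; last by rewrite /Defs.symmetric linearZ /= sY.
  by rewrite !scalerA mulrA mulfV ?gt_eqF // !scale1r mul1r.
rewrite !sc // -mulrBr normrM (gtr0_norm T0) ler_pM2l //.
apply: le_trans (HF1 _ _ _ _ _ _ Ox Oy _ _) _.
- by rewrite linearZ /= sY.
- by rewrite normrZ ger0_norm // mulrC ler_pdivrMr.
- by rewrite normrM ger0_norm // mulrC ler_pdivrMr.
by rewrite normrZ ger0_norm // [T^-1 * _]mulrC.
Qed.

(** (F2) compares values at one point, so the second argument is first moved from [y] to [x]; this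
    move is the subtracted norm. The gain [gam * \tr gap] comes from writing [X - Y] as
    [M + (2 * dl)%:M] minus the gap. *)
Lemma F_gap (X Y M S : 'M[R]_n) (dl : R) px py z w x y :
  X^T = X -> Y^T = Y -> M^T = M -> 0 <= dl ->
  (forall a b, dot (a *m X) a - dot (b *m Y) b <=
     dot (a *m M) a + dot ((a - b) *m S) (a - b) + dl * (dot a a + dot b b)) ->
  Omega x ->
  pucci_minus gam Gam M - 2 * dl * (Gam * n%:R) + gam * \tr (gap X Y M dl)
    - d1 * `|px - py| - d0 * `|z - w| - `|F Y py w x - F Y py w y|
    <= F X px z x - F Y py w y.
Proof.
move=> sX sY sM dl0 XY Ox; have [d10 d00 gam0 gG F2] := HF2.
have [h1 _] := F2 X Y px py z w x sX sY Ox.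
have sM2 : (M + (2 * dl)%:M)^T = M + (2 * dl)%:M by rewrite linearD /= sM tr_scalar_mx.
have pg := gap_psd sX sY sM XY.
have h2 := pucci_minus_sub_psd gam0 gG sM2 pg.
rewrite /gap subKr -/(gap X Y M dl) in h2.
have h3 := @pucci_minus_add_scal _ _ _ _ gam0 gG M (2 * dl) sM (mulr_ge0 (ler0n _ 2) dl0).
have h5 : - `|F Y py w x - F Y py w y| <= F Y py w x - F Y py w y.
  by rewrite lerNl -normrN ler_norm.
move: h1 h2 h3 h5; lra.
Qed.

End TwoPoint.

(** With points at distance of order [s] and [|Y| / T] of order the inverse square root of [s], the
    argument of the modulus is of order [s ^ (nu - 1/2)]. *)
Lemma modulus_argument (R : realType) (nu s x c y T : R) :
  0 < s <= 1 -> 0 < nu <= 1 -> 0 <= x <= 3 * s -> 0 <= c -> 0 < T ->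
  y <= 4 * (T * c / Num.sqrt s + T) ->
  x `^ nu * (y / T + 1) <= 3 * (4 * c + 5) * (s `^ nu / Num.sqrt s).
Proof.
move=> /andP[s0 s1] /andP[nu0 nu1] /andP[x0 x3] c0 T0 yT.
have q0 : 0 < Num.sqrt s by rewrite sqrtr_gt0.
have q1 : Num.sqrt s <= 1 by rewrite -sqrtr1 ler_sqrt.
have xs : x `^ nu <= 3 * s `^ nu.
  apply: (@le_trans _ _ ((3 * s) `^ nu)).
    by rewrite ge0_ler_powR ?nnegrE ?(ltW nu0) // mulr_ge0 // ltW.
  rewrite powRM ?(ltW s0) // ler_wpM2r ?powR_ge0 // -[leRHS]powRr1 //.
  by apply: ler_powR => //; rewrite ler1n.
have yc : y / T + 1 <= (4 * c + 5) / Num.sqrt s.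
  have : y / T <= 4 * c / Num.sqrt s + 4.
    rewrite ler_pdivrMr //; apply: le_trans yT _; apply: eq_ler; ring.
  have : 5 <= 5 / Num.sqrt s by rewrite ler_pdivlMr // ler_piMr.
  by rewrite mulrDl; lra.
have b0 : 0 <= (4 * c + 5) / Num.sqrt s by rewrite divr_ge0 ?sqrtr_ge0 // addr_ge0 // mulr_ge0.
apply: (@le_trans _ _ (x `^ nu * ((4 * c + 5) / Num.sqrt s))).
  by rewrite ler_wpM2l ?powR_ge0.
apply: (@le_trans _ _ (3 * s `^ nu * ((4 * c + 5) / Num.sqrt s))); first by rewrite ler_wpM2r.
by apply: eq_ler; ring.
Qed.

Lemma sqrt_gap_le (R : realType) (T L c s : R) : 0 < s -> 0 <= T -> 0 <= L -> 0 <= c ->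
  T * L <= (T * c) ^+ 2 -> Num.sqrt (T * (L / s)) <= T * c / Num.sqrt s.
Proof.
move=> s0 T0 L0 c0 H; have Tc0 : 0 <= T * c by exact: mulr_ge0.
rewrite mulrA sqrtrM ?mulr_ge0 // sqrtrV ?(ltW s0) // ler_wpM2r ?invr_ge0 ?sqrtr_ge0 //.
by rewrite -[leRHS](ger0_norm Tc0) -sqrtr_sqr ler_sqrt ?sqr_ge0.
Qed.

(** [Cs] depends on [v], [r] and [sg] but not on [L], [L'] or [e], which may therefore be chosen
    after it. The normalization of [sg] makes [eta * (r / 8)^2 = 4 * sg], which covers the error
    [sg] from the modulus, the value [L * e <= sg] of the penalty at 0, and the margin [2 * sg]
    asked by [sum_jets]. *)
Lemma doubling_jets (R : realType) (n : nat) (u v : 'rV[R]_n -> R) x0 p (M1 : 'M[R]_n)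
    (eta r sg : R) :
  0 < eta -> 0 < r -> r * (4 * n%:R + 4) <= 1 -> 256 * sg = eta * r ^+ 2 -> M1^T = M1 ->
  (forall y, `|y - x0| <= r -> {for y, continuous u}) ->
  (forall y, `|y - x0| <= r -> {for y, continuous v}) ->
  (forall y, `|y - x0| <= r ->
     u y - v y <= u x0 - v x0 + qform p M1 x0 y - eta * dot (y - x0) (y - x0)) ->
  exists Cs, 0 <= Cs /\ forall L' L e dl, eta * r / 8 <= L' -> 2 * (Cs + L') <= L ->
    0 < L -> 0 < e -> L * e <= sg -> 0 < dl <= sg ->
  exists x y xx yy px py (X Y : 'M[R]_n),
  [/\ [/\ X^T = X, Y^T = Y, `|x - x0| <= r / 4 + dl, `|y - x0| <= r / 4 + dl &
          L' * `|x - y| <= 3 * sg + 2 * L' * dl],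
      `|xx - x| <= dl /\ `|yy - y| <= dl,
      `|px - (p + (x - x0) *m M1 + penalty_grad L e (x - y))| <= dl /\
      `|py - penalty_grad L e (x - y)| <= dl,
      (\forall z \near xx, u z <= u xx + qform px X xx z) /\
      (\forall z \near yy, v yy + qform py Y yy z <= v z) &
      forall a b, dot (a *m X) a - dot (b *m Y) b <=
        dot (a *m M1) a + dot ((a - b) *m penalty_hess L e (x - y)) (a - b)
        + dl * (dot a a + dot b b)].
Proof.
move=> eta0 r0 rn sgE sM1 cu cv uv.
have r2 : 0 < r ^+ 2 by rewrite exprn_gt0.
have sg0 : 0 < sg by have : 0 < eta * r ^+ 2 by [rewrite mulr_gt0]; lra.
have n0 : 0 <= n%:R :> R by [].
have r41 : 4 * r <= 1 by have : 0 <= r * n%:R by [rewrite mulr_ge0 // ltW]; lra.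
have [Cs [Cs0 CsP]] := cball_modulus (ltW r0) sg0 cv.
exists Cs; split=> // L' L e dl L'r LL' L0 e0 Le /andP[dl0 dls].
have L'0 : 0 < L' by apply: lt_le_trans L'r; rewrite divr_gt0 // mulr_gt0.
have [CP [CP0 PsiT PsiC PsiL PsiS]] := @penalty_bounds R n L e L0 e0.
pose u2 y := - v y.
have cu2 y : `|y - x0| <= r -> {for y, continuous u2}.
  by move=> yr; apply: continuousN; exact: cv.
pose ob := obj u u2 x0 p M1 (penalty L e).
have ob0 : ob x0 x0 = u x0 - v x0 - L * e.
  rewrite /ob /obj /pen /u2 qform_center subrr /penalty /sabs dot0l addr0 subr0 add0r.
  by rewrite sqrtr_sqr gtr0_norm.
have obP x y : `|x - x0| <= r -> `|y - x0| <= r ->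
    ob x y <= u x0 - v x0 - eta * dot (x - x0) (x - x0) + sg - L' * `|x - y|.
  move=> xr yr; have z2 : `|x - y| <= 2 * r by exact: sub_ball xr yr.
  (* On the small ball the subtracted square takes away at most half of [sabs], so the penalty still
     dominates [L / 2] times the distance. *)
  have pz : `|x - y| / 2 <= sabs e (x - y) - dot (x - y) (x - y).
    set z := x - y in z2 *.
    have zs : `|z| ^+ 2 <= dot z z by exact: norm_le_dot.
    have zn : dot z z <= n%:R * `|z| ^+ 2 by exact: dot_le_norm.
    pose t := Num.sqrt (dot z z).
    have tt : t ^+ 2 = dot z z by rewrite sqr_sqrtr ?dot_ge0.
    have t0 : 0 <= t by exact: sqrtr_ge0.
    have t1 : `|z| <= t by rewrite -ler_sqr ?nnegrE // tt.
    have t2 : t <= sabs e z by rewrite ler_sqrt ?addr_ge0 ?sqr_ge0 ?dot_ge0 // lerDr sqr_ge0.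
    have t3 : t <= 1 / 2.
      rewrite -ler_sqr ?nnegrE // tt; apply: le_trans zn _.
      have : `|z| ^+ 2 <= (2 * r) ^+ 2 by rewrite lerXn2r ?nnegrE ?normr_ge0 ?mulr_ge0 ?(ltW r0).
      move=> /(ler_wpM2l n0) /le_trans; apply.
      have rn1 : 4 * (r * n%:R) <= 1 by move: rn r0; lra.
      have -> : n%:R * (2 * r) ^+ 2 = (4 * (r * n%:R)) * r by ring.
      apply: (@le_trans _ _ (1 * r)); first by rewrite ler_wpM2r // ltW.
      by move: r41; lra.
    rewrite -tt; nra.
  have := uv x xr; have := CsP x y xr yr; rewrite ler_norml => /andP[_ h1] h2.
  have h3 := ler_wpM2l (ltW L0) pz.
  have h4 : (Cs + L') * `|x - y| <= L / 2 * `|x - y| by rewrite ler_wpM2r //; move: LL'; lra.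
  rewrite /ob /obj /pen /u2 /penalty.
  move: h1 h2 h3 h4; lra.
have m00 : 0 < 2 * sg by rewrite mulr_gt0.
have ob00 : u x0 - v x0 - sg <= ob x0 x0 by rewrite ob0; move: Le; lra.
have strict x y : `|x - x0| <= r -> `|y - x0| <= r ->
    ob x y <= ob x0 x0 - 2 * sg \/ (`|x - x0| <= r / 4 /\ `|y - x0| <= r / 4).
  move=> xr yr; have H := obP x y xr yr.
  have Lz : 0 <= L' * `|x - y| by rewrite mulr_ge0 // ltW.
  have ed : 0 <= eta * dot (x - x0) (x - x0) by rewrite mulr_ge0 ?dot_ge0 // ltW.
  have [x8|x8] := leP `|x - x0| (r / 8); last first.
    left; have : eta * (r / 8) ^+ 2 <= eta * dot (x - x0) (x - x0).
      rewrite ler_pM2l //; apply: le_trans (norm_le_dot _).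
      by rewrite lerXn2r ?nnegrE ?normr_ge0 ?divr_ge0 ?(ltW r0) ?(ltW x8).
    rewrite (_ : eta * (r / 8) ^+ 2 = eta * r ^+ 2 / 64); last by field.
    by rewrite -sgE; move: H ob00 Lz; lra.
  have [y4|y4] := leP `|y - x0| (r / 4); first by right; split=> //; move: x8 r0; lra.
  left; have xy8 : r / 8 <= `|x - y|.
    have : `|y - x0| <= `|x - y| + `|x - x0|.
      by rewrite (distrC x y) -{1}(subrKA x) ler_normD.
    by move: x8 y4; lra.
  have : eta * r / 8 * (r / 8) <= L' * `|x - y|.
    by apply: ler_pM; rewrite ?divr_ge0 ?mulr_ge0 // ltW.
  rewrite (_ : eta * r / 8 * (r / 8) = eta * r ^+ 2 / 64); last by field.
  by rewrite -sgE; move: H ob00 ed; lra.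
have [x [y [x' [y' [xx [yy [px [py [X [Y]]]]]]]]]] :=
  sum_jets r0 r41 sM1 (@penalty_hess_sym R n L e) CP0 cu cu2 PsiT PsiC PsiL PsiS m00 strict dl0.
move=> [[sX sY x'r y'r om] [xx' yy' xxx yyy] [pxP pyP] [J1 J2] XY].
exists x, y, xx, yy, px, (- py), X, (- Y).
have r4r : r / 4 <= r by move: r0; lra.
split.
- split=> //; first by rewrite linearN /= sY.
  + rewrite -(subrKA x'); apply: le_trans (ler_normD _ _) _.
    by rewrite addrC lerD.
  + rewrite -(subrKA y'); apply: le_trans (ler_normD _ _) _.
    by rewrite addrC lerD.
  have := obP x' y' (le_trans x'r r4r) (le_trans y'r r4r).
  have : 0 <= eta * dot (x' - x0) (x' - x0) by rewrite mulr_ge0 ?dot_ge0 // ltW.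
  have : `|x - y| <= `|x' - y'| + 2 * dl.
    rewrite (_ : x - y = (x' - y') + ((x - x') - (y - y'))); last by apply/rowP => k; rewrite !mxE; ring.
    apply: le_trans (ler_normD _ _) _; rewrite lerD2l; apply: le_trans (ler_normB _ _) _.
    by move: xx' yy'; lra.
  move=> /(ler_wpM2l (ltW L'0)) h1 h2 h3.
  have om' : ob x0 x0 <= ob x' y' + dl := om.
  by move: h1 h2 h3 om' ob00 dls; lra.
- by [].
- split=> //; by rewrite -opprD normrN.
- split=> //; apply: filterS J2 => z; rewrite qformN /u2.
  by move: (qform _ _ _ _) => q; lra.
move=> a b; have := XY a b; rewrite mulmxN dotNl opprK; exact.
Qed.

(** * The inequality satisfied by a difference *)

Section JetArith.
Variable R : realFieldType.
Implicit Types (a b c d e q r s t x y : R).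

Lemma jet_arith (P P1 Gn eta dl gam tau d1 d0 pp w0 A B loss FX FY g1 g2 g1' g2' : R) :
  0 <= d1 -> 0 <= d0 -> 0 <= Gn ->
  P1 - 2 * dl * Gn + gam * tau - d1 * A - d0 * B - loss <= FX - FY ->
  FX <= g1' -> g2' <= FY -> P - 2 * eta * Gn <= P1 ->
  A <= pp + 3 * eta -> B <= w0 + 2 * eta -> g1' <= g1 + eta -> g2 - eta <= g2' ->
  loss <= gam * tau + eta -> dl <= eta -> 0 < eta ->
  P - d1 * pp - d0 * w0 - (g1 - g2) <= eta * (4 * Gn + 3 * d1 + 2 * d0 + 3).
Proof.
move=> d10 d00 G0 h1 h2 h3 h4 /(ler_wpM2l d10) h5 /(ler_wpM2l d00) h6 h7 h8 h9.
move=> /(ler_wpM2r G0) h10 h11; lra.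
Qed.

Lemma abs_near a b x y e : `|a - x| <= e -> `|b - y| <= e -> `|a - b| <= `|x - y| + 2 * e.
Proof.
move=> h1 h2; rewrite (_ : a - b = (x - y) + ((a - x) - (b - y))); last by ring.
apply: le_trans (ler_normD _ _) _; rewrite lerD2l.
by apply: le_trans (ler_normB _ _) _; lra.
Qed.

End JetArith.

Section PenaltyBounds.
Variables (R : realType) (n : nat) (L e : R).
Hypothesis L0 : 0 < L.
Hypothesis e0 : 0 < e.
Implicit Types z : 'rV[R]_n.

Lemma norm_le_sabs z : `|z| <= sabs e z.
Proof.
rewrite -ler_sqr ?nnegrE ?sqrtr_ge0 // sabs_sqr.
by apply: le_trans (norm_le_dot z) _; rewrite lerDr sqr_ge0.
Qed.

Lemma sabs_le_norm z : sabs e z <= e + (n%:R + 1) * `|z|.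
Proof.
have n0 : 0 <= n%:R :> R by [].
have h0 : 0 <= e + (n%:R + 1) * `|z|.
  by apply: addr_ge0; [exact: ltW|apply: mulr_ge0 => //; exact: addr_ge0].
rewrite -ler_sqr ?nnegrE ?sqrtr_ge0 // sabs_sqr.
have h1 := dot_le_norm z.
have h2 : 0 <= e * `|z| by rewrite mulr_ge0 // ltW.
have h3 : 0 <= n%:R * `|z| ^+ 2 by rewrite mulr_ge0 ?sqr_ge0.
have h4 : 0 <= n%:R * (e * `|z|) by rewrite mulr_ge0.
have h5 : 0 <= (n%:R * `|z|) ^+ 2 by rewrite sqr_ge0.
have h6 : 0 <= `|z| ^+ 2 by rewrite sqr_ge0.
move: h1 h2 h3 h4 h5 h6; lra.
Qed.

Lemma penalty_grad_norm z : `|z| <= 1 -> `|penalty_grad L e z| <= 3 * L.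
Proof.
move=> z1; have s0 := @sabs_gt0 R n e e0 z.
rewrite /penalty_grad normrZ (gtr0_norm L0) mulrC ler_pM2r //.
apply: le_trans (ler_normB _ _) _; rewrite !normrZ gtr0_norm ?invr_gt0 //.
have : (sabs e z)^-1 * `|z| <= 1 by rewrite mulrC ler_pdivrMr // mul1r norm_le_sabs.
by rewrite ger0_norm //; lra.
Qed.

Lemma penalty_hess_le z a : dot (a *m penalty_hess L e z) a <= L / sabs e z * dot a a.
Proof.
have s0 := @sabs_gt0 R n e e0 z.
rewrite penalty_hess_quad -mulrA ler_pM2l // [leRHS]mulrC.
have : 0 <= dot z a ^+ 2 / sabs e z ^+ 3 by rewrite divr_ge0 ?sqr_ge0 ?exprn_ge0 ?(ltW s0).
by have := dot_ge0 a; lra.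
Qed.

Lemma penalty_hess_radial z : e ^+ 2 <= sabs e z ^+ 3 ->
  dot (z *m penalty_hess L e z) z <= - L * dot z z.
Proof.
move=> es; have s0 := @sabs_gt0 R n e e0 z.
rewrite penalty_hess_quad [leRHS]mulNr -[leRHS]mulrN ler_pM2l //.
have kE : dot z z = sabs e z ^+ 2 - e ^+ 2 by rewrite sabs_sqr addrC addKr.
have k0 := dot_ge0 z; set k := dot z z in kE k0 *; set s := sabs e z in es s0 kE *.
have -> : k / s - k ^+ 2 / s ^+ 3 - 2 * k = k * (e ^+ 2 / s ^+ 3) - 2 * k.
  have -> : e ^+ 2 = s ^+ 2 - k by rewrite kE subKr.
  by field; rewrite gt_eqF.
have : k * (e ^+ 2 / s ^+ 3) <= k.
  by rewrite ler_piMr // ler_pdivrMr ?exprn_gt0 // mul1r.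
lra.
Qed.

End PenaltyBounds.

Lemma jet_radius (R : realType) (n : nat) (Omega : set 'rV[R]_n) (u v g1 g2 : 'rV[R]_n -> R)
    x0 (P : 'rV[R]_n -> Prop) (B eta : R) :
  open Omega -> (forall x, Omega x -> {for x, continuous u}) ->
  (forall x, Omega x -> {for x, continuous v}) ->
  (forall x, Omega x -> {for x, continuous g1}) ->
  (forall x, Omega x -> {for x, continuous g2}) ->
  Omega x0 -> (\forall y \near x0, P y) -> 0 < eta -> 0 <= B ->
  exists r : R, [/\ 0 < r, r * (4 * n%:R + 4) <= 1, r * B <= eta &
    forall y, `|y - x0| <= r -> [/\ Omega y, P y, `|u y - u x0| <= eta, `|v y - v x0| <= eta &
      `|g1 y - g1 x0| <= eta /\ `|g2 y - g2 x0| <= eta]].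
Proof.
move=> oO cu cv cg1 cg2 Ox nP e0 B0.
have nO : \forall y \near x0, Omega y by apply: open_nbhs_nbhs.
have nc (f : 'rV[R]_n -> R) : {for x0, continuous f} -> \forall y \near x0, `|f y - f x0| <= eta.
  move=> cf; have [e [e1 eP]] := (continuous_normP f x0).1 cf _ e0.
  by apply/near_normP; exists e.
have /near_normP[e [e1 eP]] : \forall y \near x0, [/\ Omega y, P y, `|u y - u x0| <= eta,
    `|v y - v x0| <= eta & `|g1 y - g1 x0| <= eta /\ `|g2 y - g2 x0| <= eta].
  near=> y; split; last split; near: y.
  - exact: nO.
  - exact: nP.
  - exact/nc/cu.
  - exact/nc/cv.
  - exact/nc/cg1.
  - exact/nc/cg2.
have n4 : 0 < 4 * n%:R + 4 :> R by rewrite ltr_wpDl // mulr_ge0.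
have B1 : 0 < B + 1 by rewrite ltr_wpDl.
exists (Num.min (e / 2) (Num.min (4 * n%:R + 4)^-1 (eta / (B + 1)))); split.
- by rewrite !lt_min !divr_gt0 // invr_gt0 n4.
- by rewrite -ler_pdivlMr // mul1r !ge_min lexx orbT.
- apply: (@le_trans _ _ (eta / (B + 1) * B)).
    by rewrite ler_wpM2r // !ge_min lexx !orbT.
  rewrite mulrAC ler_pdivrMr // ler_wpM2l ?(ltW e0) //; lra.
move=> y yr; apply: eP; apply: le_lt_trans yr _.
by rewrite gt_min; apply/orP; left; lra.
Unshelve. all: by end_near.
Qed.

(** The viscosity notion restricted to quadratic test functions, which is all that is used from here
    on. Scaling and reflection then act on a slope and a matrix instead of on functions of class
    C2. *)
Definition jet_sub (R : realType) (n : nat) (F : NLop R n) (O : set 'rV[R]_n) (u g : 'rV[R]_n -> R) :=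
  forall x0 p (M : 'M[R]_n), O x0 -> M^T = M ->
  (\forall y \near x0, u y <= u x0 + qform p M x0 y) -> F M p (u x0) x0 <= g x0.

Definition jet_super (R : realType) (n : nat) (F : NLop R n) (O : set 'rV[R]_n) (v g : 'rV[R]_n -> R) :=
  forall x0 p (M : 'M[R]_n), O x0 -> M^T = M ->
  (\forall y \near x0, v x0 + qform p M x0 y <= v y) -> g x0 <= F M p (v x0) x0.

Lemma difference_jet (R : realType) (n : nat) (Omega : set 'rV[R]_n) (F : NLop R n)
    (d1 d0 gam Gam : R) (u v g1 g2 : 'rV[R]_n -> R) x0 p (M : 'M[R]_n) :
  open Omega -> cond_F1 F Omega -> cond_F2 F Omega d1 d0 gam Gam -> cond_F3 F Omega ->
  (forall x, Omega x -> {for x, continuous u}) ->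
  (forall x, Omega x -> {for x, continuous v}) ->
  (forall x, Omega x -> {for x, continuous g1}) ->
  (forall x, Omega x -> {for x, continuous g2}) ->
  jet_sub F Omega u g1 -> jet_super F Omega v g2 -> Omega x0 -> M^T = M ->
  (\forall y \near x0, u y - v y <= u x0 - v x0 + qform p M x0 y) ->
  pucci_minus gam Gam M - d1 * `|p| - d0 * `|u x0 - v x0| <= g1 x0 - g2 x0.
Proof.
move=> oO HF1 HF2 HF3 cu cv cg1 cg2 Vu Vv Ox sM nq.
have [d10 d00 gam0 gG _] := HF2.
have Gam0 : 0 < Gam by apply: lt_le_trans gG.
rewrite leNgt; apply/negP; rewrite -subr_gt0 => Dpos.
set Del := (X in 0 < X) in Dpos.
have Gn0 : 0 <= Gam * n%:R by rewrite mulr_ge0 // ltW.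
pose Cst := 4 * (Gam * n%:R) + 3 * d1 + 2 * d0 + 4.
have C0 : 0 < Cst by rewrite /Cst; lra.
pose eta := Num.min 1 (Del / Cst).
have eta0 : 0 < eta by rewrite lt_min ltr01 divr_gt0.
have eta1 : eta <= 1 by rewrite ge_min lexx.
have etaC : eta * Cst <= Del by rewrite -ler_pdivlMr // ge_min lexx orbT.
clearbody eta.
(* The additional [2 * eta] turns the touching into a strict one, with margin
   [eta * dot (y - x0) (y - x0)]. *)
pose M1 := M + (2 * eta)%:M.
have sM1 : M1^T = M1 by rewrite linearD /= sM tr_scalar_mx.
have B0 : 0 <= n%:R * `|M1| by rewrite mulr_ge0.
have [r [r0 rn rB rP]] := jet_radius oO cu cv cg1 cg2 Ox nq eta0 B0.
pose sg := eta * r ^+ 2 / 256.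
have sgE : 256 * sg = eta * r ^+ 2 by rewrite /sg; field.
have sg0 : 0 < sg.
  have : 0 < eta * r ^+ 2 by apply: mulr_gt0 => //; exact: exprn_gt0.
  by rewrite -sgE; clear; lra.
clearbody sg.
have cur y : `|y - x0| <= r -> {for y, continuous u} by move=> /rP[Oy _ _ _ _]; exact: cu.
have cvr y : `|y - x0| <= r -> {for y, continuous v} by move=> /rP[Oy _ _ _ _]; exact: cv.
have uvr y : `|y - x0| <= r ->
    u y - v y <= u x0 - v x0 + qform p M1 x0 y - eta * dot (y - x0) (y - x0).
  move=> /rP[_ H _ _ _]; apply: le_trans H _.
  by rewrite /qform /M1 mulmxDr mul_mx_scalar dotDl dotZl; apply: eq_ler; field.
have [Cs [Cs0 CsP]] := doubling_jets eta0 r0 rn sgE sM1 cur cvr uvr.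
have [V VE] : exists V, V = `|v x0| + 1 by eexists.
have V1 : 1 <= V by rewrite VE lerDr.
(* A bound free of [L]: in the case of a large trace gap [T >= 4 * L + 1], so after division by [T]
   the slope bound [3 * L + 1] fits under [4 + V]. *)
have KV0 : 0 < 4 + V by move: V1; clear; lra.
have [om0 [nu0 [[om0c _ _ om00] nu0P HF10]]] := HF1 _ KV0.
have gam2 : 0 < gam / 2 by rewrite divr_gt0.
have [sA' [sA'0 sA'P]] := modulus_small om0c om00 gam2.
have nu0h : 1 / 2 < nu0 by case/andP: nu0P.
have [sA [sA0 sAP]] := powR_sqrt_small nu0h (ltr0n _ 27 : 0 < 27 :> R) sA'0.
pose sa := Num.min sA 1.
have sa0 : 0 < sa by rewrite lt_min sA0 ltr01.
have saA : sa <= sA by rewrite ge_min lexx.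
have sa1 : sa <= 1 by rewrite ge_min lexx orbT.
clearbody sa.
have n1 : 0 < n%:R + 1 :> R by rewrite ltr_wpDl.
(* The second summand, together with the estimate of [L' * |x - y|] from [doubling_jets], forces
   [s <= sa] below. *)
pose L' := eta * r / 8 + 24 * sg * (n%:R + 1) / sa.
have L'1 : eta * r / 8 <= L' by rewrite lerDl divr_ge0 ?(ltW sa0) // !mulr_ge0 ?(ltW sg0) ?(ltW n1).
have L'2 : 24 * sg * (n%:R + 1) / sa <= L' by rewrite lerDr divr_ge0 // !mulr_ge0 ?(ltW eta0) ?(ltW r0).
have L'0 : 0 < L' by apply: lt_le_trans L'1; rewrite divr_gt0 // mulr_gt0.
clearbody L'.
pose L := 2 * (Cs + L') + 2.
have LL' : 2 * (Cs + L') <= L by rewrite lerDl.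
have L2 : 2 <= L by rewrite lerDr mulr_ge0 // addr_ge0 // ltW.
have L0 : 0 < L by apply: lt_le_trans L2.
clearbody L.
(* Without a large trace gap [T] is only known to be at least 1, so the gradient bound has to
   contain [3 * L + 1]. The resulting [sb] depends on [L], and [e] is chosen after it. *)
have KL0 : 0 < 3 * L + 1 + V by move: L0 V1; clear; lra.
have [omL [nuL [[omLc _ _ omL0] nuLP HF1L]]] := HF1 _ KL0.
have mge : 0 < Num.min gam eta by rewrite lt_min gam0 eta0.
have [sB' [sB'0 sB'P]] := modulus_small omLc omL0 mge.
have nuLh : 1 / 2 < nuL by case/andP: nuLP.
have sqL0 : 0 < Num.sqrt L by rewrite sqrtr_gt0.
have CL0 : 0 < 3 * (4 * Num.sqrt L + 5) by move: sqL0; clear; lra.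
have [sB [sB0 sBP]] := powR_sqrt_small nuLh CL0 sB'0.
pose sb := Num.min sB 1.
have sb0 : 0 < sb by rewrite lt_min sB0 ltr01.
have sbB : sb <= sB by rewrite ge_min lexx.
have sb1 : sb <= 1 by rewrite ge_min lexx orbT.
clearbody sb.
(* The bound by [sb ^+ 2] serves the second case: [s^3 < e^2 <= sb^4 <= sb^3] gives [s <= sb]. *)
pose e := Num.min (sg / L) (Num.min (sa / 4) (Num.min (sb ^+ 2) (1 / 2))).
have e0 : 0 < e.
  rewrite !lt_min; apply/and4P; split; first exact: divr_gt0.
  - by apply: divr_gt0; rewrite ?ltr0n.
  - exact: exprn_gt0.
  - by apply: divr_gt0; rewrite ?ltr0n.
have eL : L * e <= sg by rewrite mulrC -ler_pdivlMr // ge_min lexx.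
have ea : e <= sa / 4 by rewrite !ge_min lexx !orbT.
have eb : e <= sb ^+ 2 by rewrite !ge_min lexx !orbT.
have e12 : e <= 1 / 2 by rewrite !ge_min lexx !orbT.
clearbody e.
pose dl := Num.min sg (Num.min eta (Num.min e (Num.min (1 / 8) (Num.min (r / 8) (sa / (16 * (n%:R + 1))))))).
have n16 : 0 < 16 * (n%:R + 1) :> R by rewrite mulr_gt0.
have dl0 : 0 < dl.
  by rewrite !lt_min sg0 eta0 e0 /=; apply/and3P; split; apply: divr_gt0; rewrite ?ltr0n.
have dls : dl <= sg by rewrite ge_min lexx.
have dleta : dl <= eta by rewrite !ge_min lexx !orbT.
have dle : dl <= e by rewrite !ge_min lexx !orbT.
have dl8 : dl <= 1 / 8 by rewrite !ge_min lexx !orbT.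
have dlr : dl <= r / 8 by rewrite !ge_min lexx !orbT.
have dla : dl * (16 * (n%:R + 1)) <= sa by rewrite -ler_pdivlMr // !ge_min lexx !orbT.
clearbody dl.
have dl01 : 0 < dl <= sg by rewrite dl0.
have [x [y [xx [yy [px [py [X [Y [[sX sY xr yr zL] [xxx yyy] [pxP pyP] [J1 J2] XY]]]]]]]]] :=
  CsP L' L e dl L'1 LL' L0 e0 eL dl01.
set z := x - y in zL pxP pyP XY.
set s := sabs e z.
have s0 : 0 < s by exact: sabs_gt0.
have es : e <= s by exact: sabs_ge.
have zs : `|z| <= s by exact: norm_le_sabs.
have ssa : s <= sa.
  apply: le_trans (sabs_le_norm e0 z) _.
  have h1 : 24 * sg * (n%:R + 1) <= L' * sa by rewrite -ler_pdivrMr.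
  have h2 : (n%:R + 1) * `|z| <= sa / 4.
    rewrite -(ler_pM2l L'0).
    have h3 := ler_wpM2l (ltW n1) zL.
    have h4 := ler_wpM2l (ltW L'0) dla.
    by move: h1 h3 h4; clear; lra.
  by move: ea h2 sa0; clear; lra.
have s1 : s <= 1 := le_trans ssa sa1.
have z1 : `|z| <= 1 := le_trans zs s1.
have xxr : `|xx - x0| <= r.
  rewrite -(subrKA x); apply: le_trans (ler_normD _ _) _.
  by move: xxx xr dlr r0; clear; lra.
have yyr : `|yy - x0| <= r.
  rewrite -(subrKA y); apply: le_trans (ler_normD _ _) _.
  by move: yyy yr dlr r0; clear; lra.
have xr1 : `|x - x0| <= r by move: xr dlr r0; clear; lra.
have [Oxx _ uxx _ [g1xx _]] := rP xx xxr.
have [Oyy _ _ vyy [_ g2yy]] := rP yy yyr.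
have FX := Vu _ _ _ Oxx sX J1.
have FY := Vv _ _ _ Oyy sY J2.
have dl02 : 0 <= dl by exact: ltW.
have HG := F_gap HF2 px py (u xx) (v yy) yy sX sY sM1 dl02 XY Oxx.
set tau := \tr (gap X Y M1 dl) in HG.
have tau0 : 0 <= tau by exact: gap_trace_ge0 sX sY sM1 XY.
pose T := tau + 1.
have T1 : 1 <= T by rewrite lerDr.
have T0 : 0 < T by apply: lt_le_trans T1.
have Lam0 : 0 < L / s by rewrite divr_gt0.
have dl018 : 0 <= dl <= 1 / 8 by rewrite dl02.
have YT : `|Y| <= 4 * (Num.sqrt (T * (L / s)) + T).
  exact: gap_norm_le sX sY sM1 dl018 Lam0 XY (penalty_hess_le L0 e0 z).
have pyL : `|py| <= 3 * L + 1.
  rewrite -(subrK (penalty_grad L e z) py); apply: le_trans (ler_normD _ _) _.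
  by have := penalty_grad_norm L0 e0 z1; move: pyP dl8; clear; lra.
have vV : `|v yy| <= V.
  by rewrite -(subrK (v x0) (v yy)) (le_trans (ler_normD _ _)) // VE addrC lerD // (le_trans vyy).
have xy3 : 0 <= `|xx - yy| <= 3 * s.
  rewrite normr_ge0 /= (_ : xx - yy = z + ((xx - x) - (yy - y))); last first.
    by rewrite /z; apply/rowP => k; rewrite !mxE; ring.
  apply: le_trans (ler_normD _ _) _; have := ler_normB (xx - x) (yy - y).
  by move: zs xxx yyy dle es; clear; lra.
have s01 : 0 < s <= 1 by rewrite s0.
(* If [e ^ 2 <= s ^ 3] the trace gap is at least [4 L] and absorbs the loss; otherwise
   [s] is as small as desired. *)
have loss : `|F Y py (v yy) xx - F Y py (v yy) yy| <= gam * tau + eta.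
  have [es3|es3] := leP (e ^+ 2) (s ^+ 3).
    have z0 : z != 0.
      apply/eqP => z0; move: es3; rewrite /s z0 /sabs dot0l addr0 sqrtr_sqr gtr0_norm //.
      by rewrite (exprS e 2) ler_pMl ?exprn_gt0 //; move: e12; clear; lra.
    have tauL : 4 * L <= tau.
      apply: (gap_trace_large sX sY sM1 XY z0); exact: penalty_hess_radial.
    have TL : T * L <= (T * 1) ^+ 2.
      by rewrite mulr1 expr2 ler_pM2l // /T; move: tauL L0; clear; lra.
    have nu01 : 0 < nu0 <= 1 by move: nu0P; clear; lra.
    have arg : `|xx - yy| `^ nu0 * (`|Y| / T + 1) <= sA'.
      apply: le_trans (modulus_argument s01 nu01 xy3 ler01 T0 _) _.
        apply: le_trans YT _; rewrite ler_pM2l // lerD2r.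
        exact: sqrt_gap_le s0 (ltW T0) (ltW L0) ler01 TL.
      rewrite (_ : 3 * (4 * 1 + 5) = 27); last by ring.
      by apply: sAP; rewrite s0 (le_trans ssa).
    have arg0 : 0 <= `|xx - yy| `^ nu0 * (`|Y| / T + 1).
      by rewrite mulr_ge0 ?powR_ge0 // addr_ge0 // divr_ge0 // ltW.
    have omle : om0 (`|xx - yy| `^ nu0 * (`|Y| / T + 1)) <= gam / 2.
      by apply: sA'P; rewrite arg0.
    apply: le_trans (F1_scaled HF3 HF10 T0 sY Oxx Oyy _ _) _.
    - apply: le_trans pyL _; rewrite mulrDl.
      have : 0 <= V * T by rewrite mulr_ge0 ?(ltW T0) // (le_trans ler01).
      by rewrite /T; move: tauL L2; clear; lra.
    - apply: le_trans vV _; rewrite -[leLHS]mulr1; apply: ler_pM => //.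
      by rewrite (le_trans ler01).
      by rewrite lerDr.
    apply: (@le_trans _ _ (T * (gam / 2))); first by rewrite ler_pM2l.
    have : gam * 1 <= gam * tau by rewrite ler_pM2l //; move: tauL L2; clear; lra.
    by rewrite /T; move: eta0; clear; lra.
  have ssb : s <= sb.
    rewrite leNgt; apply/negP => sbs.
    have h1 : sb ^+ 3 <= s ^+ 3 by rewrite lerXn2r ?nnegrE ?(ltW s0) ?(ltW sb0) ?(ltW sbs).
    have h2 : e ^+ 2 <= (sb ^+ 2) ^+ 2.
      by rewrite lerXn2r ?nnegrE ?(ltW e0) ?exprn_ge0 ?(ltW sb0).
    have h3 : (sb ^+ 2) ^+ 2 <= sb ^+ 3.
      rewrite -exprM (exprS sb 3) ler_piMl ?exprn_ge0 ?(ltW sb0) //.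
    by move: es3 h1 h2 h3; clear; lra.
  have nuL1 : 0 < nuL <= 1 by move: nuLP; clear; lra.
  have TL : T * L <= (T * Num.sqrt L) ^+ 2.
    rewrite exprMn sqr_sqrtr ?(ltW L0) // ler_pM2r // expr2 ler_peMl // ltW //.
  have arg : `|xx - yy| `^ nuL * (`|Y| / T + 1) <= sB'.
    apply: le_trans (modulus_argument s01 nuL1 xy3 (ltW sqL0) T0 _) _.
      apply: le_trans YT _; rewrite ler_pM2l // lerD2r.
      exact: sqrt_gap_le s0 (ltW T0) (ltW L0) (ltW sqL0) TL.
    by apply: sBP; rewrite s0 (le_trans ssb).
  have arg0 : 0 <= `|xx - yy| `^ nuL * (`|Y| / T + 1).
    by rewrite mulr_ge0 ?powR_ge0 // addr_ge0 // divr_ge0 // ltW.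
  have := sB'P (`|xx - yy| `^ nuL * (`|Y| / T + 1)); rewrite arg0 => /(_ arg).
  rewrite le_min => /andP[om1 om2].
  have KT : 3 * L + 1 + V <= (3 * L + 1 + V) * T by rewrite ler_peMr // ltW.
  apply: le_trans (F1_scaled HF3 HF1L T0 sY Oxx Oyy _ _) _.
  - by apply: le_trans KT; move: pyL V1; clear; lra.
  - by apply: le_trans KT; move: vV L0; clear; lra.
  rewrite {1}/T mulrDl mul1r mulrC; apply: lerD => //.
  by rewrite ler_wpM2r.
have P1 : pucci_minus gam Gam M - 2 * eta * (Gam * n%:R) <= pucci_minus gam Gam M1.
  by apply: pucci_minus_add_scal => //; rewrite mulr_ge0 // ltW.
have pxy : `|px - py| <= `|p| + 3 * eta.
  have xM : `|(x - x0) *m M1| <= eta.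
    apply: le_trans (mulmx_bound _ _) _; apply: le_trans rB; rewrite mulrAC mulrC.
    by rewrite ler_wpM2r.
  rewrite (_ : px - py = p + ((px - (p + (x - x0) *m M1 + penalty_grad L e z))
      - (py - penalty_grad L e z) + (x - x0) *m M1)); last first.
    by apply/rowP => k; move: ((x - x0) *m M1) (penalty_grad L e z) => a b; rewrite !mxE; ring.
  apply: le_trans (ler_normD _ _) _; rewrite lerD2l.
  apply: le_trans (ler_normD _ _) _; have := ler_normB (px - (p + (x - x0) *m M1 + penalty_grad L e z)) (py - penalty_grad L e z).
  by move: pxP pyP xM dleta; clear; lra.
have uvxy := abs_near uxx vyy.
have g1' : g1 xx <= g1 x0 + eta by move: g1xx; rewrite ler_norml; clear; lra.
have g2' : g2 x0 - eta <= g2 yy by move: g2yy; rewrite ler_norml; clear; lra.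
have := jet_arith d10 d00 Gn0 HG FX FY P1 pxy uvxy g1' g2' loss dleta eta0.
rewrite -/Del; move: etaC eta0; rewrite /Cst; clearbody Del; clear; lra.
Qed.

(** * Barriers *)

Section MeanValue.
Variables (R : realType) (n : nat).
Implicit Types (f : 'rV[R]_n -> R) (x h : 'rV[R]_n).

Lemma partial_mvt f x i (t : R) : (forall y, derivable f y (basis_vec R i)) ->
  exists c, `|c| <= `|t| /\
    f (x + t *: basis_vec R i) - f x = t * partial i f (x + c *: basis_vec R i).
Proof.
move=> df; set e := basis_vec R i; pose g (s : R) := f (x + s *: e).
have dg (s : R) : is_derive s 1 g (partial i f (x + s *: e)).
  have E : (fun h : R => h^-1 *: (g (h *: 1 + s) - g s)) =
      (fun h : R => h^-1 *: (f (h *: e + (x + s *: e)) - f (x + s *: e))).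
    by apply/funext => h; rewrite /g scaler1 scalerDl addrCA.
  split; last by rewrite /partial /derive /= E.
  by have := df (x + s *: e); rewrite /derivable /= E.
have cg : continuous g by move=> s; apply/differentiable_continuous/derivable1_diffP; case: (dg s).
have mvt (a b : R) : a < b -> exists2 c, a < c < b & g b - g a = partial i f (x + c *: e) * (b - a).
  move=> ab; have [|c cI cE] := @MVT _ g (fun s => partial i f (x + s *: e)) _ _ ab (fun s _ => dg s).
    exact: continuous_subspaceT.
  by exists c => //; rewrite in_itv in cI.
have g0 : g 0 = f x by rewrite /g scale0r addr0.
rewrite -g0 -/(g t).
have [t0|t0|->] := ltgtP t 0.
- have [c /andP[c1 c2] cE] := mvt _ _ t0; exists c; split.
    by rewrite (ler0_norm (ltW c2)) (ler0_norm (ltW t0)) lerN2 ltW.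
  by rewrite -opprB cE sub0r mulrN opprK mulrC.
- have [c /andP[c1 c2] cE] := mvt _ _ t0; exists c; split.
    by rewrite (ger0_norm (ltW c1)) (ger0_norm (ltW t0)) ltW.
  by rewrite cE subr0 mulrC.
by exists 0; rewrite subrr mul0r.
Qed.

(** Smoothness supplies derivatives along the basis vectors only, so the increment is split along a
    path changing one coordinate at a time, with the mean value theorem on each piece. *)
Lemma taylor_path f x h : (forall i y, derivable f y (basis_vec R i)) ->
  exists xi : 'I_n -> 'rV[R]_n, (forall i, `|xi i - x| <= `|h|) /\
    f (x + h) - f x = \sum_i h 0 i * partial i f (xi i).
Proof.
move=> df; pose pt k : 'rV[R]_n := x + \row_j (if (j < k)%N then h 0 j else 0).
have ptS (i : 'I_n) : pt i.+1 = pt i + h 0 i *: basis_vec R i.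
  apply/rowP => j; rewrite !mxE /= ltnS leq_eqVlt eq_sym (inj_eq val_inj) eq_sym.
  by case: eqVneq => [->|_]; rewrite ?ltnn ?mulr1 ?mulr0 ?addr0.
have /choice[c cP] : forall i : 'I_n, exists c, `|c| <= `|h 0 i| /\
    f (pt i.+1) - f (pt i) = h 0 i * partial i f (pt i + c *: basis_vec R i).
  by move=> i; rewrite ptS; exact: partial_mvt.
exists (fun i : 'I_n => pt i + c i *: basis_vec R i); split=> [i|].
  apply/mxnorm_leP => // k j; rewrite {k}ord1 !mxE /= addrAC (addrAC _ _ (- x 0 j)) subrr add0r.
  have hj k : `|h 0 k| <= `|h| by exact: coord_le_mxnorm.
  case: (eqVneq j i) => [->|_] /=; last by rewrite mulr0 addr0; case: ifP; rewrite ?normr0.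
  by rewrite ltnn add0r mulr1; apply: le_trans (hj i); exact: (cP i).1.
have -> : x + h = pt n.
  by congr (_ + _); apply/rowP => j; rewrite mxE ltn_ord.
have -> : f x = f (pt 0%N).
  by congr f; rewrite -[LHS]addr0; congr (_ + _); apply/rowP => j; rewrite !mxE.
rewrite -(telescope_sumr (fun k => f (pt k))) // big_mkord.
by apply: eq_bigr => i _; exact: (cP i).2.
Qed.

Lemma taylor_grad f x h (K : R) : smooth f -> 0 <= K ->
  (forall i j y, `|y - x| <= `|h| -> `|partial j (partial i f) y| <= K) ->
  `|f (x + h) - f x - dot (grad f x) h| <= n%:R ^+ 2 * K * dot h h.
Proof.
move=> sf K0 HK.
have d1 i y : derivable f y (basis_vec R i) by exact: (sf [::]).2.
have d2 k i y : derivable (partial k f) y (basis_vec R i) by exact: (sf [:: k]).2.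
have [xi [xih ->]] := taylor_path x h d1.
have -> : dot (grad f x) h = \sum_i h 0 i * partial i f x.
  by rewrite dotE; apply: eq_bigr => i _; rewrite mxE mulrC.
rewrite -sumrB; apply: le_trans (ler_norm_sum _ _ _) _.
apply: (@le_trans _ _ (\sum_(i < n) n%:R * K * `|h| ^+ 2)).
  apply: ler_sum => i _.
  rewrite (_ : n%:R * K * `|h| ^+ 2 = `|h| * \sum_(j < n) K * `|h|); last first.
    by rewrite sumr_const card_ord -mulr_natl; ring.
  rewrite -mulrBr normrM; apply: ler_pM => //; first exact: coord_le_mxnorm.
  have [ze [zeh zeE]] := taylor_path x (xi i - x) (d2 i).
  move: zeE; rewrite subrKC => ->.
  apply: le_trans (ler_norm_sum _ _ _) _; apply: ler_sum => j _.
  rewrite normrM mulrC; apply: ler_pM => //.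
    by apply: HK; apply: le_trans (zeh j) (xih i).
  by apply: le_trans (xih i); exact: coord_le_mxnorm.
rewrite sumr_const card_ord -[leLHS]mulr_natl [leLHS](_ : _ = n%:R ^+ 2 * K * `|h| ^+ 2); last by ring.
by apply: ler_wpM2l; [rewrite mulr_ge0 // exprn_ge0|exact: norm_le_dot].
Qed.

End MeanValue.

Definition pucci_sub (R : realType) (n : nat) (O : set 'rV[R]_n) (gam Gam d1 d0 : R)
    (w : 'rV[R]_n -> R) :=
  forall x0 p (M : 'M[R]_n), O x0 -> M^T = M ->
  (\forall y \near x0, w y <= w x0 + qform p M x0 y) ->
  pucci_minus gam Gam M - d1 * `|p| - d0 * `|w x0| <= 0.

Lemma barrier_arith (R : realFieldType) (b k C dd gq dl : R) : 0 <= k -> 0 <= C -> 0 <= dd ->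
  `|dl - gq| <= C * dd -> 2 * k * C * `|gq| <= 1 ->
  b * gq - (`|b| * C + 1) * dd + k * gq ^+ 2 <= b * dl + k * dl ^+ 2.
Proof.
move=> k0 C0 dd0 h1 h2; set t := dl - gq in h1; have -> : dl = gq + t by rewrite /t subrKC.
clearbody t.
have b1 : - (b * t) <= `|b| * (C * dd).
  by apply: le_trans (ler_norm _) _; rewrite normrN normrM ler_wpM2l.
have b2 : - (2 * k * (gq * t)) <= dd.
  apply: le_trans (ler_norm _) _; rewrite normrN !normrM (ger0_norm k0) ger0_norm //.
  apply: (@le_trans _ _ (2 * k * (`|gq| * (C * dd)))).
    by rewrite ler_wpM2l ?mulr_ge0 // ler_wpM2l.
  rewrite (_ : _ * _ = (2 * k * C * `|gq|) * dd); last by ring.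
  by rewrite ler_piMl.
have b3 : 0 <= k * t ^+ 2 by rewrite mulr_ge0 ?sqr_ge0.
by lra.
Qed.

(* Tests [w] against [- e * (b * sg + k * sg ^ 2)]; the one-sided expansion of the square uses
   only first-order information on [sg], the large term [k * (dot g h) ^ 2] being exact. *)
Lemma barrier_test (R : realType) (n : nat) (O : set 'rV[R]_n) (gam Gam d1 d0 : R)
    (w sg : 'rV[R]_n -> R) x0 g (C b k e : R) :
  0 < gam -> gam <= Gam -> 0 <= C -> 0 <= k -> 0 < e -> pucci_sub O gam Gam d1 d0 w -> O x0 ->
  (\forall y \near x0, `|sg y - sg x0 - dot g (y - x0)| <= C * dot (y - x0) (y - x0)) ->
  (\forall y \near x0, w y <= w x0 - e * (b * (sg y - sg x0) + k * (sg y - sg x0) ^+ 2)) ->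
  e * (2 * k * gam * dot g g - 2 * (`|b| * C + 1) * (Gam * n%:R) - d1 * (`|b| * `|g|))
    <= d0 * `|w x0|.
Proof.
move=> gam0 gG C0 k0 e0 Pw Ox nsg nw.
pose c := 2 * e * (`|b| * C + 1); pose N := (2 * k * e) *: (g^T *m g).
have c0 : 0 <= c by rewrite !mulr_ge0 ?(ltW e0) // addr_ge0 // mulr_ge0.
have ke0 : 0 <= 2 * k * e by rewrite !mulr_ge0 ?(ltW e0).
have pN : psd N.
  split=> [|z]; first by rewrite linearZ /= trmx_mul trmxK.
  by rewrite mulmx_scaler dotZl quad_rank1 mulr_ge0 ?sqr_ge0.
have trN : \tr N = 2 * k * e * dot g g.
  by rewrite linearZ /= -(mul1mx (g^T *m g)) trace_rank1 mulmx1.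
have sc : (c%:M : 'M[R]_n)^T = c%:M by rewrite tr_scalar_mx.
have sM : (c%:M - N)^T = c%:M - N by rewrite linearB /= sc pN.1.
have := Pw x0 (- (e * b) *: g) _ Ox sM; rewrite normrZ normrN normrM (gtr0_norm e0).
have h1 := @pucci_minus_sub_psd _ _ _ _ gam0 gG _ _ sc pN.
have s0 : (0 : 'M[R]_n)^T = 0 by rewrite linear0.
have h2 := @pucci_minus_add_scal _ _ _ _ gam0 gG _ _ s0 c0.
have h3 : 0 <= pucci_minus gam Gam (0 : 'M[R]_n).
  by apply: pucci_minus_ge => // A _; rewrite mulmx0 linear0 oppr0.
rewrite add0r in h2; rewrite trN in h1.
have fin : pucci_minus gam Gam (c%:M - N) - d1 * (e * `|b| * `|g|) - d0 * `|w x0| <= 0 ->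
    e * (2 * k * gam * dot g g - 2 * (`|b| * C + 1) * (Gam * n%:R) - d1 * (`|b| * `|g|))
      <= d0 * `|w x0|.
  by move: h1 h2 h3; rewrite /c; move: (pucci_minus _ _ _) => P1; move: (pucci_minus _ _ _) (pucci_minus _ _ _) => P2 P3; clear; lra.
move=> H; apply: fin; apply: H.
pose B := 2 * k * C * (n%:R * `|g|).
have B0 : 0 <= B by rewrite !mulr_ge0.
have B1 : 0 < B + 1 by rewrite ltr_wpDl.
have nB : \forall y \near x0, `|y - x0| * B <= 1.
  apply/near_normP; exists (B + 1)^-1; rewrite invr_gt0; split=> // y yx.
  apply: (@le_trans _ _ ((B + 1)^-1 * B)); first by rewrite ler_wpM2r // ltW.
  by rewrite mulrC ler_pdivrMr // mul1r lerDl.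
near=> y.
have h4 : w y <= w x0 - e * (b * (sg y - sg x0) + k * (sg y - sg x0) ^+ 2) by near: y.
have h5 : `|sg y - sg x0 - dot g (y - x0)| <= C * dot (y - x0) (y - x0) by near: y.
have h6 : `|y - x0| * B <= 1 by near: y.
have h7 : 2 * k * C * `|dot g (y - x0)| <= 1.
  apply: le_trans h6; rewrite (_ : _ * B = 2 * k * C * (n%:R * `|g| * `|y - x0|)); last first.
    by rewrite /B; ring.
  by apply: ler_wpM2l; rewrite ?mulr_ge0 ?dot_bound.
have h8 := barrier_arith b k0 C0 (dot_ge0 _) h5 h7.
apply: le_trans h4 _; rewrite lerD2l.
have -> : qform (- (e * b) *: g) (c%:M - N) x0 y =
    - (e * (b * dot g (y - x0) - (`|b| * C + 1) * dot (y - x0) (y - x0) + k * dot g (y - x0) ^+ 2)).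
  rewrite /qform mulmxDr mulmxN mul_mx_scalar /N mulmx_scaler !(dotDl, dotNl, dotZl) quad_rank1 (dotC (y - x0) g) /c.
  by field.
by rewrite lerN2 ler_pM2l.
Unshelve. all: by end_near.
Qed.

(** * Strong maximum principle *)

Lemma compact_ge0 (R : realType) (n : nat) (K : set 'rV[R]_n) (w : 'rV[R]_n -> R) : compact K -> {within K, continuous w} ->
  compact (K `&` [set x | 0 <= w x]).
Proof.
move=> cK cw; have : closed ((w : subspace K -> R) @^-1` [set t | 0 <= t]).
  by apply: preimage_closed => [x _|]; [exact: cw|exact: closed_ge].
move=> /closed_subspaceP[C cC E].
have -> : K `&` [set x | 0 <= w x] = K `&` C by rewrite setIC -[LHS]E setIC.
exact: compact_closedI.
Qed.

Lemma compact_max (R : realType) (n : nat) (K : set 'rV[R]_n) (w : 'rV[R]_n -> R) : compact K -> K !=set0 -> {within K, continuous w} ->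
  exists c, K c /\ forall x, K x -> w x <= w c.
Proof.
move=> cK K0 cw; have [c cK' cmax] := EVT_max_rV K0 cK cw.
by rewrite inE in cK'; exists c; split=> // x Kx; apply: cmax; rewrite inE.
Qed.

Lemma dist2_continuous (R : realType) (n : nat) (y : 'rV[R]_n) : continuous (fun x : 'rV[R]_n => dot (x - y) (x - y)).
Proof.
move=> x; have c := @continuous_coordB R n y x.
exact: (@continuous_dot R n _ (fun x : 'rV[R]_n => x - y) (fun x : 'rV[R]_n => x - y) x c c).
Qed.

Lemma dist_continuous (R : realType) (n : nat) (y : 'rV[R]_n) (r : R) :
  continuous (fun x : 'rV[R]_n => `|x - y| - r).
Proof.
move=> x; apply/continuous_normP => eps e0; exists eps; split=> // z zx.
rewrite opprB addrA subrK; apply: le_trans (ler_dist_dist _ _) _.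
by rewrite opprB addrA subrK ltW.
Qed.

Lemma dist2B (R : realType) (n : nat) (y x0 x : 'rV[R]_n) : dot (x - y) (x - y) - dot (x0 - y) (x0 - y) =
  2 * dot (x0 - y) (x - x0) + dot (x - x0) (x - x0).
Proof.
rewrite (_ : x - y = (x0 - y) + (x - x0)); last by rewrite [RHS]addrC subrKA.
by move: (x0 - y) (x - x0) => a b; rewrite !dot_lin (dotC b a); ring.
Qed.

(** The barrier argument of Hopf. Near [z] the function [w + e * phi], with [phi = tau + k * tau^2]
    and [tau] positive inside the sphere about [y1] through [z], has an interior maximum, where
    [barrier_test] contradicts the choice of [k]. A small ball about [z] replaces the usual
    annulus. *)
Lemma no_interior_touching (R : realType) (n : nat) (O : set 'rV[R]_n) (gam Gam d1 d0 : R)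
    (w : 'rV[R]_n -> R) y1 z (r : R) :
  0 < gam -> gam <= Gam -> 0 <= d1 -> 0 <= d0 -> 0 < r -> pucci_sub O gam Gam d1 d0 w ->
  (forall x, `|x - z| <= r -> [/\ O x, {for x, continuous w} & w x <= 0]) ->
  w z = 0 -> z != y1 ->
  ~ (forall x, `|x - z| <= r -> x != z ->
       dot (x - y1) (x - y1) <= dot (z - y1) (z - y1) -> w x < 0).
Proof.
move=> gam0 gG d10 d00 r0 Pw Hw wz zy1 Hin.
have [rho rhoE] : exists rho, rho = dot (z - y1) (z - y1) by eexists.
have rho0 : 0 < rho by rewrite rhoE dot_gt0 // subr_eq0.
pose tau x := rho - dot (x - y1) (x - y1).
have tauz : tau z = 0 by rewrite /tau rhoE subrr.
have ctau x : {for x, continuous tau}.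
  apply: continuousB; [exact: cst_continuous|exact: dist2_continuous].
have Gn0 : 0 <= Gam * n%:R by rewrite mulr_ge0 // (le_trans (ltW gam0)).
(* One more than the sum of the terms to be beaten, under the bounds [b <= 2],
   [|x0 - y1| <= 2 * rho + 1] and [|w x0| <= 2 * e]; [k] is scaled so that the gradient term reaches
   [A]. *)
have [A AE] : exists A, A = 6 * (Gam * n%:R) + 4 * d1 * (2 * rho + 1) + 2 * d0 + 1 by eexists.
have A0 : 0 < A.
  have : 0 <= d1 * (2 * rho + 1) by rewrite mulr_ge0 // addr_ge0 // mulr_ge0 // ltW.
  by rewrite AE; move: Gn0 d00; clear; lra.
have den0 : 0 < 4 * gam * rho by rewrite !mulr_gt0.
pose k := A / (4 * gam * rho).
have k0 : 0 < k by rewrite divr_gt0.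
have kE : 4 * k * gam * rho = A by rewrite /k; field; rewrite !gt_eqF.
clearbody k.
pose t0 := Num.min 1 (Num.min (rho / 2) (1 / (2 * k))).
have t00 : 0 < t0 by rewrite !lt_min ltr01 !divr_gt0 // mulr_gt0.
have t01 : t0 <= 1 by rewrite ge_min lexx.
have t0r : t0 <= rho / 2 by rewrite !ge_min lexx !orbT.
have t0k : k * t0 <= 1 / 2.
  rewrite mulrC -ler_pdivlMr // !ge_min; apply/orP; right; apply/orP; right.
  by apply: eq_ler; field; rewrite gt_eqF.
clearbody t0.
have [e1 [e10 e1P]] := (continuous_normP tau z).1 (ctau z) _ t00.
pose r1 := Num.min r (e1 / 2).
have r10 : 0 < r1 by rewrite lt_min r0 divr_gt0.
have r1r : r1 <= r by rewrite ge_min lexx.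
have r1e : r1 <= e1 / 2 by rewrite ge_min lexx orbT.
clearbody r1.
have taus x : `|x - z| <= r1 -> `|tau x| <= t0.
  by move=> xr; have := e1P x; rewrite tauz subr0; apply; move: xr r1e e10; clear; lra.
have Hw1 x : `|x - z| <= r1 -> [/\ O x, {for x, continuous w} & w x <= 0].
  by move=> xr; apply: Hw; exact: le_trans r1r.
pose phi x := tau x + k * tau x ^+ 2.
have phi2 x : `|x - z| <= r1 -> `|phi x| <= 2.
  move=> /taus tx; rewrite /phi (_ : _ + _ = tau x * (1 + k * tau x)); last by ring.
  have h1 : `|k * tau x| <= 1 / 2.
    by rewrite normrM (gtr0_norm k0); apply: le_trans t0k; rewrite ler_pM2l.
  rewrite normrM -[leRHS]mul1r; apply: ler_pM => //; first exact: le_trans t01.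
  by apply: le_trans (ler_normD _ _) _; rewrite normr1; move: h1; clear; lra.
have phineg x : `|x - z| <= r1 -> tau x < 0 -> phi x < 0.
  move=> /taus; rewrite ler_norml => /andP[tx _] tn; rewrite /phi.
  rewrite (_ : _ + _ = tau x * (1 + k * tau x)); last by ring.
  rewrite nmulr_rlt0 //; have : - (1 / 2) <= k * tau x.
    by apply: le_trans (_ : _ <= k * - t0) _; [rewrite mulrN lerN2|rewrite ler_pM2l].
  by clear; lra.
(* The part of the sphere inside the closed ball around [y1] misses the touching point. *)
have [c [c0 cP]] : exists c, 0 < c /\ forall x, `|x - z| <= r1 -> r1 <= `|x - z| ->
    0 <= tau x -> w x <= - c.
  pose K := [set x | `|x - z| <= r1] `&` [set x | 0 <= `|x - z| - r1] `&` [set x | 0 <= tau x].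
  have cK : compact K.
    apply: compact_ge0; last exact: continuous_subspaceT.
    apply: compact_ge0; first exact: (@compact_cball R n z r1).
    by apply: continuous_subspaceT; exact: dist_continuous.
  have [K0|/set0P K0] := eqVneq K set0.
    exists 1; split=> // x x1 x2 x3; have : K x by split=> //; split=> //=; rewrite subr_ge0.
    by rewrite K0.
  have [|x0 [[[x01 x02] x03] x0m]] := compact_max cK K0 (w := w).
    by apply: within_continuous_at => x [[/Hw1[]]].
  exists (- w x0); rewrite oppr_gt0; split; last first.
    by move=> x x1 x2 x3; rewrite opprK; apply: x0m; split=> //; split=> //=; rewrite subr_ge0.
  apply: Hin; first exact: le_trans r1r.
    apply/eqP => xz; move: x02; rewrite /= xz subrr normr0 sub0r oppr_ge0.
    by rewrite leNgt r10.
  by move: x03; rewrite /= /tau -rhoE subr_ge0.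
(* Since [|phi| <= 2], the perturbation stays below [c] and cannot lift [w <= - c] to a nonnegative
   value. *)
pose e := c / 3; have e0 : 0 < e by rewrite divr_gt0.
have cphi x : {for x, continuous phi}.
  apply: continuousD; first exact: ctau.
  apply: continuousM; first exact: cst_continuous.
  by apply: continuousM; exact: ctau.
have [x0 [x0r x0m]] : exists x0, `|x0 - z| <= r1 /\
    forall y, `|y - z| <= r1 -> w y + e * phi y <= w x0 + e * phi x0.
  apply: (@cball_max _ _ (fun y => w y + e * phi y)); first exact: ltW.
  move=> y /Hw1[_ cw _]; apply: continuousD => //.
  by apply: continuousM; [exact: cst_continuous|exact: cphi].
have max0 : 0 <= w x0 + e * phi x0.
  have := x0m z; rewrite subrr normr0 wz /phi tauz expr0n mulr0 addr0 mulr0 addr0.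
  by apply; exact: ltW.
have [Ox0 _ wx0] := Hw1 _ x0r.
have x0r' : `|x0 - z| < r1.
  rewrite lt_neqAle x0r andbT; apply/eqP => x0E; move: max0; apply/negP; rewrite -ltNge.
  have [tn|tp] := ltP (tau x0) 0.
    have := phineg _ x0r tn; rewrite -(pmulr_rlt0 _ e0) => h; move: h wx0; clear; lra.
  have h1 : w x0 <= - c by apply: cP => //; rewrite x0E.
  have h2 : e * phi x0 <= e * 2 by rewrite ler_pM2l // (le_trans (ler_norm _)) // phi2.
  by move: h1 h2 c0; rewrite /e; clear; lra.
have b2 : `|1 + 2 * k * tau x0| <= 2.
  apply: le_trans (ler_normD _ _) _; rewrite normr1 !normrM (gtr0_norm k0) ger0_norm //.
  have : k * `|tau x0| <= k * t0 by rewrite ler_pM2l // taus.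
  by move: t0k; clear; lra.
have nsg : \forall y \near x0, `|tau y - tau x0 - dot (- (2 *: (x0 - y1))) (y - x0)|
    <= 1 * dot (y - x0) (y - x0).
  near=> y; rewrite mul1r dotNl dotZl.
  have := dist2B y1 x0 y; rewrite /tau => h.
  rewrite (_ : _ - _ = - dot (y - x0) (y - x0)).
    by rewrite normrN ger0_norm // dot_ge0.
  by move: h; clear; lra.
have nw : \forall y \near x0, w y <= w x0 - e * ((1 + 2 * k * tau x0) * (tau y - tau x0)
    + k * (tau y - tau x0) ^+ 2).
  apply/near_normP; exists (r1 - `|x0 - z|); rewrite subr_gt0; split=> // y yx.
  have := x0m y; rewrite /phi; move: (tau y) (tau x0) => s t H.
  have {}H : w y + e * (s + k * s ^+ 2) <= w x0 + e * (t + k * t ^+ 2).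
    apply: H; rewrite -(subrKA x0); apply: le_trans (ler_normD _ _) _.
    by move: yx; clear; lra.
  move: H; lra.
have := barrier_test gam0 gG ler01 (ltW k0) e0 Pw Ox0 nsg nw.
set b := `|1 + _| in b2 *; rewrite normrN normrZ ger0_norm // mulr1 dotNl dotNr opprK dotZl dotZr.
have tx0 := taus _ x0r.
have wx0b : `|w x0| <= e * 2.
  rewrite ler0_norm //; have : e * phi x0 <= e * 2 by rewrite ler_pM2l // (le_trans (ler_norm _)) // phi2.
  by move: max0; clear; lra.
have dE : dot (x0 - y1) (x0 - y1) = rho - tau x0 by rewrite /tau subKr.
have gn : `|x0 - y1| <= 2 * rho + 1.
  have h1 := norm_le_dot (x0 - y1); rewrite dE in h1.
  have h2 : `|tau x0| <= rho / 2 := le_trans tx0 t0r.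
  move: h2; rewrite ler_norml => /andP[h2 _].
  move: (`|x0 - y1|) h1 h2 rho0 => q; clear; nra.
have h3 : 2 * rho <= 4 * (rho - tau x0).
  by have := le_trans (ler_norm _) (le_trans tx0 t0r); clear; lra.
rewrite dE => H.
have {}H : 2 * k * gam * (4 * (rho - tau x0)) - 2 * (b + 1) * (Gam * n%:R) -
    d1 * (b * (2 * `|x0 - y1|)) <= d0 * 2.
  rewrite -(ler_pM2l e0) [leRHS]mulrCA; apply: le_trans (ler_wpM2l d00 wx0b).
  by move: H; clear; lra.
have h4 : 2 * k * gam * (2 * rho) <= 2 * k * gam * (4 * (rho - tau x0)).
  by rewrite ler_wpM2l // !mulr_ge0 // ltW.
have h5 : 2 * (b + 1) * (Gam * n%:R) <= 6 * (Gam * n%:R).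
  by rewrite ler_wpM2r //; move: b2; clear; lra.
have h6 : d1 * (b * (2 * `|x0 - y1|)) <= d1 * (2 * (2 * (2 * rho + 1))).
  by apply: ler_wpM2l => //; apply: ler_pM; rewrite ?normr_ge0 ?mulr_ge0 // ler_wpM2l.
by move: H h4 h5 h6 kE; rewrite AE; clear; lra.
Unshelve. all: by end_near.
Qed.

(** If [w] were negative at some [y0] close to [z0], a zero [z] nearest to [y0] would be a touching
    point for a ball free of other zeros, against [no_interior_touching]. *)
Lemma zero_set_near (R : realType) (n : nat) (O : set 'rV[R]_n) (gam Gam d1 d0 : R)
    (w : 'rV[R]_n -> R) z0 :
  0 < gam -> gam <= Gam -> 0 <= d1 -> 0 <= d0 -> open O -> pucci_sub O gam Gam d1 d0 w ->
  (forall x, O x -> {for x, continuous w}) -> (forall x, O x -> w x <= 0) ->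
  O z0 -> w z0 = 0 -> \forall y \near z0, w y = 0.
Proof.
move=> gam0 gG d10 d00 oO Pw cw w0 Oz wz.
have /near_normP[r' [r'0 r'P]] : \forall y \near z0, O y by apply: open_nbhs_nbhs.
have [r rE] : exists r, r = r' / 4 by eexists.
have r0 : 0 < r by rewrite rE divr_gt0.
have Or x : `|x - z0| <= 2 * r -> O x by move=> xr; apply: r'P; move: xr r0; rewrite rE; clear; lra.
have n2 : 0 < n%:R + 2 :> R by rewrite ltr_wpDl.
(* The nearest zero minimizes the Euclidean distance, so in the maximum norm it lies within
   [(n + 1) * |y0 - z0|] of [y0]. One more unit for [y0] itself gives [n + 2]. *)
apply/near_normP; exists (r / (n%:R + 2)); rewrite divr_gt0 //; split=> // y0.
rewrite ltr_pdivlMr // => y0r.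
have y0z : `|y0 - z0| <= r.
  by apply: le_trans (ltW y0r); rewrite ler_peMr // -[leLHS]add0r lerD // ler1n.
have y0z2 : `|y0 - z0| <= 2 * r by move: y0z r0; clear; lra.
have Oy0 : O y0 := Or _ y0z2.
apply/eqP; rewrite eq_le w0 //= leNgt; apply/negP => wy0.
pose K := [set x | `|x - z0| <= 2 * r] `&` [set x | 0 <= w x].
have cK : compact K.
  apply: compact_ge0; first exact: (@compact_cball R n z0 (2 * r)).
  by apply: within_continuous_at => x /= /Or; exact: cw.
have Kz0 : K z0 by split=> /=; rewrite ?wz ?lexx // subrr normr0 mulr_ge0 // ltW.
have cd x : {for x, continuous (fun y : 'rV[R]_n => - dot (y - y0) (y - y0))}.
  by apply: continuousN; exact: dist2_continuous.
have [|z [[/= zr wz1] zmin]] := compact_max cK (ex_intro _ _ Kz0)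
    (w := fun x => - dot (x - y0) (x - y0)).
  by apply: within_continuous_at => x _; exact: cd.
have Oz1 := Or _ zr.
have wz0 : w z = 0 by apply/eqP; rewrite eq_le wz1 w0.
have zy0 : z != y0 by apply/eqP => E; move: wy0; rewrite -E wz0 ltxx.
have dz : dot (z - y0) (z - y0) <= dot (z0 - y0) (z0 - y0).
  by rewrite -lerN2; exact: zmin.
have zz0 : `|z - z0| <= r.
  have h1 : `|z - y0| <= (n%:R + 1) * `|y0 - z0|.
    have n10 : 0 <= n%:R :> R by [].
    rewrite -ler_sqr ?nnegrE ?mulr_ge0 ?addr_ge0 //.
    apply: le_trans (norm_le_dot _) _; apply: le_trans dz _; apply: le_trans (dot_le_norm _) _.
    rewrite distrC exprMn; apply: ler_wpM2r; first exact: sqr_ge0.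
    by move: n10; clear; nra.
  rewrite -(subrKA y0); apply: le_trans (ler_normD _ _) _.
  by move: h1 y0r; clear; lra.
(* Halving the ball about [y0] keeps it tangent at [z] but strictly inside elsewhere, so [z] is the
   only zero in the closed smaller ball. *)
pose y1 := y0 + 2^-1 *: (z - y0).
have zy1E : z - y1 = 2^-1 *: (z - y0).
  by apply/rowP => k; rewrite !mxE; field.
apply: (@no_interior_touching R n O gam Gam d1 d0 w y1 z r) => //.
- move=> x xz; have Ox : O x.
    apply: Or; rewrite -(subrKA z); apply: le_trans (ler_normD _ _) _.
    by move: xz zz0; clear; lra.
  by split=> //; [exact: cw|exact: w0].
- by rewrite -subr_eq0 zy1E scaler_eq0 negb_or invr_eq0 pnatr_eq0 /= subr_eq0.
move=> x xz xnz hx.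
have xr : `|x - z0| <= 2 * r.
  by rewrite -(subrKA z); apply: le_trans (ler_normD _ _) _; move: xz zz0; clear; lra.
rewrite ltNge; apply/negP => wx.
have : - dot (x - y0) (x - y0) <= - dot (z - y0) (z - y0) by apply: zmin; split.
have h1 := dist2B y1 z x; have h2 := dist2B y0 z x; have h3 : 0 < dot (x - z) (x - z).
  by rewrite dot_gt0 // subr_eq0.
move: hx h1 h2 h3; rewrite zy1E !(dotZl, dotZr).
by clear; lra.
Qed.

Lemma strong_maximum_principle (R : realType) (n : nat) (O : set 'rV[R]_n) (gam Gam d1 d0 : R)
    (w : 'rV[R]_n -> R) z :
  0 < gam -> gam <= Gam -> 0 <= d1 -> 0 <= d0 -> open O -> connected O ->
  pucci_sub O gam Gam d1 d0 w ->
  (forall x, O x -> {for x, continuous w}) -> (forall x, O x -> w x <= 0) ->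
  O z -> w z = 0 -> forall x, O x -> w x = 0.
Proof.
move=> gam0 gG d10 d00 oO kO Pw cw w0 Oz wz x Ox.
suff : [set y | O y /\ w y = 0] = O by move=> /seteqP[_ /(_ x Ox)] [].
apply: kO; first by exists z.
- exists [set y | O y /\ w y = 0]; last first.
    by apply/seteqP; split=> y /=; [case=> Oy wy|case=> _ [Oy wy]].
  rewrite openE => y /= [Oy wy]; rewrite /interior.
  have nO : \forall y' \near y, O y' by apply: open_nbhs_nbhs.
  have nz := zero_set_near gam0 gG d10 d00 oO Pw cw w0 Oy wy.
  by near=> y'; split; near: y'.
exists (~` [set y | O y /\ w y < 0]); last first.
  apply/seteqP; split=> y /= [Oy H]; split=> //; first by rewrite H ltxx => -[].
  by apply/eqP; rewrite eq_le w0 //= leNgt; apply/negP => wy; apply: H.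
apply: open_closedC; rewrite openE => y /= [Oy wy]; rewrite /interior.
have nO : \forall y' \near y, O y' by apply: open_nbhs_nbhs.
have wy2 : 0 < - w y / 2 by rewrite divr_gt0 // oppr_gt0.
have [e [e0 eP]] := (continuous_normP w y).1 (cw _ Oy) _ wy2.
have nw : \forall y' \near y, w y' < 0.
  apply/near_normP; exists e; split=> // y' /eP; rewrite ler_norml; move: wy; clear; lra.
by near=> y'; split; near: y'.
Unshelve. all: by end_near.
Qed.

(** * Maximum principle in a strip along the boundary *)

Lemma closure_cases (R : realType) (n : nat) (O : set 'rV[R]_n) x : open O -> closure O x ->
  O x \/ bdry O x.
Proof.
move=> oO cx; have [Ox|nOx] := pselect (O x); [by left|right; split=> //].
by move=> /interior_subset.
Qed.

Lemma bounded_closure (R : realType) (n : nat) (O : set 'rV[R]_n) : bounded_set O ->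
  exists B : R, forall x, closure O x -> `|x - 0| <= B.
Proof.
move=> [M [_ HM]]; exists (M + 1) => x cx.
have : closure [set x : 'rV[R]_n | `|x - 0| <= M + 1] x.
  apply: closureS cx => y Oy /=; rewrite subr0; apply: (HM (M + 1)) => //.
  by rewrite ltrDl.
rewrite -(closure_id _).1 //.
exact: compact_closed (@compact_cball R n 0 (M + 1)).
Qed.

Lemma compact_bounded_closure (R : realType) (n : nat) (O : set 'rV[R]_n) : bounded_set O ->
  compact (closure O).
Proof.
move=> /bounded_closure[B HB].
apply: (subclosed_compact (@closed_closure _ O) (@compact_cball R n 0 B)) => x; exact: HB.
Qed.

Lemma second_partials_bound (R : realType) (n : nat) (rho : 'rV[R]_n -> R) (B : R) :
  smooth rho -> 0 <= B -> exists K : R, 0 <= K /\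
    forall i j y, `|y - 0| <= B -> `|partial j (partial i rho) y| <= K.
Proof.
move=> sr B0.
have /choice[k kP] : forall ij : 'I_n * 'I_n, exists c : R, 0 <= c /\
    forall y, `|y - 0| <= B -> `|partial ij.2 (partial ij.1 rho) y| <= c.
  move=> [i j]; have cs := (sr [:: j; i]).1.
  have [c [_ cP]] := @cball_max R n (fun y => `|partial j (partial i rho) y|) 0 B B0
    (fun y _ => continuous_comp (cs y) (@norm_continuous _ _ _)).
  by exists `|partial j (partial i rho) c|.
exists (\sum_ij k ij); split=> [|i j y yB]; first by apply: sumr_ge0 => ij _; exact: (kP ij).1.
apply: le_trans ((kP (i, j)).2 y yB) _; rewrite (bigD1 (i, j)) //= lerDl.
by apply: sumr_ge0 => ij _; exact: (kP ij).1.
Qed.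

Lemma strip_arith (R : realFieldType) (gam G a m lam C Gn d1 d0 b rho0 g gg A : R) :
  0 < gam -> 0 < lam -> 0 <= C -> 0 <= Gn -> 0 <= d1 -> 0 <= g -> 0 <= G ->
  A = 2 * C * Gn + d1 * G + 1 ->
  lam * (gam * (m / 2)) = d0 + 2 * Gn + 1 -> a <= m / 2 -> a * (2 * A) <= gam * (m / 2) ->
  `|rho0| <= a -> m <= gg + a -> g <= G -> b = 2 * lam * rho0 ->
  d0 < 2 * lam * gam * gg - 2 * (`|b| * C + 1) * Gn - d1 * (`|b| * g).
Proof.
move=> gam0 lam0 C0 Gn0 d10 g0 G0 AE lamE am aA ra mg gG ->.
rewrite !normrM (gtr0_norm lam0) ger0_norm //.
have a0 : 0 <= a by apply: le_trans ra.
have h1 : 2 * lam * gam * (m / 2) <= 2 * lam * gam * gg.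
  by rewrite ler_wpM2l ?mulr_ge0 // ?(ltW lam0) ?(ltW gam0) //; move: am mg; clear; lra.
have h2 : 2 * lam * `|rho0| <= 2 * lam * a by rewrite ler_wpM2l // mulr_ge0 // ltW.
have h3 : 2 * lam * `|rho0| * (C * Gn) <= 2 * lam * a * (C * Gn).
  by rewrite ler_wpM2r // mulr_ge0.
have h4 : d1 * (2 * lam * `|rho0| * g) <= d1 * (2 * lam * a * G).
  by rewrite ler_wpM2l // ler_pM // !mulr_ge0 // ltW.
have h5 : lam * (a * (2 * A)) <= lam * (gam * (m / 2)) by rewrite ler_pM2l.
have h6 : 0 <= lam * a by rewrite mulr_ge0 // ltW.
by move: h1 h3 h4 h5 h6 lamE; rewrite AE; clear; lra.
Qed.

(** [K] is fixed before [w], so the same strip serves every multiple of [u] in the comparison. The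
    sign follows by maximizing [w / psi]: at a positive interior maximum [w] is touched by a
    multiple of [psi], which [barrier_test] rules out. *)
Lemma strip_maximum_principle (R : realType) (n : nat) (O : set 'rV[R]_n) (gam Gam d1 d0 : R) :
  0 < gam -> gam <= Gam -> 0 <= d1 -> 0 <= d0 -> smooth_bounded_domain O ->
  exists K : set 'rV[R]_n, [/\ compact K, K `<=` O &
    forall w, pucci_sub O gam Gam d1 d0 w -> {within closure O, continuous w} ->
      (forall x, bdry O x -> w x <= 0) -> (forall x, K x -> w x <= 0) ->
      forall x, O x -> w x <= 0].
Proof.
move=> gam0 gG d10 d00 [oO [bO [rho [sr OE bE gE]]]].
have [eO|/set0P[xO OxO]] := eqVneq O set0.
  by exists set0; split=> // [|w _ _ _ _ x]; [exact: compact0|rewrite eO].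
have cO := compact_bounded_closure bO.
have [B0 HB0] := bounded_closure bO.
have [B [B1 HB]] : exists B : R, 0 <= B /\ forall x, closure O x -> `|x - 0| <= B.
  exists `|B0|; split=> // x /HB0 h; apply: le_trans h _; exact: ler_norm.
have cl0 : closure O !=set0 by exists xO; exact: subset_closure.
have crho : continuous rho := (sr [::]).1.
have rhoO x : O x -> rho x < 0 by rewrite {1}OE.
have rhob x : bdry O x -> rho x = 0 by rewrite bE.
have rhoC x : closure O x -> rho x <= 0.
  by move=> /(closure_cases oO)[/rhoO/ltW|/rhob ->].
have cgk x k : {for x, continuous (fun y => grad rho y 0 k)}.
  rewrite (_ : (fun y => _) = partial k rho); first exact: (sr [:: k]).1.
  by apply/funext => y; rewrite mxE.
have cg2 x : {for x, continuous (fun y => dot (grad rho y) (grad rho y))}.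
  exact: (@continuous_dot R n _ (grad rho) (grad rho) x (cgk x) (cgk x)).
have [xG [_ HG]] := compact_max cO cl0 (within_continuous_at (fun y _ => cg2 y)).
have [G GE] : exists G, G = dot (grad rho xG) (grad rho xG) + 1 by eexists.
have G0 : 0 <= G by rewrite GE addr_ge0 ?dot_ge0.
have gG' x : closure O x -> `|grad rho x| <= G.
  move=> /HG; have := norm_le_dot (grad rho x); rewrite GE.
  move: (dot _ _) (dot _ _) `|_| => p q t; clear; nra.
have cm x : {for x, continuous (fun y => rho y - dot (grad rho y) (grad rho y))}.
  by apply: continuousB; [exact: crho|exact: cg2].
have [xm [Cxm Hm]] := compact_max cO cl0 (within_continuous_at (fun y _ => cm y)).
(* The minimum over the closure of [|grad rho|^2 - rho]. It is positive because [- rho > 0] inside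
   and the gradient is nonzero where [rho = 0]; in the strip it bounds [|grad rho|^2] below by
   [m - a >= m / 2]. *)
have [m mE] : exists m, m = dot (grad rho xm) (grad rho xm) - rho xm by eexists.
have mP x : closure O x -> m <= dot (grad rho x) (grad rho x) - rho x.
  by move=> /Hm; rewrite mE; clear; lra.
have m0 : 0 < m.
  rewrite mE; have [/rhoO|bx] := closure_cases oO Cxm.
    by have := dot_ge0 (grad rho xm); clear; lra.
  by rewrite (rhob _ bx) subr0 dot_gt0 // gE.
have B10 : 0 <= B + 1 by rewrite addr_ge0.
have [K2 [K20 K2P]] := second_partials_bound sr B10.
have [C CE] : exists C, C = n%:R ^+ 2 * K2 by eexists.
have C0 : 0 <= C by rewrite CE mulr_ge0 // exprn_ge0.
have Gn0 : 0 <= Gam * n%:R by rewrite mulr_ge0 // (le_trans (ltW gam0)).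
have [A AE] : exists A, A = 2 * C * (Gam * n%:R) + d1 * G + 1 by eexists.
have A0 : 0 < A.
  by rewrite AE; have := mulr_ge0 C0 Gn0; have := mulr_ge0 d10 G0; clear; lra.
have gm0 : 0 < gam * (m / 2) by rewrite mulr_gt0 // divr_gt0.
have [lam lamE] : exists lam, lam = (d0 + 2 * (Gam * n%:R) + 1) / (gam * (m / 2)) by eexists.
have lam0 : 0 < lam by rewrite lamE divr_gt0 //; move: d00 Gn0; clear; lra.
have lamE' : lam * (gam * (m / 2)) = d0 + 2 * (Gam * n%:R) + 1.
  by rewrite lamE mulfVK // gt_eqF.
pose a := Num.min (Num.min 1 (m / 2)) (Num.min (gam * (m / 2) / (2 * A)) (1 / (2 * lam))).
have a0 : 0 < a by rewrite !lt_min ltr01 !divr_gt0 // mulr_gt0.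
have a1 : a <= 1 by rewrite !ge_min lexx.
have am : a <= m / 2 by rewrite !ge_min lexx !orbT.
have aA : a * (2 * A) <= gam * (m / 2).
  by rewrite -ler_pdivlMr ?mulr_gt0 // !ge_min lexx !orbT.
have al : lam * a <= 1 / 2.
  have : a * (2 * lam) <= 1 by rewrite -ler_pdivlMr ?mulr_gt0 // !ge_min lexx !orbT.
  by clear; lra.
clearbody a.
have crN x : {for x, continuous (fun y => - a - rho y)}.
  by apply: continuousB; [exact: cst_continuous|exact: crho].
have crP x : {for x, continuous (fun y => rho y + a)}.
  by apply: continuousD; [exact: crho|exact: cst_continuous].
exists (closure O `&` [set x | 0 <= - a - rho x]); split.
- by apply: compact_ge0 => //; apply: within_continuous_at => y _; exact: crN.
- move=> x [/(closure_cases oO)[//|/rhob rx]] /=; rewrite rx subr0 oppr_ge0.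
  by rewrite leNgt a0.
move=> w Pw cw wb wK x1 Ox1; rewrite leNgt; apply/negP => wx1.
pose K := closure O `&` [set x | 0 <= rho x + a].
have cK : compact K by apply: compact_ge0 => //; apply: within_continuous_at => y _; exact: crP.
have inK x : O x -> 0 < w x -> - a < rho x.
  move=> Ox wx; rewrite ltNge; apply/negP => rx; move: wx; apply/negP; rewrite -leNgt.
  by apply: wK; split; [exact: subset_closure|rewrite /= subr_ge0].
have Kx1 : K x1.
  by split; [exact: subset_closure|have := inK _ Ox1 wx1; rewrite /=; clear; lra].
(* [psi] is a strict supersolution on the strip because the gradient of [rho] does not vanish there. *)
pose psi x := 1 - lam * rho x ^+ 2.
have rhoK x : K x -> `|rho x| <= a.
  by move=> [/rhoC r0 /= r1]; rewrite ler0_norm //; move: r1; clear; lra.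
have psiK x : K x -> 1 / 2 <= psi x /\ psi x <= 1.
  move=> /rhoK ra; have : lam * rho x ^+ 2 <= lam * a.
    rewrite ler_pM2l // -(real_normK (num_real (rho x))) expr2 -[leRHS]mul1r ler_pM //.
    exact: le_trans a1.
  have : 0 <= lam * rho x ^+ 2 by rewrite mulr_ge0 ?sqr_ge0 // ltW.
  by rewrite /psi; move: al; clear; lra.
have psi0 x : K x -> 0 < psi x by move=> /psiK[h _]; move: h; clear; lra.
have cpsi x : {for x, continuous psi}.
  apply: continuousB; first exact: cst_continuous.
  apply: continuousM; first exact: cst_continuous.
  by apply: continuousM; exact: crho.
have cE : {within K, continuous (fun x => (psi x)^-1)}.
  apply: within_continuous_at => y Ky; apply: continuousV; last exact: cpsi.
  by rewrite gt_eqF // psi0.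
have cw' : {within K, continuous w} by apply: continuous_subspaceW cw => x [].
have [x0 [Kx0 x0m]] : exists x0, K x0 /\ forall x, K x -> w x / psi x <= w x0 / psi x0.
  apply: (compact_max cK) => [|x]; first by exists x1.
  exact: (continuousM (cw' x) (cE x)).
pose th := w x0 / psi x0.
have th0 : 0 < th by apply: lt_le_trans (x0m _ Kx1); rewrite divr_gt0 // psi0.
have wE : w x0 = th * psi x0 by rewrite /th mulfVK // gt_eqF // psi0.
have wx0 : 0 < w x0 by rewrite wE mulr_gt0 // psi0.
have wle y : K y -> w y <= th * psi y.
  by move=> Ky; rewrite -ler_pdivrMr ?psi0 //; exact: x0m.
clearbody th.
have Ox0 : O x0.
  by have [//|/wb] := closure_cases oO Kx0.1; rewrite leNgt wx0.
have rx0 := inK _ Ox0 wx0.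
have nK : \forall y \near x0, K y.
  have nO : \forall y \near x0, O y by apply: open_nbhs_nbhs.
  have ra : 0 < (rho x0 + a) / 2 by rewrite divr_gt0 //; move: rx0; clear; lra.
  have [e [e0 eP]] := (continuous_normP rho x0).1 (crho x0) _ ra.
  have nr : \forall y \near x0, 0 <= rho y + a.
    apply/near_normP; exists e; split=> // y /eP; rewrite ler_norml; move: rx0; clear; lra.
  by near=> y; split; [apply: subset_closure|]; near: y.
have nsg : \forall y \near x0, `|rho y - rho x0 - dot (grad rho x0) (y - x0)|
    <= C * dot (y - x0) (y - x0).
  apply/near_normP; exists 1; split=> // y yx.
  have := @taylor_grad R n rho x0 (y - x0) K2 sr K20; rewrite subrKC CE; apply.
  move=> i j z zx; apply: K2P; rewrite -(subrKA x0).
  apply: le_trans (ler_normD _ _) _; rewrite addrC; apply: lerD; first exact: HB Kx0.1.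
  by apply: le_trans zx _; exact: ltW.
(* The bracket is the exact expansion of [lam * rho^2] at [rho x0]. Its linear coefficient is at
   most [2 * lam * a] in absolute value, hence small in a thin strip, while the quadratic
   coefficient [lam] is large. *)
have nw : \forall y \near x0, w y <= w x0 - th * (2 * lam * rho x0 * (rho y - rho x0)
    + lam * (rho y - rho x0) ^+ 2).
  near=> y; have : w y <= th * psi y by apply: wle; near: y.
  by rewrite wE /psi; clear; lra.
have := barrier_test gam0 gG C0 (ltW lam0) th0 Pw Ox0 nsg nw.
apply/negP; rewrite -ltNge; apply: (@le_lt_trans _ _ (th * d0)).
  by rewrite mulrC gtr0_norm // wE ler_wpM2r // -[leRHS]mulr1 ler_pM2l //; exact: (psiK _ Kx0).2.
rewrite ltr_pM2l //.
have mg : m <= dot (grad rho x0) (grad rho x0) + a.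
  by have := mP _ Kx0.1; move: rx0; clear; lra.
exact: (strip_arith gam0 lam0 C0 Gn0 d10 (normr_ge0 _) G0 AE lamE' am aA (rhoK _ Kx0) mg (gG' _ Kx0.1)).
Unshelve. all: by end_near.
Qed.

(** * Comparison *)

Lemma within_open_continuous (R : realType) (n : nat) (O A : set 'rV[R]_n) (f : 'rV[R]_n -> R) :
  open O -> O `<=` A -> {within A, continuous f} -> forall x, O x -> {for x, continuous f}.
Proof.
move=> oO OA /within_normP cf x Ox; apply/continuous_normP => eps eps0.
have [e [e0 eP]] := cf x (OA _ Ox) _ eps0.
have /near_normP[r [r0 rP]] : \forall y \near x, O y by apply: open_nbhs_nbhs.
exists (Num.min e r); rewrite lt_min e0 r0; split=> // z; rewrite lt_min => /andP[ze zr].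
by apply: eP => //; apply/OA/rP.
Qed.

Lemma closure_ge0 (R : realType) (n : nat) (O : set 'rV[R]_n) (w : 'rV[R]_n -> R) :
  {within closure O, continuous w} -> (forall x, O x -> 0 <= w x) ->
  forall x, closure O x -> 0 <= w x.
Proof.
move=> /within_normP cw w0 x cx; rewrite leNgt; apply/negP => wx.
have wx2 : 0 < - w x / 2 by rewrite divr_gt0 // oppr_gt0.
have [e [e0 eP]] := cw x cx _ wx2.
have [y [Oy /= yx]] : O `&` [set y | `|y - x| < e] !=set0.
  by apply: cx; apply/near_normP; exists e.
have := eP y (subset_closure Oy) yx; have := w0 y Oy.
by rewrite ler_norml; move: wx; clear; lra.
Qed.

Section Comparison.
Variables (R : realType) (n : nat) (O : set 'rV[R]_n) (F : NLop R n) (d1 d0 gam Gam : R).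
Implicit Types u v f : 'rV[R]_n -> R.

Lemma jet_sub_scale u f (s : R) : cond_F3 F O -> 0 < s -> jet_sub F O u f ->
  jet_sub F O (fun x => s * u x) (fun x => s * f x).
Proof.
move=> HF3 s0 Hu x0 p M Ox sM nu; have s1 : s != 0 by rewrite gt_eqF.
have sM' : (s^-1 *: M)^T = s^-1 *: M by rewrite linearZ /= sM.
rewrite -{1}(scalerKV s1 M) -{1}(scalerKV s1 p) HF3 ?(ltW s0) // ler_pM2l //.
apply: Hu => //; apply: filterS nu => y.
have -> : qform (s^-1 *: p) (s^-1 *: M) x0 y = s^-1 * qform p M x0 y.
  by rewrite /qform mulmx_scaler !dotZl; ring.
by move=> H; rewrite -(ler_pM2l s0) mulrDr mulVKf.
Qed.

Lemma difference_pucci_sub u v f (s : R) : open O ->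
  cond_F1 F O -> cond_F2 F O d1 d0 gam Gam -> cond_F3 F O ->
  (forall x, O x -> {for x, continuous u}) -> (forall x, O x -> {for x, continuous v}) ->
  (forall x, O x -> {for x, continuous f}) -> (forall x, O x -> 0 <= f x) ->
  jet_sub F O u f -> jet_super F O v f -> 0 < s -> s <= 1 ->
  pucci_sub O gam Gam d1 d0 (fun x => s * u x - v x).
Proof.
move=> oO HF1 HF2 HF3 cu cv cf f0 Hu Hv s0 s1 x0 p M Ox sM nw.
have csc (g : 'rV[R]_n -> R) x : {for x, continuous g} -> {for x, continuous (fun y => s * g y)}.
  by move=> cg; apply: continuousM => //; exact: cst_continuous.
apply: le_trans (difference_jet oO HF1 HF2 HF3 (fun x Hx => csc _ _ (cu x Hx)) cv
  (fun x Hx => csc _ _ (cf x Hx)) cf (jet_sub_scale HF3 s0 Hu) Hv Ox sM nw) _.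
by rewrite subr_le0 ler_piMl // f0.
Qed.

Lemma proportional_of_positive u v f xt : smooth_bounded_domain O -> connected O ->
  cond_F1 F O -> cond_F2 F O d1 d0 gam Gam -> cond_F3 F O ->
  {within closure O, continuous u} -> {within closure O, continuous v} ->
  {within O, continuous f} -> jet_sub F O u f -> jet_super F O v f ->
  O xt -> v xt < u xt -> (forall x, O x -> 0 <= f x /\ 0 < v x) ->
  (forall x, bdry O x -> u x <= 0) ->
  exists2 t : R, 0 < t & forall x, closure O x -> v x = t * u x.
Proof.
move=> sO kO HF1 HF2 HF3 cu cv cf Hu Hv Ot vut fv ub.
have [oO _] := sO; have [d10 d00 gam0 gG _] := HF2.
have cu' := within_open_continuous oO (@subset_closure _ O) cu.
have cv' := within_open_continuous oO (@subset_closure _ O) cv.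
have cf' := within_open_continuous oO (@subset_refl _ O) cf.
have f0 x : O x -> 0 <= f x by move=> /fv[].
have v0 x : O x -> 0 < v x by move=> /fv[].
have vb x : bdry O x -> 0 <= v x.
  by move=> [cx _]; apply: closure_ge0 cx => // y /v0/ltW.
have cw (s : R) : {within closure O, continuous (fun x => s * u x - v x)}.
  move=> x; have c : {for x, continuous ((fun=> s) : subspace (closure O) -> R)}.
    exact: cst_continuous.
  exact: (continuousB (continuousM c (cu x)) (cv x)).
have cw' s := within_open_continuous oO (@subset_closure _ O) (cw s).
have Pw s : 0 < s -> s <= 1 -> pucci_sub O gam Gam d1 d0 (fun x => s * u x - v x).
  by move=> s0 s1; exact: (difference_pucci_sub oO HF1 HF2 HF3 cu' cv' cf' f0 Hu Hv s0 s1).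
(* The cap at 1 bounds [S] and keeps [Pw] applicable; the point [xt] shows that the supremum stays
   below the cap. *)
pose S := [set s : R | 0 <= s <= 1 /\ forall x, O x -> s * u x <= v x].
have S0 : S 0.
  by split; [rewrite lexx ler01|move=> x /v0; rewrite mul0r => /ltW].
have hS : has_sup S by split; [exists 0|exists 1 => s [/andP[]]].
pose s := sup S.
have s0 : 0 <= s by apply: ub_le_sup S0; exact: hS.2.
have s1 : s <= 1 by apply: ge_sup; [exists 0|move=> t [/andP[]]].
(* The supremum is attained: a violation at [x] needs [u x > 0], and then [v x / u x] bounds every
   element of [S] strictly below [s]. *)
have suv x : O x -> s * u x <= v x.
  move=> Ox; rewrite leNgt; apply/negP => vx.
  have ux : 0 < u x.
    rewrite ltNge; apply/negP => ux; have := v0 _ Ox.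
    by have := mulr_ge0_le0 s0 ux; move: vx; lra.
  have eps0 : 0 < s - v x / u x by rewrite subr_gt0 ltr_pdivrMr.
  have [t [_ /(_ x Ox) tu]] := sup_adherent eps0 hS.
  by rewrite subKr ltr_pdivrMr // ltNge tu.
have s1' : s < 1.
  by rewrite lt_neqAle s1 andbT; apply/eqP => E; have := suv _ Ot; rewrite E mul1r leNgt vut.
have smax t : S t -> t <= s by move=> St; apply: ub_le_sup St; exact: hS.2.
clearbody s.
have [[z [Oz wz]]|ntouch] := pselect (exists z, O z /\ s * u z - v z = 0).
  have s0' : 0 < s.
    rewrite lt_neqAle s0 andbT; apply/eqP => E; have := v0 _ Oz.
    by move: wz; rewrite -E mul0r sub0r => /eqP; rewrite oppr_eq0 => /eqP ->; rewrite ltxx.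
  have w0 x : O x -> s * u x - v x <= 0 by move=> Ox; rewrite subr_le0 suv.
  have wE := strong_maximum_principle gam0 gG d10 d00 oO kO (Pw s s0' s1) (cw' s) w0 Oz wz.
  exists s => // x cx; apply/eqP; rewrite eq_le; apply/andP; split.
    rewrite -subr_ge0; apply: (closure_ge0 (cw s)) cx => y Oy.
    by rewrite wE.
  have cwN : {within closure O, continuous (fun x => v x - s * u x)}.
    move=> y; have c : {for y, continuous ((fun=> s) : subspace (closure O) -> R)}.
      exact: cst_continuous.
    exact: (continuousB (cv y) (continuousM c (cu y))).
  by rewrite -subr_ge0; apply: (closure_ge0 cwN) cx => y Oy; rewrite -opprB wE // oppr0.
exfalso; have [K [cK KO HK]] := strip_maximum_principle gam0 gG d10 d00 sO.
have [c [U [c0 U0 cU]]] : exists c U : R, [/\ 0 < c, 0 < U &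
    forall x, K x -> s * u x - v x <= - c /\ u x <= U].
  have [K0|/set0P K0] := eqVneq K set0.
    by exists 1, 1; split=> // x; rewrite K0.
  have [x1 [Kx1 Hx1]] := compact_max cK K0 (within_continuous_at (fun y Ky => cw' s y (KO y Ky))).
  have [x2 [Kx2 Hx2]] := compact_max cK K0 (within_continuous_at (fun y Ky => cu' y (KO y Ky))).
  exists (- (s * u x1 - v x1)), (`|u x2| + 1); split.
  - rewrite oppr_gt0 lt_neqAle subr_le0 suv ?andbT; last exact: KO.
    by apply/eqP => E; apply: ntouch; exists x1; split=> //; exact: KO.
  - by rewrite ltr_wpDl.
  move=> x Kx; rewrite opprK; split; first exact: Hx1.
  apply: le_trans (Hx2 x Kx) _; apply: le_trans (ler_norm _) _.
  by rewrite lerDl.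
(* The first bound keeps [s + eta <= 1] for [Pw]; the second spends the gap [c] on [K], where
   [u <= U]. *)
pose eta := Num.min (1 - s) (c / U).
have eta0 : 0 < eta by rewrite lt_min subr_gt0 s1' divr_gt0.
have etas : eta <= 1 - s by rewrite ge_min lexx.
have etaU : eta * U <= c by rewrite -ler_pdivlMr // ge_min lexx orbT.
clearbody eta.
have t0 : 0 < s + eta by rewrite ltr_wpDl.
have t1 : s + eta <= 1 by rewrite -lerBrDl.
have neg x : O x -> (s + eta) * u x - v x <= 0.
  apply: (HK _ (Pw _ t0 t1) (cw _)) => [y yb|y Ky].
    by have := vb _ yb; have := mulr_ge0_le0 (ltW t0) (ub _ yb); lra.
  have [h1 /(ler_wpM2l (ltW eta0)) h2] := cU _ Ky; rewrite mulrDl; lra.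
have : s + eta <= s.
  by apply: smax; split=> [|x /neg]; [rewrite (ltW t0) t1|rewrite subr_le0].
by rewrite leNgt ltrDl eta0.
Qed.

End Comparison.

(** * Reduction of case (i) by reflection, and conclusion *)

Section Reflection.
Variables (R : realType) (n : nat) (O : set 'rV[R]_n) (F : NLop R n).

Definition reflect_op : NLop R n := fun M p z x => - F (- M) (- p) (- z) x.

Lemma reflect_F1 : cond_F1 F O -> cond_F1 reflect_op O.
Proof.
move=> HF K K0; have [om [nu [omP nuP H]]] := HF K K0.
exists om, nu; split=> // M p z x y sM Ox Oy pK zK.
rewrite /reflect_op -opprD normrN -(normrN M); apply: H; rewrite ?normrN //.
by rewrite /Defs.symmetric linearN /= sM.
Qed.

(** Negation reverses differences, so the hypothesis is used at the negated arguments in exchanged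
    order. The matrix [- N - (- M)] is again [M - N], and both Pucci bounds reappear unchanged, with
    no duality between them. *)
Lemma reflect_F2 (d1 d0 gam Gam : R) : cond_F2 F O d1 d0 gam Gam ->
  cond_F2 reflect_op O d1 d0 gam Gam.
Proof.
move=> [d10 d00 gam0 gG H]; split=> // M N p q z w x sM sN Ox.
have sM' : Defs.symmetric (- M) by rewrite /Defs.symmetric linearN /= sM.
have sN' : Defs.symmetric (- N) by rewrite /Defs.symmetric linearN /= sN.
have := H (- N) (- M) (- q) (- p) (- w) (- z) x sN' sM' Ox.
by rewrite /reflect_op !opprK (addrC (- N)) (addrC (- q)) (addrC (- w)) (addrC (- F _ _ _ _)).
Qed.

Lemma reflect_F3 : cond_F3 F O -> cond_F3 reflect_op O.
Proof.
move=> H t M p z x t0 sM Ox; rewrite /reflect_op -(mulrN t z) -(scalerN t M) -(scalerN t p) H ?mulrN //.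
by rewrite /Defs.symmetric linearN /= sM.
Qed.

Lemma reflect_jet_sub (v f : 'rV[R]_n -> R) : jet_super F O v f ->
  jet_sub reflect_op O (fun x => - v x) (fun x => - f x).
Proof.
move=> H x0 p M Ox sM nv; rewrite /reflect_op opprK lerN2; apply: H => //.
  by rewrite linearN /= sM.
by apply: filterS nv => y; rewrite qformN; lra.
Qed.

Lemma reflect_jet_super (u f : 'rV[R]_n -> R) : jet_sub F O u f ->
  jet_super reflect_op O (fun x => - u x) (fun x => - f x).
Proof.
move=> H x0 p M Ox sM nu; rewrite /reflect_op opprK lerN2; apply: H => //.
  by rewrite linearN /= sM.
by apply: filterS nu => y; rewrite qformN; lra.
Qed.

End Reflection.

Theorem theorem3p3 (R : realType) (n : nat) (Omega : set 'rV[R]_n)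
  (F : 'M[R]_n -> 'rV[R]_n -> R -> 'rV[R]_n -> R) (d1 d0 gam Gam : R)
  (u v f : 'rV[R]_n -> R) (xt : 'rV[R]_n) :
  smooth_bounded_domain Omega -> connected Omega ->
  cond_F1 F Omega -> cond_F2 F Omega d1 d0 gam Gam -> cond_F3 F Omega ->
  {within closure Omega, continuous u} ->
  {within closure Omega, continuous v} ->
  {within Omega, continuous f} ->
  visc_sub F Omega u f -> visc_super F Omega v f ->
  Omega xt -> v xt < u xt ->
  ((forall x, Omega x -> f x <= 0 /\ u x < 0) /\
     (forall x, bdry Omega x -> 0 <= v x)) \/
  ((forall x, Omega x -> 0 <= f x /\ 0 < v x) /\
     (forall x, bdry Omega x -> u x <= 0)) ->
  exists2 t : R, 0 < t & forall x, closure Omega x -> v x = t * u x.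
Proof.
move=> sO kO HF1 HF2 HF3 cu cv cf Vu Vv Ot vut.
have Hu : jet_sub F Omega u f by move=> x0 p M; exact: visc_sub_quad.
have Hv : jet_super F Omega v f by move=> x0 p M; exact: visc_super_quad.
case=> [[fu vb]|[fv ub]]; last exact: (proportional_of_positive sO kO HF1 HF2 HF3 cu cv cf Hu Hv Ot vut fv ub).
have cN (A : set 'rV[R]_n) (g : 'rV[R]_n -> R) : {within A, continuous g} ->
    {within A, continuous (fun x => - g x)}.
  by move=> cg x; exact: (continuousN (cg x)).
have uvN : - u xt < - v xt by rewrite ltrN2.
have fuN x : Omega x -> 0 <= - f x /\ 0 < - u x by move=> /fu[h1 h2]; rewrite oppr_ge0 oppr_gt0.
have vbN x : bdry Omega x -> - v x <= 0 by move=> /vb; rewrite oppr_le0.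
have [t t0 tE] := proportional_of_positive sO kO (reflect_F1 HF1) (reflect_F2 HF2)
  (reflect_F3 HF3) (cN _ _ cv) (cN _ _ cu) (cN _ _ cf) (reflect_jet_sub Hv)
  (reflect_jet_super Hu) Ot uvN fuN vbN.
exists t^-1 => [|x cx]; first by rewrite invr_gt0.
have := tE x cx; rewrite mulrN => /oppr_inj ->.
by rewrite mulKf // gt_eqF.
Qed.
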